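(* Let $\beta_1,\beta_2$ satisfy $0<\beta_2\le 1\le\beta_1<2\beta_2$. There exist compactly supported $(\omega_0,\rho_0)\in K^\infty((0,1))\times K^\infty((0,1))$ such that the corresponding solution of $$\partial_t\omega+u\,\partial_x\omega=\frac{\rho}{x},\qquad \partial_t\rho+u\,\partial_x\rho=0,$$ $$u(x,t)=x\int_{\min(\beta_2x,1)}^{\min(\beta_1x,1)}\frac{\omega(y,t)}{y}\,dy-x\int_{\min(\beta_1x,1)}^{1}\frac{\omega(y,t)}{y}\,dy,$$ $$\omega(x,0)=\omega_0(x),\qquad \rho(x,0)=\rho_0(x),$$ blows up in finite time in the sense that $$\int_0^{T}\|\omega(\cdot,t)\|_{L^\infty}dt=\infty,\qquad \int_0^{T}\|\partial_x\rho(\cdot,t)\|_{L^\infty}dt=\infty,\qquad \int_0^{T}\|\partial_x u(\cdot,t)\|_{L^\infty}dt=\infty$$ for some $T\in(0,\infty)$.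
   Context: For an integer $n\ge 1$, $K^n((0,1))$ is the space of $C^n$ functions $f$ compactly supported in $(0,1)$, with size measured by $\|f\|_{K^n}:=\|f\|_{C^n}+(\min\{x: x\in\operatorname{supp}(f)\})^{-1}$ (for $f\equiv0$ the second term is understood to be $0$), and $K^\infty((0,1))=\bigcap_{n\ge1}K^n((0,1))$. The unknowns $\omega(x,t),\rho(x,t)$ are scalar functions of one space variable; the meaningful evolution takes place on $x\in(0,1)$. ''The corresponding solution'' is the regular solution, continuous in time with values in $K^n((0,1))\times K^n((0,1))$, starting from $(\omega_0,\rho_0)$. *)

(* Defs.v *)
From mathcomp Require Import all_boot all_order all_algebra.
From mathcomp Require Import all_classical all_reals all_analysis.
Import Order.TTheory GRing.Theory Num.Theory.
Import numFieldNormedType.Exports.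

Set Implicit Arguments.
Unset Strict Implicit.
Unset Printing Implicit Defensive.

Local Open Scope ring_scope.
Local Open Scope classical_set_scope.

Section Spaces.
Context {R : realType}.
Implicit Types (n : nat) (T : R) (f : R -> R) (F : R -> R -> R).

(* A function compactly supported in (0,1) is represented by its extension by
   zero to the whole line. *)
Definition supp f : set R := closure [set x | f x != 0].

Definition isCn n f : Prop :=
  (forall k, (k < n)%N -> forall x : R, derivable (derive1n k f) x 1) /\
  continuous (derive1n n f).

Definition inK n f : Prop :=
  [/\ isCn n f, compact (supp f) & supp f `<=` `]0, 1[].

Definition inKoo f : Prop := forall n, (1 <= n)%N -> inK n f.

Definition Cnorm n f : \bar R :=
  (\sum_(k < n.+1) ereal_sup [set `|derive1n k f x|%:E | x in `]0%R, 1%R[])%E.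

(* The infimum of the support is its minimum when f is in K^n and f is not
   identically zero; for f = 0 the second term is 0, since inf set0 = 0 and
   0^-1 = 0. *)
Definition Ksize n f : \bar R := (Cnorm n f + ((inf (supp f))^-1)%:E)%E.

(* Continuity on [0,T) with values in K^n.  Since Ksize is not a norm,
   continuity is meant in the C^n norm, with Ksize bounded on every [0,T'],
   T' < T (i.e. the supports stay away from 0 locally uniformly in time). *)
Definition continuous_in_K n T F : Prop :=
  [/\ forall t : R, 0 <= t < T -> inK n (F t),
      forall t0 : R, 0 <= t0 < T ->
        Cnorm n (F t \- F t0) @[t --> within `[0, T[ (nbhs t0)] --> 0%E
    & forall T' : R, 0 <= T' < T ->
        exists M : R, forall t : R, 0 <= t <= T' -> (Ksize n (F t) <= M%:E)%E].

Definition Linfty f : \bar R :=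
  ('N[mrestr (@lebesgue_measure R) (measurable_itv (`]0, 1[)%R)]_+oo
     [EFin \o f])%E.

End Spaces.

Section Equation.
Context {R : realType}.
Local Notation mu := (@lebesgue_measure R).

Definition velocity (b1 b2 : R) (w : R -> R) (x : R) : R :=
  x * \int[mu]_(y in `[Num.min (b2 * x) 1, Num.min (b1 * x) 1]) (w y / y)
  - x * \int[mu]_(y in `[Num.min (b1 * x) 1, 1]) (w y / y).

(* w t and r t are the profiles at time t: w t x stands for w(x,t). *)
Definition regular_solution (b1 b2 : R) (n : nat) (T : R) (w0 r0 : R -> R)
    (w r : R -> R -> R) : Prop :=
  let u t := velocity b1 b2 (w t) in
  [/\ continuous_in_K n T w /\ continuous_in_K n T r,
      forall x t : R, 0 < x < 1 -> 0 < t < T ->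
        [/\ derivable (w^~ x) t 1, derivable (r^~ x) t 1,
            derive1 (w^~ x) t + u t x * derive1 (w t) x = r t x / x
          & derive1 (r^~ x) t + u t x * derive1 (r t) x = 0],
      w 0 = w0
    & r 0 = r0].

Definition blows_up_at (b1 b2 T : R) (w r : R -> R -> R) : Prop :=
  [/\ (\int[mu]_(t in `]0%R, T[) Linfty (w t) = +oo)%E,
      (\int[mu]_(t in `]0%R, T[) Linfty (derive1 (r t)) = +oo)%E
    & (\int[mu]_(t in `]0%R, T[) Linfty (derive1 (velocity b1 b2 (w t))) = +oo)%E].

End Equation.

(* Main.v *)
Require Import Defs.
From mathcomp Require Import all_boot all_order all_algebra.
From mathcomp Require Import all_classical all_reals all_analysis.
From mathcomp Require Import ess_sup_inf ring lra.
Import Order.TTheory GRing.Theory Num.Theory numFieldNormedType.Exports.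
Set Implicit Arguments.
Unset Strict Implicit.
Unset Printing Implicit Defensive.
Local Open Scope classical_set_scope.
Local Open Scope ring_scope.

(* In the variable z = - ln x, with a = ln b1, b = - ln b2 and W the primitive in z of omega that
   vanishes near z = 0, both unknowns are transported with speed V(z) = 2 W(z - a) - W(z + b).
   Along the flow P(t, z) the density keeps its initial value r0(z),
   omega(t, P(t, z)) = w0(z) + r0(z) \int_0^t exp(P(s, z)) ds, and L = ln d_z P satisfies
   d_t L = 2 omega(P - a) - omega(P + b).

   If omega grows in space no faster than e^(g z), with g slightly above 1, then
   2 omega(P - a) - omega(P + b) >= kap omega(P) with kap = 2 e^(-g a) - e^(g b), and kap > 0
   because b1 < 2 b2. The growth bound is propagated by a continuity argument on times < 1/16, for
   data that are plateaus, the one of rho having a small height eta. With kap > 0 the particles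
   move to +oo (that is, x to 0) in a cascade: at time (1 - 2^-k)/16 those beyond the label
   r - 2^-k have passed r - 2 + 3k, and then L exceeds 6 2^k on the next interval of labels, of
   length 2^-k/2. Hence the solution lives for less than 1/16.

   The solution is built globally in a new time s, in which the speed of the clock decreases with
   the position of the front, as the fixed point of a contraction in P; the original time th(s) is
   bounded, so that th(+oo) is the blow-up time T. If one of the three integrals were finite,
   L or the position of the front would be bounded, and th would not be bounded. As all regular
   solutions with the same data coincide on [0, T), it is enough to exhibit one that blows up. *)

(** * Real calculus and joint continuity *)

Section Calculus.
Context {R : realType}.
Implicit Types (f g : R -> R) (a b c x y l m : R).
Local Notation mu := (@lebesgue_measure R).

(** Room for [g]. The source [rho / x] is [rho * e^z], so omega must be allowed to grow like [e^z],
    and the errors of the argument raise the exponent to [g = e^ep + ep]. As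
    [kap = e^(-g a) (2 - e^(g (a + b)))] and [e^(a + b) = b1 / b2 < 2], a small [ep] is affordable.
    The obstacle is a circle: the growth bound needs L to be almost nondecreasing in time, and this
    monotonicity comes from the growth bound. [boot] carries both. The labels are laid out for it:
    [w0] rises on [2, 3], [r0] on [6, 7], and both fall on [r, r + 1]. On [6, 7] omega is at least 1
    and absorbs the slope of [r0]; the gap from 3 to 6 keeps the shift by [a <= 1] inside the region
    of growth control. Left of label 7 the rate of L is at most 4, which costs 1/4 over a time 1/16.
    The constants are chosen in the order [ep] (from [a + b]), [eta] (from [ep]), [r] (from [eta]).
    The clock s is slowed by [e^(- front)], so that the source seen in s is bounded on the support
    of [r0]: the flow exists for all s, and neither a continuation criterion nor advance knowledge
    of T is required. *)

Definition der f x l := is_derive x 1 f l.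

Lemma der_eq f x l l' : l = l' -> der f x l -> der f x l'.
Proof. by move=> ->. Qed.

Lemma der_unique f x l l' : der f x l -> der f x l' -> l = l'.
Proof. by move=> [_ <-] [_ <-]. Qed.

Lemma der_add f g x l m : der f x l -> der g x m ->
  der (fun x => f x + g x) x (l + m).
Proof. by rewrite /der => ? ?; apply: is_deriveD. Qed.

Lemma der_sub f g x l m : der f x l -> der g x m ->
  der (fun x => f x - g x) x (l - m).
Proof. by rewrite /der => ? ?; apply: is_deriveB. Qed.

Lemma der_opp f x l : der f x l -> der (fun x => - f x) x (- l).
Proof. by rewrite /der => ?; apply: is_deriveN. Qed.

Lemma der_mul f g x l m : der f x l -> der g x m ->
  der (fun x => f x * g x) x (l * g x + f x * m).
Proof.
rewrite /der => df dg; have := @is_deriveM _ _ f g x 1 l m df dg.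
by rewrite addrC (mulrC l).
Qed.

Lemma der_cst c x : der (fun=> c) x 0.
Proof. exact: is_derive_cst. Qed.

Lemma der_id x : der id x 1.
Proof. exact: is_derive_id. Qed.

Lemma der_cmul c f x l : der f x l -> der (fun x => c * f x) x (c * l).
Proof. by move=> df; have := der_mul (der_cst c x) df; rewrite mul0r add0r. Qed.

Lemma der_comp f g x l m : der f (g x) l -> der g x m ->
  der (fun x => f (g x)) x (m * l).
Proof. by rewrite /der mulrC => ? ?; apply: is_derive1_comp. Qed.

Lemma der_exp f x l : der f x l -> der (fun x => expR (f x)) x (l * expR (f x)).
Proof. by apply: der_comp; exact: is_derive_expR. Qed.

Lemma der_inv f x l : f x != 0 -> der f x l ->
  der (fun x => (f x)^-1) x (- l / (f x) ^+ 2).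
Proof.
move=> f0; rewrite /der => df; have := @is_deriveV _ f x l 1 f0 df.
by apply: der_eq; rewrite /GRing.scale/= !mulNr mulrC.
Qed.

Lemma der_ext f g x l : f =1 g -> der f x l -> der g x l.
Proof. by move=> /funext ->. Qed.

Lemma der_near f g x l : (\near x, f x = g x) -> der f x l -> der g x l.
Proof. exact: near_eq_is_derive. Qed.

Lemma der_cont f x l : der f x l -> {for x, continuous f}.
Proof. by move=> [d _]; apply/differentiable_continuous/derivable1_diffP. Qed.

Lemma mvt f f' a b : a <= b ->
  (forall x, a <= x <= b -> der f x (f' x)) ->
  exists2 c, a <= c <= b & f b - f a = f' c * (b - a).
Proof.
move=> ab df; have [||c] := @MVT_segment R f f' a b ab.
- by move=> x /[!in_itv]/= /andP[? ?]; apply: df; rewrite !ltW.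
- apply: continuous_in_subspaceT => x /[!inE]/= /[!in_itv]/= /df.
  exact: der_cont.
- by rewrite in_itv => cab E; exists c.
Qed.

Lemma mvt_bound f f' a b C : a <= b ->
  (forall x, a <= x <= b -> der f x (f' x)) ->
  (forall x, a <= x <= b -> `|f' x| <= C) -> `|f b - f a| <= C * (b - a).
Proof.
move=> ab df bf; have [c cab ->] := mvt ab df.
by rewrite normrM (ger0_norm (x := b - a)) ?subr_ge0// ler_wpM2r ?subr_ge0// bf.
Qed.

Lemma mvt_ge f f' a b C : a <= b ->
  (forall x, a <= x <= b -> der f x (f' x)) ->
  (forall x, a <= x <= b -> C <= f' x) -> C * (b - a) <= f b - f a.
Proof.
move=> ab df bf; have [c cab ->] := mvt ab df.
by rewrite ler_wpM2r ?subr_ge0// bf.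
Qed.

Lemma mvt_le f f' a b C : a <= b ->
  (forall x, a <= x <= b -> der f x (f' x)) ->
  (forall x, a <= x <= b -> f' x <= C) -> f b - f a <= C * (b - a).
Proof.
move=> ab df bf; have [c cab ->] := mvt ab df.
by rewrite ler_wpM2r ?subr_ge0// bf.
Qed.

Lemma mvt_dist f f' a b C :
  (forall x, Num.min a b <= x <= Num.max a b -> der f x (f' x)) ->
  (forall x, Num.min a b <= x <= Num.max a b -> `|f' x| <= C) ->
  `|f b - f a| <= C * `|b - a|.
Proof.
have [ab df bf|ba df bf] := leP a b.
  by rewrite (ger0_norm (x := b - a)) ?subr_ge0//; apply: mvt_bound bf.
rewrite distrC (distrC b) (ger0_norm (x := a - b)) ?subr_ge0 ?(ltW ba)//.
by apply: mvt_bound bf => //; exact: ltW.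
Qed.

(** Estimates integrated in time are obtained below in this differentiated form: both sides are
    compared through their derivatives, without manipulating integrals. *)
Lemma mono_diff f f' g g' a b : a <= b ->
  (forall x, a <= x <= b -> der f x (f' x)) ->
  (forall x, a <= x <= b -> der g x (g' x)) ->
  (forall x, a <= x <= b -> f' x <= g' x) -> f b - f a <= g b - g a.
Proof.
move=> ab df dg fg.
have : 0 * (b - a) <= (g \- f) b - (g \- f) a.
  apply: (@mvt_ge _ (fun x => g' x - f' x)) => // x xab.
    by apply: der_sub; [exact: dg|exact: df].
  by rewrite subr_ge0 fg.
by rewrite mul0r /=; lra.
Qed.

Lemma derive0_eq f a b : (forall x, der f x 0) -> f a = f b.
Proof.
move=> df; apply/eqP; rewrite -subr_eq0 -normr_le0.
rewrite -(mul0r `|a - b|); apply: (mvt_dist (f' := fun=> 0)) => // x _.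
by rewrite normr0.
Qed.

Lemma cont_integrable f a b : continuous f ->
  mu.-integrable `[a, b] (EFin \o f).
Proof.
move=> cf; apply: continuous_compact_integrable; first exact: segment_compact.
by apply: continuous_subspaceT.
Qed.

(** Oriented integral. The sign for [x < a] makes it differentiable on the whole line; the time s of
    the fixed-point problem runs over all of R. *)
Definition prim f a x : R :=
  if a <= x then \int[mu]_(t in `[a, x]) f t
  else - \int[mu]_(t in `[x, a]) f t.

Lemma prim_refl f a : prim f a a = 0.
Proof. by rewrite /prim lexx set_itv1 Rintegral_set1. Qed.

Lemma itv_split f a b c : continuous f -> a <= b -> b <= c ->
  \int[mu]_(t in `[a, c]) f t =
  \int[mu]_(t in `[a, b]) f t + \int[mu]_(t in `[b, c]) f t.
Proof.
move=> cf ab bc; apply/eqP; rewrite addrC -subr_eq; apply/eqP.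
rewrite Rintegral_itvB ?bnd_simp//; last exact: cont_integrable.
rewrite Rintegral_itv_obnd_cbnd//.
apply: (integrableS _ _ _ (cont_integrable b c cf)) => //.
by apply: subset_itvr; rewrite bnd_simp.
Qed.

Lemma der_prim f a x : continuous f -> der (prim f a) x (f x).
Proof.
move=> cf.
(* The fundamental theorem of calculus used below wants a base point strictly to the left of [x];
   [c] is to the left of both [a] and [x]. *)
pose c := Num.min a x - 1.
have ca : c <= a by rewrite /c; case: (leP a x); lra.
have cx : c < x by rewrite /c; case: (leP a x); lra.
have E : \forall y \near x, (fun y => \int[mu]_(t in `[c, y]) f t - \int[mu]_(t in `[c, a]) f t) y = prim f a y.
  near=> y; have cy : c <= y by near: y; near do apply: ltW; exact: lt_nbhsr.
  rewrite /prim; case: ifPn => [ay|/negP/negP]; first by rewrite (itv_split cf ca ay); lra.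
  by rewrite -ltNge => /ltW ya; rewrite (itv_split cf cy ya); lra.
apply: (der_near E).
have [d e] := @continuous_FTC1_closed R f c x (x + 1) ltac:(lra)
  (cont_integrable _ _ cf) cx (cf x).
rewrite -(subr0 (f x)); apply: der_sub; last exact: der_cst.
by split; [exact: d|rewrite -e derive1E].
Unshelve. all: by end_near. Qed.

End Calculus.

Section JointContinuity.
Context {R : realType}.
Implicit Types (f g : R -> R -> R) (s t z c e d N C : R).

Definition jc f := continuous (fun p : R * R => f p.1 p.2).

Lemma jcP f : jc f <-> forall s z e : R, 0 < e -> exists2 d : R, 0 < d &
  forall s' z', `|s' - s| < d -> `|z' - z| < d -> `|f s' z' - f s z| < e.
Proof.
split=> [cf s z e e0|H [s z]].
  have /cvgrPdist_lt /(_ e e0) := cf (s, z).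
  move=> /nbhs_ballP[d /= d0 H]; exists d => // s' z' sd zd.
  rewrite distrC; apply: (H (s', z')).
  by split; rewrite /ball/= distrC.
apply/cvgrPdist_lt => e e0; have [d d0 Hd] := H s z e e0.
apply/(@nbhs_ballP R (R * R)%type (s, z)); exists d => //= -[s' z'] [/= sd zd].
by rewrite distrC; apply: Hd; rewrite distrC.
Qed.

Lemma der_eps (f : R -> R) z l :
  (forall e : R, 0 < e -> exists2 d : R, 0 < d &
     forall h, `|h| < d -> `|f (z + h) - f z - l * h| <= e * `|h|) ->
  der f z l.
Proof.
move=> H.
have cv : h^-1 *: ((f \o shift z) (h *: 1) - f z) @[h --> 0^'] --> l.
  apply/cvgrPdist_le => e e0; have [d d0 Hd] := H e e0.
  rewrite /at_right/dnbhs/within; near_simpl; apply/nbhs_ballP; exists d => //= h.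
  rewrite /ball/= sub0r normrN => hd h0; have := Hd h hd.
  have hp : 0 < `|h| by rewrite normr_gt0.
  rewrite -(ler_pM2r (x := `|h|^-1)) ?invr_gt0// mulfK ?gt_eqF// -normrV ?unitfE// -normrM.
  rewrite distrC; apply: le_trans; rewrite le_eqVlt; apply/orP; left; apply/eqP.
  congr Num.norm; rewrite /GRing.scale/= mulr1 (addrC h).
  by rewrite [in RHS]mulrBl mulfK// mulrC.
by split; [apply: cvgP cv|apply: cvg_lim cv].
Unshelve. all: by end_near. Qed.

Lemma jc_cont1 f z : jc f -> continuous (f^~ z).
Proof.
move=> cf s; apply/cvgrPdist_lt => e e0; have [d d0 H] := (jcP f).1 cf s z e e0.
apply/nbhs_ballP; exists d => //= s' sd; rewrite distrC; apply: H.
  by rewrite distrC.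
by rewrite subrr normr0.
Qed.

Lemma jc_cont2 f s : jc f -> continuous (f s).
Proof.
move=> cf z; apply/cvgrPdist_lt => e e0; have [d d0 H] := (jcP f).1 cf s z e e0.
apply/nbhs_ballP; exists d => //= s' sd; rewrite distrC; apply: H.
  by rewrite subrr normr0.
by rewrite distrC.
Qed.

Lemma jc_swap f : jc f -> jc (fun s z => f z s).
Proof.
move=> /jcP cf; apply/jcP => s z e e0; have [d d0 H] := cf z s e e0.
by exists d => // s' z' sd zd; apply: H.
Qed.

Lemma jc_comp f g h : jc f -> jc g -> jc h -> jc (fun s z => f (g s z) (h s z)).
Proof.
move=> /jcP cf /jcP cg /jcP ch; apply/jcP => s z e e0.
have [d d0 H] := cf (g s z) (h s z) e e0.
have [d1 d10 H1] := cg s z d d0; have [d2 d20 H2] := ch s z d d0.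
exists (Num.min d1 d2); first by rewrite lt_min d10.
move=> s' z'; rewrite !lt_min => /andP[? ?] /andP[? ?].
by apply: H; [exact: H1|exact: H2].
Qed.

Lemma jc_c1 (k : R -> R) f : continuous k -> jc f -> jc (fun s z => k (f s z)).
Proof. by move=> ck cf [s z]; apply: continuous_comp; [exact: cf|exact: ck]. Qed.

Lemma jc_fst : jc (fun s _ => s).
Proof. by move=> [s z]; exact: cvg_fst. Qed.

Lemma jc_snd : jc (fun _ z => z).
Proof. by move=> [s z]; exact: cvg_snd. Qed.

Lemma jc_t (k : R -> R) : continuous k -> jc (fun s _ => k s).
Proof. by move=> ck; apply: jc_c1 => //; exact: jc_fst. Qed.

Lemma jc_x (k : R -> R) : continuous k -> jc (fun _ z => k z).
Proof. by move=> ck; apply: jc_c1 => //; exact: jc_snd. Qed.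

Lemma jc_cst c : jc (fun _ _ => c).
Proof. by move=> p; exact: cvg_cst. Qed.

Lemma jc_add f g : jc f -> jc g -> jc (fun s z => f s z + g s z).
Proof. by move=> cf cg p; apply: cvgD; [exact: cf|exact: cg]. Qed.

Lemma jc_opp f : jc f -> jc (fun s z => - f s z).
Proof. by move=> cf p; apply: cvgN; exact: cf. Qed.

Lemma jc_sub f g : jc f -> jc g -> jc (fun s z => f s z - g s z).
Proof. by move=> cf cg; apply: jc_add => //; exact: jc_opp. Qed.

Lemma jc_mul f g : jc f -> jc g -> jc (fun s z => f s z * g s z).
Proof. by move=> cf cg p; apply: cvgM; [exact: cf|exact: cg]. Qed.

Lemma jc_ext f g : (forall s z, f s z = g s z) -> jc f -> jc g.
Proof. by move=> fg; have -> : f = g by apply/funext => s; apply/funext => z. Qed.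

Lemma jc_unif f N e : jc f -> 0 < e -> exists2 d : R, 0 < d &
  forall s z s' z' : R, `|s| <= N -> `|z| <= N -> `|s' - s| < d -> `|z' - z| < d ->
  `|f s' z' - f s z| < e.
Proof.
move=> /jcP cf e0.
have cK : compact (`[-N, N]%classic `*` `[-N, N]%classic : set (R * R)).
  by apply: compact_setX; exact: segment_compact.
pose P (d : R) (p : R * R) := forall s' z',
  `|s' - p.1| < d -> `|z' - p.2| < d -> `|f s' z' - f p.1 p.2| < e.
have : \forall d \near 0^'+, `[-N, N]%classic `*` `[-N, N]%classic `<=` P d.
  move/compact_near_coveringP : cK; apply => -[s z] _.
  have e20 : 0 < e / 2 by rewrite divr_gt0.
  have [r r0 H] := cf s z (e / 2) e20.
  have r20 : 0 < r / 2 by rewrite divr_gt0.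
  exists (ball (s, z) (r / 2), [set d | 0 < d < r / 2]).
    split; first by apply/nbhs_ballP; exists (r / 2).
    near=> d; apply/andP; split => //.
  move=> [[s1 z1] d] /= [[/= bs bz] /andP[d0 dr]] s' z' /= sd zd.
  rewrite /ball/= in bs bz.
  have h1 : `|f s1 z1 - f s z| < e / 2.
    by apply: H; rewrite distrC; [move: bs|move: bz]; lra.
  have h2 : `|f s' z' - f s z| < e / 2.
    by apply: H; [have := ler_distD s1 s' s; rewrite (distrC s1 s)|
      have := ler_distD z1 z' z; rewrite (distrC z1 z)]; lra.
  have := ler_distD (f s z) (f s' z') (f s1 z1).
  by rewrite (distrC (f s z) (f s1 z1)); lra.
move=> H; near (0 : R)^'+ => d.
exists d => // s z s' z' sN zN sd zd.
have HH : `[-N, N]%classic `*` `[-N, N]%classic `<=` P d by near: d.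
by apply: (HH (s, z)) => //=; rewrite !in_itv/= -!ler_norml.
Unshelve. all: by end_near. Qed.

Lemma jc_bound f N : jc f -> exists2 C : R, 0 <= C &
  forall s z, `|s| <= N -> `|z| <= N -> `|f s z| <= C.
Proof.
move=> cf; have [N0|N0] := leP 0 N; last first.
  by exists 0 => // s z sN; have := normr_ge0 s; lra.
have cK : compact (`[-N, N]%classic `*` `[-N, N]%classic : set (R * R)).
  by apply: compact_setX; exact: segment_compact.
have [||c _ H] := @compact_EVT_max _ _ (fun p : R * R => `|f p.1 p.2|) _ _ cK.
- by exists (0, 0); split => /=; rewrite in_itv/=; lra.
- apply: continuous_subspaceT => p; apply: continuous_comp; first exact: cf.
  exact: norm_continuous.
- exists `|f c.1 c.2| => // s z sN zN; apply: (H (s, z)).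
  by rewrite inE; split; rewrite /= in_itv/= -ler_norml.
Qed.

Lemma prim_lip f N C (c t t' z : R) : jc f ->
  (forall s, `|s| <= N -> `|f s z| <= C) -> `|t| <= N -> `|t'| <= N ->
  `|prim (f^~ z) c t' - prim (f^~ z) c t| <= C * `|t' - t|.
Proof.
move=> cf bf tN t'N; apply: (@mvt_dist _ _ (f^~ z)) => x xtt.
  by apply: der_prim; exact: jc_cont1.
apply: bf; move: tN t'N xtt; rewrite !ler_norml.
by case: (leP t t') => ? /andP[? ?] /andP[? ?] /andP[? ?]; apply/andP; split; lra.
Qed.

Lemma prim_diff_le (f g : R -> R) c t C : continuous f -> continuous g ->
  (forall s, Num.min c t <= s <= Num.max c t -> `|f s - g s| <= C) ->
  `|prim f c t - prim g c t| <= C * `|t - c|.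
Proof.
move=> cf cg fg.
have := @mvt_dist _ (fun x => prim f c x - prim g c x) (fun x => f x - g x) c t C.
rewrite !prim_refl !subr0; apply => // x _.
by apply: der_sub; exact: der_prim.
Qed.

Lemma minmax_norm (c t N x : R) : `|c| <= N -> `|t| <= N ->
  Num.min c t <= x <= Num.max c t -> `|x| <= N.
Proof.
rewrite !ler_norml => /andP[? ?] /andP[? ?].
by case: (leP c t) => ? /andP[? ?]; apply/andP; split; lra.
Qed.

Lemma jc_prim f c : jc f -> jc (fun t z => prim (f^~ z) c t).
Proof.
move=> cf; apply/jcP => t z e e0.
pose N := `|t| + `|z| + `|c| + 1.
have [C C0 bf] := jc_bound N cf.
pose M := `|t - c| + 1; have M0 : 0 < M by rewrite /M; have := normr_ge0 (t - c); lra.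
have e' : 0 < e / (2 * M) by rewrite divr_gt0// mulr_gt0.
have [d d0 uf] := jc_unif N cf e'.
have C1 : 0 < e / (2 * (C + 1)) by rewrite divr_gt0// mulr_gt0//; lra.
exists (Num.min (Num.min 1 d) (e / (2 * (C + 1)))); first by rewrite !lt_min d0 C1 ltr01.
have nz := normr_ge0 z; have nt := normr_ge0 t; have nc := normr_ge0 c.
move=> t' z'; rewrite !lt_min => /andP[/andP[t1 td] tC] /andP[/andP[z1 zd] zC].
have tN : `|t| <= N by rewrite /N; lra.
have zN : `|z| <= N by rewrite /N; lra.
have cN : `|c| <= N by rewrite /N; lra.
have z'N : `|z'| <= N.
  have := ler_normD (z' - z) z; rewrite subrK /N; lra.
have t'N : `|t'| <= N.
  have := ler_normD (t' - t) t; rewrite subrK /N; lra.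
have h1 : `|prim (f^~ z') c t' - prim (f^~ z') c t| < e / 2.
  apply: (@le_lt_trans _ _ (C * `|t' - t|)).
    by apply: (@prim_lip _ N) => // s sN; exact: bf.
  apply: (@le_lt_trans _ _ ((C + 1) * `|t' - t|)).
    by rewrite ler_wpM2r//; lra.
  move: tC; rewrite -(ltr_pM2l (x := C + 1)); last lra.
  move=> /lt_le_trans; apply; rewrite le_eqVlt; apply/orP; left; apply/eqP.
  field; lra.
have h2 : `|prim (f^~ z') c t - prim (f^~ z) c t| <= e / 2.
  apply: (@le_trans _ _ (e / (2 * M) * `|t - c|)).
    apply: prim_diff_le; [exact: jc_cont1|exact: jc_cont1|].
    move=> s /(minmax_norm cN tN) sN; apply/ltW/uf => //.
    by rewrite subrr normr0.
  apply: (@le_trans _ _ (e / (2 * M) * M)).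
    by rewrite ler_wpM2l ?(ltW e')// /M; lra.
  rewrite le_eqVlt; apply/orP; left; apply/eqP; field; lra.
have := ler_distD (prim (f^~ z') c t) (prim (f^~ z') c t') (prim (f^~ z) c t).
by lra.
Qed.

Lemma jc_prim2 f c : jc f -> jc (fun t z => prim (f t) c z).
Proof. by move=> cf; apply: (@jc_swap (fun z t => prim (f t) c z)); apply: (@jc_prim (fun z t => f t z)); exact: jc_swap. Qed.

End JointContinuity.

Section PrimPar.
Context {R : realType}.
Implicit Types (f g : R -> R -> R) (s t z c e d N C : R).
(** Leibniz rule. The remainder [f s (z + h) - f s z - g s z * h] is integrated as one function of
    s; by the mean value inequality and the uniform continuity of [g] it is at most a small multiple
    of [|h|], uniformly in s. *)
Lemma der_prim_par f g c t z : jc f -> jc g ->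
  (forall s z, der (f s) z (g s z)) ->
  der (fun z => prim (f^~ z) c t) z (prim (g^~ z) c t).
Proof.
move=> cf cg dfg.
have ct := normr_ge0 (t - c).
have nz := normr_ge0 z; have nt := normr_ge0 t; have nc := normr_ge0 c.
apply: der_eps => e e0.
pose N := `|t| + `|z| + `|c|.
have M0 : 0 < `|t - c| + 1 by lra.
have e' : 0 < e / (`|t - c| + 1) by rewrite divr_gt0.
have [d d0 uf] := jc_unif N cg e'.
exists d => // h hd.
(* Linearity of the integral, obtained by differentiating the difference of both sides in the upper
   limit. *)
have E : prim (fun s => f s (z + h) - f s z - g s z * h) c t =
    prim (f^~ (z + h)) c t - prim (f^~ z) c t - prim (g^~ z) c t * h.
  pose F x := prim (fun s => f s (z + h) - f s z - g s z * h) c x -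
    (prim (f^~ (z + h)) c x - prim (f^~ z) c x - h * prim (g^~ z) c x).
  have : F t = F c.
    apply: derive0_eq => x.
    rewrite -(subrr (f x (z + h) - f x z - g x z * h)).
    apply: der_sub.
      apply: (@der_prim _ (fun s => f s (z + h) - f s z - g s z * h)).
      apply: (@jc_cont1 _ (fun s z => f s (z + h) - f s z - g s z * h)).
      apply: jc_sub; last by apply: jc_mul => //; exact: jc_cst.
      apply: jc_sub => //; apply: (jc_comp cf jc_fst).
      by apply: jc_add; [exact: jc_snd|exact: jc_cst].
    apply: der_sub; first by apply: der_sub; apply: der_prim; exact: jc_cont1.
    by rewrite (mulrC (g x z)); apply: der_cmul; apply: der_prim; exact: jc_cont1.
  by rewrite /F !prim_refl; lra.
rewrite -E.
have := @prim_diff_le _ (fun s => f s (z + h) - f s z - g s z * h) (cst 0) c t (e / (`|t - c| + 1) * `|h|).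
have -> : prim (cst 0 : R -> R) c t = 0.
  rewrite -[RHS](prim_refl (cst 0 : R -> R) c); apply: derive0_eq => x.
  by apply: (@der_prim _ (cst 0)); exact: cst_continuous.
rewrite subr0 => H; apply: (le_trans (H _ _ _)).
- apply: (@jc_cont1 _ (fun s z => f s (z + h) - f s z - g s z * h)).
  apply: jc_sub; last by apply: jc_mul => //; exact: jc_cst.
  apply: jc_sub => //; apply: (jc_comp cf jc_fst).
  by apply: jc_add; [exact: jc_snd|exact: jc_cst].
- exact: cst_continuous.
- move=> s sct; rewrite subr0.
  have sN : `|s| <= N.
    by apply: (minmax_norm _ _ sct); rewrite /N; lra.
  have := @mvt_dist _ (fun y => f s y - g s z * y) (fun y => g s y - g s z) z (z + h) (e / (`|t - c| + 1)).
  rewrite [z + h - z]addrC addKr.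
  have -> : f s (z + h) - g s z * (z + h) - (f s z - g s z * z) =
    f s (z + h) - f s z - g s z * h by lra.
  apply.
    move=> y _; apply: der_sub; first exact: dfg.
    by rewrite -[X in der _ _ X]mulr1; apply: der_cmul; exact: der_id.
  move=> y yz; apply/ltW/uf => //.
  + by rewrite /N; lra.
  + by rewrite subrr normr0.
  + move: yz hd; rewrite !ltr_norml.
    by case: (leP z (z + h)) => ? /andP[? ?] /andP[? ?]; apply/andP; split; lra.
- rewrite mulrAC ler_wpM2r//.
  by rewrite mulrAC ler_pdivrMr// ler_wpM2l ?(ltW e0)//; lra.
Qed.


Lemma der_prim_par2 f g c t z : jc f -> jc g ->
  (forall s z, der (f^~ z) s (g s z)) ->
  der (fun t => prim (f t) c z) t (prim (g t) c z).
Proof.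
move=> cf cg dfg.
by apply: (@der_prim_par (fun z t => f t z) (fun z t => g t z)) => //; exact: jc_swap.
Qed.

Lemma continuous_der (f : R -> R) (g : R -> R) :
  (forall x, der f x (g x)) -> continuous f.
Proof. by move=> df x; exact: der_cont (df x). Qed.

Lemma jc_unif_lim f :
  (forall (N e : R), 0 < e -> exists2 g, jc g & forall t z, `|t| <= N -> `|z| <= N -> `|f t z - g t z| <= e) ->
  jc f.
Proof.
move=> H; apply/jcP => s z e e0.
have e4 : 0 < e / 4 by rewrite divr_gt0.
have [g /jcP jg fg] := H (`|s| + `|z| + 1) _ e4.
have [d d0 Hd] := jg s z _ e4.
have nz := normr_ge0 z; have ns := normr_ge0 s.
exists (Num.min 1 d); first by rewrite lt_min ltr01.
move=> s' z'; rewrite !lt_min => /andP[s1 sd] /andP[z1 zd].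
have h1 := Hd s' z' sd zd.
have h2 : `|f s' z' - g s' z'| <= e / 4.
  by apply: fg; [have := ler_normD (s' - s) s|have := ler_normD (z' - z) z];
    rewrite subrK; lra.
have h3 : `|f s z - g s z| <= e / 4 by apply: fg; lra.
have := ler_distD (g s z) (f s' z') (f s z); have := ler_distD (g s' z') (f s' z') (g s z).
by rewrite (distrC (g s z) (f s z)); lra.
Qed.

End PrimPar.

(** * Classes of time-dependent families with k continuous space derivatives *)

Section Regularity.
Context {R : realType}.
Implicit Types (f g : R -> R -> R) (h : R -> R) (s t z c x : R) (k : nat).

(* Regularity is only demanded in the second variable; the first one is time. *)
Fixpoint Reg k f : Prop :=
  if k is k'.+1 then
    jc f /\ exists2 g, (forall t z, der (f t) z (g t z)) & Reg k' g
  else jc f.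

Lemma Reg_jc k f : Reg k f -> jc f.
Proof. by case: k => [|k] //= []. Qed.

Lemma RegW k f : Reg k.+1 f -> Reg k f.
Proof.
elim: k f => [|k IH] f; first by move=> /= [].
by move=> [jf [g dg /IH rg]]; split => //; exists g.
Qed.

Lemma Reg_ext k f g : (forall t z, f t z = g t z) -> Reg k f -> Reg k g.
Proof. by move=> fg; have -> : f = g by apply/funext => s; apply/funext => z. Qed.

Lemma Reg_t k h : continuous h -> Reg k (fun t _ => h t).
Proof.
have R0 m : Reg m (fun _ _ => 0).
  elim: m => [|m IH]; first exact: jc_cst.
  by split; [exact: jc_cst|exists (fun _ _ => 0) => // t z; exact: der_cst].
move=> ch; case: k => [|k]; first exact: jc_t.
by split; [exact: jc_t|exists (fun _ _ => 0) => // t z; exact: der_cst].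
Qed.

Lemma Reg_cst k c : Reg k (fun _ _ => c).
Proof. by apply: Reg_t => ?; exact: cst_continuous. Qed.

Lemma Reg_id k : Reg k (fun _ z => z).
Proof.
case: k => [|k]; first exact: jc_snd.
split; first exact: jc_snd.
by exists (fun _ _ => 1); [move=> t z; exact: der_id|exact: Reg_cst].
Qed.

Lemma Reg_add k f g : Reg k f -> Reg k g -> Reg k (fun t z => f t z + g t z).
Proof.
elim: k f g => [|k IH] f g; first exact: jc_add.
move=> [jf [f' df rf]] [jg [g' dg rg]]; split; first exact: jc_add.
by exists (fun t z => f' t z + g' t z); [move=> t z; exact: der_add|exact: IH].
Qed.

Lemma Reg_opp k f : Reg k f -> Reg k (fun t z => - f t z).
Proof.
elim: k f => [|k IH] f; first exact: jc_opp.
move=> [jf [f' df rf]]; split; first exact: jc_opp.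
by exists (fun t z => - f' t z); [move=> t z; exact: der_opp|exact: IH].
Qed.

Lemma Reg_sub k f g : Reg k f -> Reg k g -> Reg k (fun t z => f t z - g t z).
Proof. by move=> rf rg; apply: Reg_add => //; exact: Reg_opp. Qed.

Lemma Reg_mul k f g : Reg k f -> Reg k g -> Reg k (fun t z => f t z * g t z).
Proof.
elim: k f g => [|k IH] f g; first exact: jc_mul.
move=> rf0 rg0; have /RegW rf1 := rf0; have /RegW rg1 := rg0.
move: rf0 rg0 => [jf [f' df rf]] [jg [g' dg rg]]; split; first exact: jc_mul.
exists (fun t z => f' t z * g t z + f t z * g' t z).
  by move=> t z; exact: der_mul.
by apply: Reg_add; exact: IH.
Qed.

Lemma Reg_comp k f g : Reg k f -> Reg k g -> Reg k (fun t z => f t (g t z)).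
Proof.
elim: k f g => [|k IH] f g.
  by move=> jf jg; apply: jc_comp => //; exact: jc_fst.
move=> rf0 rg0; have /RegW rg1 := rg0.
move: rf0 rg0 => [jf [f' df rf]] [jg [g' dg rg]]; split.
  by apply: jc_comp => //; exact: jc_fst.
exists (fun t z => g' t z * f' t (g t z)).
  by move=> t z; apply: der_comp.
by apply: Reg_mul => //; exact: IH.
Qed.

Lemma jc_exp f : jc f -> jc (fun t z => expR (f t z)).
Proof. by apply: jc_c1; exact: continuous_expR. Qed.

Lemma Reg_exp k f : Reg k f -> Reg k (fun t z => expR (f t z)).
Proof.
have RE m : Reg m (fun _ z => expR z).
  elim: m => [|m IH]; first exact: jc_exp jc_snd.
  split; first exact: jc_exp jc_snd.
  by exists (fun _ z => expR z) => // t z; exact: is_derive_expR.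
by move=> rf; apply: (@Reg_comp k (fun _ z => expR z)).
Qed.

Lemma Reg_prim k f c : Reg k f -> Reg k (fun t z => prim (f^~ z) c t).
Proof.
elim: k f => [|k IH] f; first exact: jc_prim.
move=> [jf [f' df rf]]; split; first exact: jc_prim.
exists (fun t z => prim (f'^~ z) c t); last exact: IH.
by move=> t z; apply: der_prim_par => //; exact: Reg_jc rf.
Qed.

Lemma Reg_prim2 k f c : Reg k f -> Reg k.+1 (fun t z => prim (f t) c z).
Proof.
move=> rf; have jf := Reg_jc rf; split; first exact: jc_prim2.
by exists f => // t z; apply: der_prim; exact: jc_cont2.
Qed.

Definition smooth h := forall k, Reg k (fun _ => h).

Lemma smooth_cont h : smooth h -> continuous h.
Proof. by move=> /(_ 0%N) /(@jc_cont2 _ _ 0). Qed.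

Lemma smooth_der h : smooth h -> exists2 h', (forall x, der h x (h' x)) & smooth h'.
Proof.
move=> sh; have [_ [g dg _]] := sh 1%N.
exists (g 0) => [x|k]; first exact: dg.
have [_ [g' dg' rg']] := sh k.+1.
apply: Reg_ext rg' => t z; exact: der_unique (dg' t z) (dg 0 z).
Qed.

(** A class closed under differentiation consists of smooth functions: the induction on the order
    runs over all its members at once. *)
Lemma smooth_coind (P : (R -> R) -> Prop) :
  (forall h, P h -> exists2 h', (forall x, der h x (h' x)) & P h') ->
  forall h, P h -> smooth h.
Proof.
move=> H h Ph k; elim: k h Ph => [|k IH] h /[dup] Ph /H [h' dh Ph'].
  by apply: jc_x; exact: continuous_der dh.
split; first by apply: jc_x; exact: continuous_der dh.
by exists (fun _ => h') => //; exact: IH.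
Qed.

End Regularity.

(** * A smooth step function *)

Section SmoothStep.
Context {R : realType}.
Implicit Types (p q : {poly R}) (x y : R).

(** The usual flat function [e^(-1/x)] with a polynomial factor in [1/x]. With the polynomial as a
    parameter the family is closed under differentiation, so smoothness at 0 is one application of
    [smooth_coind]. *)
Definition flat p x : R := if 0 < x then p.[x^-1] * expR (- x^-1) else 0.

Lemma powX_le_exp n y : 0 <= y -> y ^+ n <= n%:R ^+ n * expR y.
Proof.
move=> y0; case: n => [|n].
  by rewrite expr0 mul1r; have := expR_ge1Dx y; lra.
have n0 : 0 < n.+1%:R :> R by rewrite ltr0n.
have -> : expR y = expR (y / n.+1%:R) ^+ n.+1.
  by rewrite -expRM_natl mulrC mulfVK// gt_eqF.
rewrite -exprMn; apply: lerXn2r; rewrite ?nnegrE ?mulr_ge0 ?expR_ge0//.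
rewrite mulrC -ler_pdivrMr//; by apply: le_trans (expR_ge1Dx _); rewrite lerDr.
Qed.

Lemma poly_le_pow q y : 1 <= y ->
  `|q.[y]| <= (\sum_(i < size q) `|q`_i|) * y ^+ size q.
Proof.
move=> y1; rewrite horner_coef mulr_suml.
apply: le_trans (ler_norm_sum _ _ _) _; apply: ler_sum => i _.
have y0 : 0 <= y by lra.
rewrite normrM ler_wpM2l// normrX ger0_norm// ler_weXn2l//.
exact: ltnW.
Qed.

(** The exponential beats one power of [1/x] more than the polynomial can produce; the spare power
    is the factor [|x|]. *)
Lemma flat_small q : exists2 C : R, 0 <= C & forall x, `|x| <= 1 -> `|flat q x| <= C * `|x|.
Proof.
pose n := size q; pose S := \sum_(i < size q) `|q`_i|.
have S0 : 0 <= S by apply: sumr_ge0.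
have N0 : 0 <= n.+1%:R ^+ n.+1 :> R by rewrite exprn_ge0.
exists (S * n.+1%:R ^+ n.+1); first by rewrite mulr_ge0.
move=> x; rewrite /flat; case: ifPn => [x0|_ _]; last first.
  by rewrite normr0 mulr_ge0// mulr_ge0.
rewrite gtr0_norm// => x1.
have y1 : 1 <= x^-1 by rewrite invf_ge1.
have y0 : 0 < x^-1 by rewrite invr_gt0.
rewrite normrM (gtr0_norm (expR_gt0 _)) expRN ler_pdivrMr ?expR_gt0//.
apply: le_trans (poly_le_pow _ y1) _.
rewrite -/n -/S -!mulrA ler_wpM2l//.
have := powX_le_exp n.+1 (ltW y0).
have E : x * x^-1 ^+ n.+1 = x^-1 ^+ n by rewrite exprS mulrA mulfV ?gt_eqF// mul1r.
move=> /(ler_wpM2l (ltW x0)); rewrite E => h.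
by apply: le_trans h _; rewrite mulrCA.
Qed.

Lemma der_flat p x : der (flat p) x (flat ((p - p^`()) * 'X^2) x).
Proof.
have [x0|x0|->] := ltgtP x 0.
- rewrite {2}/flat ltNge ltW//=.
  apply: (der_near (f := fun=> 0)); last exact: der_cst.
  near=> y; rewrite /flat ifF//; apply/negbTE; rewrite -leNgt.
  by near: y; exact: lt_le_nbhsl.
- apply: (der_near (f := fun y => p.[y^-1] * expR (- y^-1))).
    near=> y; rewrite /flat ifT//.
    by near: y; exact: lt_nbhsr.
  have xn : x != 0 by rewrite gt_eqF.
  have di : der (fun y => y^-1) x (- (x^-1) ^+ 2).
    by have := der_inv (f := id) xn (der_id x); rewrite exprVn mulNr mul1r.
  have dp : der (fun y => p.[y^-1]) x (- (x^-1) ^+ 2 * p^`().[x^-1]).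
    by apply: (@der_comp _ (horner p)) => //; exact: is_derive_poly.
  have de := der_exp (der_opp di).
  apply: der_eq (der_mul dp de).
  rewrite /flat x0 hornerM hornerD hornerN hornerXn; ring.
- rewrite {2}/flat ltxx.
  have [C C0 HC] := flat_small (p * 'X).
  apply: der_eps => e e0.
  have C1 : 0 < C + 1 by lra.
  exists (Num.min 1 (e / (C + 1))); first by rewrite lt_min ltr01 divr_gt0.
  move=> h; rewrite lt_min => /andP[h1 he].
  have -> : flat p 0 = 0 by rewrite /flat ltxx.
  rewrite add0r mul0r !subr0.
  (* The difference quotient at 0 is again a flat function, with polynomial [p * 'X], and
     [flat_small] sends it to 0. *)
  have -> : flat p h = flat (p * 'X) h * h.
    rewrite /flat; case: ifPn => h0; last by rewrite mul0r.
    by rewrite hornerMX; field; rewrite gt_eqF.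
  rewrite normrM ler_wpM2r//; apply: le_trans (HC _ (ltW h1)) _.
  have : (C + 1) * `|h| < e by rewrite mulrC -ltr_pdivlMr.
  by have := normr_ge0 h; lra.
Unshelve. all: by end_near. Qed.

Lemma smooth_flat p : smooth (flat p).
Proof.
apply: (@smooth_coind _ (fun h => exists q, h = flat q)); last by exists p.
move=> _ [q ->]; exists (flat ((q - q^`()) * 'X^2)); last by eexists.
by move=> x; exact: der_flat.
Qed.

Lemma smooth_step : exists sg sg' : R -> R, exists C : R,
  [/\ smooth sg, (forall x, der sg x (sg' x)),
   (forall x, x <= 0 -> sg x = 0 /\ sg' x = 0),
   (forall x, 1 <= x -> sg x = 1 /\ sg' x = 0) &
   (forall x, [/\ 0 <= sg x, sg x <= 1, 0 <= sg' x & sg' x <= C])].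
Proof.
pose b x := flat 1 x * flat 1 (1 - x).
have sb : smooth b.
  move=> k; apply: Reg_mul; first exact: smooth_flat.
  apply: (@Reg_comp _ k (fun _ z => flat 1 z)); first exact: smooth_flat.
  by apply: Reg_sub; [exact: Reg_cst|exact: Reg_id].
have cb := smooth_cont sb.
have f0 x : 0 <= flat 1 x.
  by rewrite /flat; case: ifP => // _; rewrite hornerC mul1r expR_ge0.
have f1 x : flat 1 x <= 1.
  rewrite /flat; case: ifP => // x0; rewrite hornerC mul1r -expR0 ler_expR oppr_le0.
  by rewrite invr_ge0 ltW.
have b0 x : 0 <= b x by rewrite mulr_ge0.
have b1 x : b x <= 1 by rewrite mulr_ile1.
have bl x : x <= 0 -> b x = 0.
  by move=> x0; rewrite /b /flat ltNge x0/= mul0r.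
have br x : 1 <= x -> b x = 0.
  by move=> x1; rewrite /b {2}/flat subr_gt0 ltNge x1/= mulr0.
pose I := prim b 0 1.
have mono x y : x <= y -> prim b 0 x <= prim b 0 y.
  move=> xy; have := @mvt_ge _ (prim b 0) b x y 0 xy (fun x _ => der_prim 0 x cb) (fun x _ => b0 x).
  by rewrite mul0r; lra.
have I0 : 0 < I.
  (* On [1/4, 3/4] both [1/x] and [1/(1 - x)] are at most 4, so the bump stays above [e^(-4) e^(-4)]
     there and its integral is positive. *)
  have e0 : 0 < expR (- 4) * expR (- 4) :> R by rewrite mulr_gt0 ?expR_gt0.
  have : expR (- 4) * expR (- 4) * (3/4 - 1/4) <= prim b 0 (3/4) - prim b 0 (1/4) :> R.
    apply: (@mvt_ge _ (prim b 0) b) => [|x _|x /andP[x1 x2]]; first lra.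
      exact: der_prim.
    have x0 : 0 < x by lra.
    have x3 : 0 < 1 - x by lra.
    rewrite /b /flat x0 x3 !hornerC !mul1r ler_pM ?expR_ge0// ler_expR lerN2 invf_ple ?posrE//; lra.
  have := mono 0 (1/4) ltac:(lra); have := mono (3/4) 1 ltac:(lra).
  rewrite prim_refl -/I; lra.
have dsg x : der (fun x => I^-1 * prim b 0 x) x (I^-1 * b x).
  by apply: der_cmul; exact: der_prim.
have zl x : x <= 0 -> prim b 0 x = 0.
  move=> x0; have := @mvt_dist _ (prim b 0) b x 0 0 (fun x _ => der_prim 0 x cb).
  rewrite prim_refl mul0r sub0r normrN normr_le0 => H; apply/eqP/H => y.
  by case: (leP x 0) x0 => // _ _ /andP[_ /bl ->]; rewrite normr0.
have zr x : 1 <= x -> prim b 0 x = I.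
  move=> x0; have := @mvt_dist _ (prim b 0) b 1 x 0 (fun x _ => der_prim 0 x cb).
  rewrite mul0r normr_le0 subr_eq0 => H; apply/eqP/H => y.
  by case: (leP 1 x) x0 => // _ _ /andP[/br ->]; rewrite normr0.
have Iv : 0 <= I^-1 by rewrite invr_ge0 ltW.
exists (fun x => I^-1 * prim b 0 x), (fun x => I^-1 * b x), I^-1; split => //.
- move=> k; apply: Reg_mul; first exact: Reg_cst.
  case: k => [|k]; first by apply: (@jc_x _ (prim b 0)); exact: continuous_der (fun x => der_prim 0 x cb).
  by apply: (@Reg_prim2 _ k (fun _ => b)); exact: sb.
- by move=> x x0; rewrite zl// bl// !mulr0.
- by move=> x x1; rewrite zr// br// mulr0 mulVf// gt_eqF.
- move=> x; split.
  + rewrite mulr_ge0//; have [x0|x0] := leP x 0; first by rewrite zl.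
    by have := mono _ _ (ltW x0); rewrite prim_refl.
  + rewrite mulrC ler_pdivrMr// mul1r; have [x1|x1] := leP 1 x; first by rewrite zr.
    exact: mono (ltW x1).
  + by rewrite mulr_ge0.
  + by rewrite -[leRHS]mulr1 ler_wpM2l.
Qed.

End SmoothStep.

(** * The flow as a fixed point *)

Section MonotoneFamily.
Context {R : realType}.
Implicit Types (P : R -> R -> R) (s t z x y : R).
Variable Lam : R -> R.
Hypothesis Lam_mono : forall s t, `|s| <= `|t| -> Lam s <= Lam t.

Definition bilip P := forall t z z', z <= z' ->
  expR (- Lam t) * (z' - z) <= P t z' - P t z <= expR (Lam t) * (z' - z).

Definition inv P t x := xget 0 [set y | P t y = x].

Lemma bilip_norm P t z z' : bilip P ->
  expR (- Lam t) * `|z' - z| <= `|P t z' - P t z| <= expR (Lam t) * `|z' - z|.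
Proof.
move=> bP; wlog zz : z z' / z <= z'.
  by move=> H; case: (leP z z') => [|/ltW] /H //; rewrite distrC (distrC (P t z)).
have /andP[h1 h2] := bP t _ _ zz.
have h0 : 0 <= expR (- Lam t) * (z' - z) by rewrite mulr_ge0 ?expR_ge0 ?subr_ge0.
by rewrite !ger0_norm ?subr_ge0//; [rewrite h1|rewrite -subr_ge0; apply: le_trans h1].
Qed.

Lemma bilip_mono P t z z' : bilip P -> z <= z' -> P t z <= P t z'.
Proof.
move=> bP zz; have /andP[h _] := bP t _ _ zz.
by rewrite -subr_ge0; apply: le_trans h; rewrite mulr_ge0 ?expR_ge0 ?subr_ge0.
Qed.

Lemma bilip_le P t z z' : bilip P -> (P t z <= P t z') = (z <= z').
Proof.
move=> bP; apply/idP/idP; last exact: bilip_mono.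
move=> h; rewrite leNgt; apply/negP => zz.
have /andP[h1 _] := bP t _ _ (ltW zz).
have : 0 < expR (- Lam t) * (z - z') by rewrite mulr_gt0 ?expR_gt0 ?subr_gt0.
by lra.
Qed.

Lemma bilip_lt P t z z' : bilip P -> (P t z < P t z') = (z < z').
Proof. by move=> bP; rewrite !ltNge bilip_le. Qed.

Lemma bilip_inj P t : bilip P -> injective (P t).
Proof.
by move=> bP z z' E; apply/eqP; rewrite eq_le -(bilip_le t z z' bP) -(bilip_le t z' z bP) E lexx.
Qed.

Lemma invK P t x : jc P -> bilip P -> P t (inv P t x) = x.
Proof.
move=> jP bP; suff [y Py] : exists y, P t y = x by exact: (@xgetPex _ 0 [set y | P t y = x]) (ex_intro _ y Py).
(* The slope is at least [e^(- Lam t)], so moving from 0 by [M] changes [P t] by more than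
   [|x| + |P t 0|]; hence [x] lies between the values at [- M] and [M]. *)
pose M := expR (Lam t) * (`|x| + `|P t 0| + 1).
have e0 := expR_gt0 (Lam t).
have nx := normr_ge0 x; have np := normr_ge0 (P t 0).
have M0 : 0 <= M by rewrite mulr_ge0// ?ltW//; lra.
have eM : expR (- Lam t) * M = `|x| + `|P t 0| + 1.
  by rewrite /M expRN mulrA mulVf ?mul1r// gt_eqF.
have h1 : x <= P t M.
  have /andP[h _] := bP t _ _ M0; move: h; rewrite subr0 eM.
  by have := ler_norm x; have := ler_norm (- P t 0); rewrite normrN; lra.
have h2 : P t (- M) <= x.
  have M1 : - M <= 0 by lra.
  have /andP[h _] := bP t _ _ M1; move: h; rewrite sub0r opprK eM.
  by have := ler_norm (- x); have := ler_norm (P t 0); rewrite normrN; lra.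
have [||c _ Pc] := @IVT R (P t) (- M) M x ltac:(lra); last by exists c.
  by apply: continuous_subspaceT; exact: jc_cont2.
by rewrite (min_idPl _) ?(max_idPr _) ?h1 ?h2//; lra.
Qed.

Lemma inv_id P t z : jc P -> bilip P -> inv P t (P t z) = z.
Proof. by move=> jP bP; apply: (bilip_inj (t := t) bP); rewrite invK. Qed.

Lemma inv_dist P t x z : jc P -> bilip P ->
  `|inv P t x - z| <= expR (Lam t) * `|x - P t z|.
Proof.
move=> jP bP; have /andP[h _] := bilip_norm t z (inv P t x) bP.
move: h; rewrite invK// expRN => h.
by rewrite -ler_pdivrMl ?expR_gt0.
Qed.

Lemma jc_inv P : jc P -> bilip P -> jc (inv P).
Proof.
move=> jP bP; apply/jcP => t x e e0.
pose M := expR (Lam (`|t| + 1)); have M0 : 0 < M by exact: expR_gt0.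
have eM : 0 < e / (M * 2) by rewrite divr_gt0// mulr_gt0.
have [d d0 H] := (jcP P).1 jP t (inv P t x) _ eM.
exists (Num.min (Num.min 1 d) (e / (M * 2))); first by rewrite !lt_min ltr01 d0.
move=> t' x'; rewrite !lt_min => /andP[/andP[t1 td] _] /andP[_ xd].
apply: le_lt_trans (inv_dist _ _ _ jP bP) _.
have nt := normr_ge0 t.
have Lt : expR (Lam t') <= M.
  rewrite ler_expR; apply: Lam_mono.
  rewrite (ger0_norm (x := `|t| + 1)); last lra.
  by have := ler_normD (t' - t) t; rewrite subrK; lra.
have h1 : `|x' - P t' (inv P t x)| < e / M.
  have := ler_distD x x' (P t' (inv P t x)).
  have : `|P t' (inv P t x) - P t (inv P t x)| < e / (M * 2).
    by apply: H => //; rewrite subrr normr0.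
  rewrite invK// (distrC (P t' _) x).
  have -> : e / M = e / (M * 2) + e / (M * 2) by field; rewrite gt_eqF.
  by lra.
apply: (@le_lt_trans _ _ (M * `|x' - P t' (inv P t x)|)); first by rewrite ler_wpM2r.
by rewrite mulrC -ltr_pdivlMr.
Qed.

Lemma bilip_lim P : (forall t z e, 0 < e -> exists2 Q, bilip Q &
   forall z', `|z'| <= `|z| -> `|P t z' - Q t z'| <= e) -> bilip P.
Proof.
move=> H t z z' zz; pose N := `|z| + `|z'|.
have nz := normr_ge0 z; have nz' := normr_ge0 z'.
have key e : 0 < e -> expR (- Lam t) * (z' - z) - e <= P t z' - P t z <=
    expR (Lam t) * (z' - z) + e.
  move=> e0; have e2 : 0 < e / 2 by rewrite divr_gt0.
  have [Q bQ HQ] := H t N (e / 2) e2.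
  have h1 : `|P t z - Q t z| <= e / 2.
    by apply: HQ; rewrite (ger0_norm (x := N)) /N; lra.
  have h2 : `|P t z' - Q t z'| <= e / 2.
    by apply: HQ; rewrite (ger0_norm (x := N)) /N; lra.
  have /andP[h3 h4] := bQ t _ _ zz.
  move: h1 h2; rewrite !ler_norml => /andP[? ?] /andP[? ?].
  by apply/andP; split; lra.
apply/andP; split; apply/ler_addgt0Pr => e /key /andP[? ?]; lra.
Qed.

End MonotoneFamily.

Section Estimates.
Context {R : realType}.
Implicit Types (x y z s t : R) (f g : R -> R).

Lemma exp_lip x y C : x <= C -> y <= C -> `|expR x - expR y| <= expR C * `|x - y|.
Proof.
move=> xC yC; apply: (@mvt_dist _ expR expR) => z; first by move=> _; exact: is_derive_expR.
move=> /andP[_ h]; rewrite ger0_norm ?expR_ge0// ler_expR.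
by apply: le_trans h _; case: (leP y x).
Qed.

Lemma max_lip x y : `|Num.max 0 x - Num.max 0 y| <= `|x - y|.
Proof.
rewrite ler_norml; have := ler_norm (x - y); have := ler_norm (y - x).
rewrite distrC; case: (leP 0 x) => h1; case: (leP 0 y) => h2 h3 h4;
  apply/andP; split; lra.
Qed.

Lemma min_lip x y : `|Num.min 0 x - Num.min 0 y| <= `|x - y|.
Proof.
rewrite ler_norml; have := ler_norm (x - y); have := ler_norm (y - x).
rewrite distrC; case: (leP 0 x) => h1; case: (leP 0 y) => h2 h3 h4;
  apply/andP; split; lra.
Qed.

Lemma lip_cont f C : (forall x y, `|f x - f y| <= C * `|x - y|) -> continuous f.
Proof.
move=> H x; apply/cvgrPdist_lt => e e0.
have C1 : 0 < `|C| + 1 by have := normr_ge0 C; lra.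
apply/nbhs_ballP; exists (e / (`|C| + 1)); rewrite /= ?divr_gt0// => y.
rewrite /ball/= ltr_pdivlMr// mulrC => h; apply: le_lt_trans h.
apply: le_trans (H _ _) _; rewrite ler_wpM2r//.
by have := ler_norm C; lra.
Qed.

Lemma jc_max0 (f : R -> R -> R) : jc f -> jc (fun s z => Num.max 0 (f s z)).
Proof.
apply: jc_c1; apply: (@lip_cont _ 1) => x y; rewrite mul1r; exact: max_lip.
Qed.

Lemma jc_min0 (f : R -> R -> R) : jc f -> jc (fun s z => Num.min 0 (f s z)).
Proof.
apply: jc_c1; apply: (@lip_cont _ 1) => x y; rewrite mul1r; exact: min_lip.
Qed.

Lemma prim_norm_le f c t C : continuous f ->
  (forall s, Num.min c t <= s <= Num.max c t -> `|f s| <= C) ->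
  `|prim f c t| <= C * `|t - c|.
Proof.
move=> cf bf; have := @mvt_dist _ (prim f c) f c t C (fun x _ => der_prim c x cf) bf.
by rewrite prim_refl subr0.
Qed.

Lemma prim_sub f g c t : continuous f -> continuous g ->
  prim (fun s => f s - g s) c t = prim f c t - prim g c t.
Proof.
move=> cf cg; pose F x := prim (fun s => f s - g s) c x - (prim f c x - prim g c x).
have : F t = F c.
  apply: derive0_eq => x; rewrite -(subrr (f x - g x)); apply: der_sub.
    by apply: (@der_prim _ (fun s => f s - g s)) => y; apply: cvgB; [exact: cf|exact: cg].
  by apply: der_sub; exact: der_prim.
by rewrite /F !prim_refl; lra.
Qed.

Lemma norm_2sub u v K : `|u| <= K -> `|v| <= K -> `|2 * u - v| <= 3 * K :> R.
Proof.
by rewrite !ler_norml => /andP[? ?] /andP[? ?]; apply/andP; split; lra.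
Qed.

Lemma norm_2sub_diff u v u' v' K : `|u - u'| <= K -> `|v - v'| <= K ->
  `|(2 * u - v) - (2 * u' - v')| <= 3 * K :> R.
Proof.
by rewrite !ler_norml => /andP[? ?] /andP[? ?]; apply/andP; split; lra.
Qed.

Lemma minmax0 s t : Num.min 0 t <= s <= Num.max 0 t -> `|s| <= `|t|.
Proof. by move=> h; apply: minmax_norm h; rewrite ?normr0. Qed.

(** Integrating a bound with weight [e^(la |s|)] gains the factor [1 / la]. This is what makes the
    flow map a contraction, on any bounded time interval, once [la] is large. Negative [t] are
    handled by reflection. *)
Lemma prim_exp_le f la C t : continuous f -> 0 < la ->
  (forall s, `|s| <= `|t| -> `|f s| <= C * expR (la * `|s|)) ->
  `|prim f 0 t| <= C / la * expR (la * `|t|).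
Proof.
move=> + la0; wlog t0 : f t / 0 <= t.
  move=> H cf bf; case: (leP 0 t) => [t0|/ltW t0]; first exact: H.
  have cg : continuous (fun s => - f (- s)).
    by move=> x; apply: cvgN; apply: (continuous_comp (f := -%R) (g := f));
      [exact: opp_continuous|exact: cf].
  have E : prim f 0 t = prim (fun s => - f (- s)) 0 (- t).
    pose F x := prim f 0 x - prim (fun s => - f (- s)) 0 (- x).
    have : F t = F 0.
      apply: derive0_eq => x; rewrite -(subrr (f x)); apply: der_sub; first exact: der_prim.
      apply: der_eq (der_comp (der_prim 0 (- x) cg) (der_opp (der_id x))).
      by rewrite opprK mulrNN mul1r.
    by rewrite /F oppr0 !prim_refl; lra.
  rewrite E -(normrN t); apply: H => //; first lra.
  by rewrite normrN => s st; rewrite normrN -(normrN s); apply: bf; rewrite normrN.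
move=> cf bf; have C0 : 0 <= C.
  by have := bf 0; rewrite normr0 mulr0 expR0 mulr1 => /(_ (normr_ge0 _)); apply: le_trans.
have dE c x : der (fun s => c / la * expR (la * s)) x (c * expR (la * x)).
  apply: der_eq (der_cmul (c / la) (der_exp (der_cmul la (der_id x)))).
  by rewrite mulr1 mulrA divfK// gt_eqF.
have bx x : 0 <= x <= t -> `|f x| <= C * expR (la * x).
  move=> /andP[x0 xt]; have := bf x; rewrite (ger0_norm x0) (ger0_norm t0); exact: (fun h => h xt).
have h1 : prim f 0 t - prim f 0 0 <= C / la * expR (la * t) - C / la * expR (la * 0).
  apply: (@mono_diff _ (prim f 0) f (fun x => C / la * expR (la * x)) (fun x => C * expR (la * x)) 0 t) => //.
  - by move=> y _; exact: der_prim.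
  - by move=> y yt; apply: le_trans (bx y yt); exact: ler_norm.
have h2 : (- C) / la * expR (la * t) - (- C) / la * expR (la * 0) <= prim f 0 t - prim f 0 0.
  apply: (@mono_diff _ (fun x => (- C) / la * expR (la * x)) (fun x => (- C) * expR (la * x)) (prim f 0) f 0 t) => //.
  - by move=> y _; exact: der_prim.
  - by move=> y yt; rewrite mulNr lerNl; apply: le_trans (bx y yt); rewrite -normrN; exact: ler_norm.
move: h1 h2; rewrite prim_refl mulr0 expR0 !mulr1 (ger0_norm t0) ler_norml !mulNr.
have : 0 <= C / la by rewrite divr_ge0// ltW.
by move=> *; apply/andP; split; lra.
Qed.

Lemma le_geom x C : (forall k : nat, x <= C / 2 ^+ k) -> x <= 0.
Proof.
move=> H; rewrite leNgt; apply/negP => x0.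
have C0 : 0 < C by have := H 0%N; rewrite expr0 divr1; lra.
have [n hn] : exists n : nat, C / x < n%:R.
  exists (Num.truncn (C / x)).+1; exact: truncnS_gt.
have := H n; rewrite ler_pdivlMr ?exprn_gt0// => h.
have : n%:R <= 2 ^+ n :> R by rewrite -natrX ler_nat ltnW// ltn_expl.
rewrite ltr_pdivrMr// mulrC in hn.
by move=> /(ler_wpM2l (ltW x0)); lra.
Qed.

(** With [d k] the tail of the geometric series, the intervals of centre [u k] and radius [d k] are
    nested; the limit is the supremum of their left ends. *)
Lemma geom_lim (u : nat -> R) C : (forall k, `|u k.+1 - u k| <= C / 2 ^+ k) ->
  exists l, forall k, `|l - u k| <= 2 * C / 2 ^+ k.
Proof.
move=> H; pose d k : R := 2 * C / 2 ^+ k.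
have dS k : d k.+1 + C / 2 ^+ k = d k.
  by rewrite /d exprS; field; rewrite expf_neq0.
have lo k n : u k - d k <= u (k + n)%N - d (k + n)%N.
  elim: n => [|n IH]; first by rewrite addn0.
  rewrite addnS; apply: le_trans IH _.
  by have := H (k + n)%N; rewrite ler_norml -(dS (k + n)%N) => /andP[]; lra.
have hi k n : u (k + n)%N + d (k + n)%N <= u k + d k.
  elim: n => [|n IH]; first by rewrite addn0.
  rewrite addnS; apply: le_trans IH.
  by have := H (k + n)%N; rewrite ler_norml -(dS (k + n)%N) => /andP[]; lra.
have d0 k : 0 <= d k.
  have := H 0%N; rewrite expr0 divr1 => /(le_trans (normr_ge0 _)) C0.
  by rewrite /d mulr_ge0 ?invr_ge0 ?exprn_ge0//; lra.
have lh k n : u k - d k <= u n + d n.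
  have := lo k n; have := hi n k; rewrite (addnC n); have := d0 (k + n)%N; lra.
pose X := [set u k - d k | k in [set: nat]].
have hX : has_sup X.
  split; first by exists (u 0%N - d 0%N); exists 0%N.
  by exists (u 0%N + d 0%N) => _ [k _ <-]; exact: lh.
exists (sup X) => k; rewrite ler_norml -/(d k); apply/andP; split.
  have : u k - d k <= sup X by apply: ub_le_sup; [exact: hX.2|exists k].
  lra.
have : sup X <= u k + d k by apply: ge_sup; [exact: hX.1|move=> _ [n _ <-]; exact: lh].
lra.
Qed.

End Estimates.

(** * The flow map, its contraction estimate and its fixed point *)

Section Picard.
Context {R : realType}.
Implicit Types (P Q : R -> R -> R) (s t x y z : R).
Variables (a b al be m0 p0 m1 p1 : R) (w0 r0 : R -> R).
Hypothesis b0 : 0 <= b.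
Hypothesis w0b : forall z, `|w0 z| <= m0.
Hypothesis r0b : forall z, `|r0 z| <= p0.
Hypothesis w0l : forall z z', `|w0 z - w0 z'| <= m1 * `|z - z'|.
Hypothesis r0l : forall z z', `|r0 z - r0 z'| <= p1 * `|z - z'|.
Hypothesis w0o : forall z, ~~ (al < z < be) -> w0 z = 0.
Hypothesis r0o : forall z, ~~ (al < z < be) -> r0 z = 0.

(** A priori bounds valid for every admissible P, because the integrand of [Ef] is at most 1: [Kb]
    bounds [omf], and [Lam] bounds [Lf], the 3 being the sum 2 + 1 of the coefficients in [Gf]. *)
Definition Kb t : R := m0 + p0 * `|t|.
Definition Lam t : R := 3 * Kb t * `|t|.
(* [P s z] is the position at time s of the particle labelled z. The new time s has speed
   [qf P s], which damps the growth of [expR (P s be)] at the front label be and keeps the whole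
   system globally Lipschitz. The truncations [Num.min 0] and [Num.max 0] bound the iteration;
   the first one is inactive for labels z <= be, the only ones where r0 lives. *)
Definition ex x : R := expR (Num.min 0 x).
Definition qf P s : R := expR (- Num.max 0 (P s be)).
Definition Ef P t z : R := prim (fun s => ex (P s z - Num.max 0 (P s be))) 0 t.
Definition Af P t z : R := w0 z + r0 z * Ef P t z.
Definition omf P t x : R := Af P t (inv P t x).
Definition Gf P t z : R :=
  qf P t * (2 * omf P t (P t z - a) - omf P t (P t z + b)).
(* [Lf] is the logarithm of d_z P and [Hf] is minus the speed of the label al, to the left of
   which omega vanishes; [Tf] recovers P from these two. *)
Definition Hf P s : R := qf P s * prim (fun y => omf P s (P s al + y)) 0 b.
Definition Lf P t z : R := prim (Gf P ^~ z) 0 t.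
Definition Tf P t z : R := al - prim (Hf P) 0 t + prim (fun z => expR (Lf P t z)) al z.

Definition adm P := jc P /\ bilip Lam P.

Let m0_ge0 : 0 <= m0. Proof. exact: le_trans (w0b 0). Qed.
Let p0_ge0 : 0 <= p0. Proof. exact: le_trans (r0b 0). Qed.
Let m1_ge0 : 0 <= m1.
Proof. by have := w0l 1 0; rewrite subr0 normr1 mulr1; apply: le_trans. Qed.
Let p1_ge0 : 0 <= p1.
Proof. by have := r0l 1 0; rewrite subr0 normr1 mulr1; apply: le_trans. Qed.

Lemma Kb_mono s t : `|s| <= `|t| -> Kb s <= Kb t.
Proof. by move=> st; rewrite lerD2l ler_wpM2l. Qed.

Lemma Kb_ge0 t : 0 <= Kb t.
Proof. by rewrite addr_ge0// mulr_ge0. Qed.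

Lemma Lam_ge0 t : 0 <= Lam t.
Proof. by rewrite mulr_ge0// mulr_ge0// Kb_ge0. Qed.

Lemma Lam_mono s t : `|s| <= `|t| -> Lam s <= Lam t.
Proof.
move=> st; rewrite /Lam -!mulrA ler_wpM2l//.
by rewrite ler_pM ?Kb_ge0// Kb_mono.
Qed.

Lemma ex_ge0 x : 0 <= ex x. Proof. exact: expR_ge0. Qed.

Lemma ex_le1 x : ex x <= 1.
Proof. by rewrite -expR0 ler_expR ge_min lexx. Qed.

Lemma ex_lip x y : `|ex x - ex y| <= `|x - y|.
Proof.
have := @exp_lip R (Num.min 0 x) (Num.min 0 y) 0; rewrite expR0 mul1r.
move=> H; apply: le_trans (H _ _) (min_lip _ _); by rewrite ge_min lexx.
Qed.

Lemma jc_ex P : jc P -> jc (fun s z => ex (P s z)).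
Proof. by move=> jP; apply: jc_exp; exact: jc_min0. Qed.

Lemma jc_col P z0 : jc P -> jc (fun s _ => P s z0).
Proof. by move=> jP; apply: (jc_comp jP jc_fst); exact: jc_cst. Qed.

Lemma qf_gt0 P s : 0 < qf P s. Proof. exact: expR_gt0. Qed.

Lemma qf_le1 P s : qf P s <= 1.
Proof. by rewrite -expR0 ler_expR oppr_le0 le_max lexx. Qed.

Lemma jc_qf P : jc P -> jc (fun s _ => qf P s).
Proof. by move=> jP; apply: jc_exp; apply: jc_opp; apply: jc_max0; exact: jc_col. Qed.

Lemma jc_eint P : jc P -> jc (fun s z => ex (P s z - Num.max 0 (P s be))).
Proof. by move=> jP; apply: jc_ex; apply: jc_sub => //; apply: jc_max0; exact: jc_col. Qed.

Lemma jc_Ef P : jc P -> jc (Ef P).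
Proof. by move=> jP; apply: jc_prim; exact: jc_eint. Qed.

Lemma w0_cont : continuous w0. Proof. exact: lip_cont w0l. Qed.
Lemma r0_cont : continuous r0. Proof. exact: lip_cont r0l. Qed.

Lemma jc_Af P : jc P -> jc (Af P).
Proof.
move=> jP; apply: jc_add; first exact: jc_x w0_cont.
by apply: jc_mul; [exact: jc_x r0_cont|exact: jc_Ef].
Qed.

Lemma Ef_bound P t z : jc P -> `|Ef P t z| <= `|t|.
Proof.
move=> jP; have := @prim_norm_le R (fun s => ex (P s z - Num.max 0 (P s be))) 0 t 1.
rewrite subr0 mul1r; apply; first exact: (jc_cont1 (jc_eint jP)).
by move=> s _; rewrite ger0_norm ?ex_ge0// ex_le1.
Qed.

Lemma Af_bound P t z : jc P -> `|Af P t z| <= Kb t.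
Proof.
move=> jP; apply: le_trans (ler_normD _ _) _; apply: lerD => //.
by rewrite normrM ler_pM//; exact: Ef_bound.
Qed.

Lemma Af_out P t z : ~~ (al < z < be) -> Af P t z = 0.
Proof. by move=> h; rewrite /Af w0o// r0o// mul0r addr0. Qed.

Section Admissible.
Variable P : R -> R -> R.
Hypothesis aP : adm P.
Let jP : jc P := aP.1.
Let bP : bilip Lam P := aP.2.

Lemma jc_omf : jc (omf P).
Proof.
by apply: (jc_comp (jc_Af jP) jc_fst); exact: (jc_inv Lam_mono).
Qed.

Lemma omf_bound t x : `|omf P t x| <= Kb t. Proof. exact: Af_bound. Qed.

Lemma jc_Gf : jc (Gf P).
Proof.
have jm (c : R) : jc (fun t z => omf P t (P t z + c)).
  by apply: (jc_comp jc_omf jc_fst); apply: jc_add => //; exact: jc_cst.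
apply: jc_mul; first exact: jc_qf.
by apply: jc_sub => //; apply: jc_mul; [exact: jc_cst|exact: jm].
Qed.

Lemma Gf_bound t z : `|Gf P t z| <= 3 * Kb t.
Proof.
rewrite normrM (ger0_norm (ltW (qf_gt0 _ _))) -[leRHS]mul1r.
apply: ler_pM; rewrite ?qf_le1 ?(ltW (qf_gt0 _ _))//.
by apply: norm_2sub; exact: omf_bound.
Qed.

Lemma Lf_bound t z : `|Lf P t z| <= Lam t.
Proof.
have := @prim_norm_le R (Gf P ^~ z) 0 t (3 * Kb t) (jc_cont1 jc_Gf).
rewrite subr0; apply => s /minmax0 st; apply: le_trans (Gf_bound _ _) _.
by rewrite ler_wpM2l// Kb_mono.
Qed.

Lemma jc_Lf : jc (Lf P). Proof. exact: jc_prim jc_Gf. Qed.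

Lemma Hf_cont : continuous (Hf P).
Proof.
apply: (@jc_cont1 _ (fun s _ => Hf P s) 0); apply: jc_mul; first exact: jc_qf.
apply: (@jc_comp _ (fun s z => prim (fun y => omf P s (P s al + y)) 0 z) (fun s _ => s) (fun _ _ => b) _ (@jc_fst _) (@jc_cst _ b)).
apply: jc_prim2; apply: (jc_comp jc_omf jc_fst).
by apply: jc_add; [exact: jc_col|exact: jc_snd].
Qed.

Lemma Tf_adm : adm (Tf P).
Proof.
have jE : jc (fun t z => expR (Lf P t z)) by exact: jc_exp jc_Lf.
split.
  apply: jc_add; last exact: jc_prim2.
  apply: jc_sub; first exact: jc_cst.
  by apply: jc_t; apply: continuous_der => x; apply: der_prim; exact: Hf_cont.
move=> t z z' zz; have dT x : der (Tf P t) x (expR (Lf P t x)).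
  rewrite -[expR _]add0r; apply: der_add; first exact: der_cst.
  exact: (@der_prim _ (fun z => expR (Lf P t z)) al x (jc_cont2 jE)).
have B x : expR (- Lam t) <= expR (Lf P t x) <= expR (Lam t).
  by rewrite !ler_expR; have := Lf_bound t x; rewrite ler_norml.
apply/andP; split.
  by apply: (mvt_ge zz (fun x _ => dT x)) => x _; case/andP: (B x).
by apply: (mvt_le zz (fun x _ => dT x)) => x _; case/andP: (B x).
Qed.

End Admissible.

Section Contraction.
Variables (S N : R).
Hypothesis S0 : 0 <= S.
Hypothesis alN : `|al| <= N.
Hypothesis beN : `|be| <= N.

Let eL := expR (Lam S).
Let CA := m1 + p1 * S + p0 * (S * eL).

Let eL_ge0 : 0 <= eL. Proof. exact: expR_ge0. Qed.
Let CA_ge0 : 0 <= CA. Proof. by rewrite !addr_ge0 ?mulr_ge0. Qed.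
Let inN z : al < z < be -> `|z| <= N.
Proof.
move: alN beN; rewrite !ler_norml => /andP[? ?] /andP[? ?] /andP[? ?].
by apply/andP; split; lra.
Qed.
Let KbS t : `|t| <= S -> Kb t <= Kb S.
Proof. by move=> tS; apply: Kb_mono; rewrite (ger0_norm S0). Qed.
Let eLS t : `|t| <= S -> expR (Lam t) <= eL.
Proof. by move=> tS; rewrite ler_expR Lam_mono// (ger0_norm S0). Qed.

Lemma Af_lip P t z z' : adm P -> `|t| <= S ->
  `|Af P t z - Af P t z'| <= CA * `|z - z'|.
Proof.
move=> [jP bP] tS.
have hE : `|Ef P t z - Ef P t z'| <= S * eL * `|z - z'|.
  have j y : continuous (fun s => ex (P s y - Num.max 0 (P s be))) by exact: (jc_cont1 (jc_eint jP)).
  apply: le_trans (prim_diff_le (C := eL * `|z - z'|) (j z) (j z') _) _.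
    move=> s /minmax0 st; apply: le_trans (ex_lip _ _) _.
    rewrite opprB addrA subrK.
    have /andP[_ h] := bilip_norm s z' z bP; apply: le_trans h _.
    by rewrite ler_wpM2r// eLS//; exact: le_trans tS.
  rewrite subr0 mulrC mulrA ler_wpM2r// ler_wpM2r//.
have -> : Af P t z - Af P t z' =
  (w0 z - w0 z') + (r0 z - r0 z') * Ef P t z + r0 z' * (Ef P t z - Ef P t z').
  by rewrite /Af; move: (Ef P t z) (Ef P t z') (w0 z) (w0 z') => e e' w w'; ring.
apply: le_trans (ler_normD _ _) _; rewrite /CA [leRHS]mulrDl; apply: lerD.
  apply: le_trans (ler_normD _ _) _; rewrite [leRHS]mulrDl; apply: lerD => //.
  rewrite normrM mulrAC ler_pM//; apply: le_trans tS; exact: Ef_bound.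
by rewrite normrM -mulrA ler_pM.
Qed.

Variables (P Q : R -> R -> R) (la D : R).
Hypothesis aP : adm P.
Hypothesis aQ : adm Q.
Hypothesis la1 : 1 <= la.
Hypothesis D0 : 0 <= D.
Let de s := D * expR (la * `|s|).
Hypothesis PQ : forall s z, `|s| <= S -> `|z| <= N -> `|P s z - Q s z| <= de s.

Let la0 : 0 < la. Proof. by apply: lt_le_trans la1. Qed.
Let de_ge0 s : 0 <= de s. Proof. by rewrite mulr_ge0 ?expR_ge0. Qed.

Lemma Ef_diff t z : `|t| <= S -> `|z| <= N -> `|Ef P t z - Ef Q t z| <= 2 * de t.
Proof.
move=> tS zN.
have jd : jc (fun s z => ex (P s z - Num.max 0 (P s be)) - ex (Q s z - Num.max 0 (Q s be))).
  by apply: jc_sub; [exact: jc_eint aP.1|exact: jc_eint aQ.1].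
have -> : Ef P t z - Ef Q t z =
  prim (fun s => ex (P s z - Num.max 0 (P s be)) - ex (Q s z - Num.max 0 (Q s be))) 0 t.
  by rewrite prim_sub//; [exact: (jc_cont1 (jc_eint aP.1))|exact: (jc_cont1 (jc_eint aQ.1))].
apply: le_trans (prim_exp_le (la := la) (C := 2 * D) (jc_cont1 jd) la0 _) _.
  move=> s st; have sS := le_trans st tS.
  apply: le_trans (ex_lip _ _) _.
  have := PQ sS zN; have := PQ sS beN; have := max_lip (P s be) (Q s be).
  move: (P s z) (Q s z) (Num.max 0 (P s be)) (Num.max 0 (Q s be)) => u u' v v' h1 h2 h3.
  have -> : u - v - (u' - v') = (u - u') - (v - v') by ring.
  apply: le_trans (ler_normB _ _) _.
  by move: h1 h2 h3; rewrite /de -mulrA; lra.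
rewrite /de mulrA ler_wpM2r ?expR_ge0// ler_pdivrMr// ler_peMr//.
by rewrite mulr_ge0.
Qed.

(** The closeness of P and Q is known only for labels in [[-N, N]], whereas the labels of [x] and
    [x'] may be anywhere. If one of them lies in [(al, be)], the comparison is made at that label,
    which is in the box; if neither does, both values of omega vanish. *)
Lemma omf_diff t x x' : `|t| <= S ->
  `|omf P t x - omf Q t x'| <= (2 * p0 + CA * eL) * (de t + `|x - x'|).
Proof.
move=> tS; rewrite /omf; set y := inv P t x; set y' := inv Q t x'.
have dA z : `|z| <= N -> `|Af P t z - Af Q t z| <= 2 * p0 * de t.
  move=> zN; rewrite /Af.
  have -> : w0 z + r0 z * Ef P t z - (w0 z + r0 z * Ef Q t z) = r0 z * (Ef P t z - Ef Q t z).
    by move: (Ef P t z) (Ef Q t z) => e e'; ring.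
  by rewrite normrM mulrAC [leRHS]mulrC ler_pM// Ef_diff.
have C0 : 0 <= CA * eL * (de t + `|x - x'|) by rewrite !mulr_ge0// addr_ge0.
have p0x : 0 <= p0 * `|x - x'| by rewrite mulr_ge0.
have dy z : `|z| <= N -> z = y \/ z = y' -> `|y - y'| <= eL * (de t + `|x - x'|).
  move=> zN [zy|zy].
    rewrite distrC; apply: le_trans (inv_dist t x' y aQ.1 aQ.2) _.
    apply: ler_pM; rewrite ?expR_ge0// ?eLS//.
    have := ler_distD x x' (Q t y); rewrite (distrC x' x).
    have := PQ tS zN; rewrite zy {1}/y (invK _ _ aP.1 aP.2).
    by move: (Q t y) => u; lra.
  apply: le_trans (inv_dist t x y' aP.1 aP.2) _.
  apply: ler_pM; rewrite ?expR_ge0// ?eLS//.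
  have := ler_distD x' x (P t y').
  have := PQ tS zN; rewrite zy {2}/y' (invK _ _ aQ.1 aQ.2).
  by move: (P t y') => u; rewrite (distrC u x'); lra.
have dd : 2 * p0 * de t <= 2 * p0 * (de t + `|x - x'|).
  by rewrite ler_wpM2l ?mulr_ge0// lerDl.
case: (boolP (al < y < be)) => hy.
  have yN := inN hy; rewrite [leRHS]mulrDl.
  apply: le_trans (ler_distD (Af Q t y) _ _) _; apply: lerD.
    exact: le_trans (dA _ yN) dd.
  apply: le_trans (Af_lip y y' aQ tS) _; rewrite -mulrA ler_wpM2l//.
  exact: dy yN (or_introl erefl).
case: (boolP (al < y' < be)) => hy'.
  have yN := inN hy'; rewrite [leRHS]mulrDl [leRHS]addrC.
  apply: le_trans (ler_distD (Af P t y') _ _) _; apply: lerD.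
    apply: le_trans (Af_lip y y' aP tS) _; rewrite -mulrA ler_wpM2l//.
    exact: dy yN (or_intror erefl).
  exact: le_trans (dA _ yN) dd.
rewrite !Af_out// subrr normr0 mulr_ge0// ?addr_ge0 ?mulr_ge0//.
Qed.

Let C1 := 2 * p0 + CA * eL.
Let C1_ge0 : 0 <= C1. Proof. by rewrite addr_ge0 ?mulr_ge0. Qed.

Lemma qf_diff t : `|t| <= S -> `|qf P t - qf Q t| <= de t.
Proof.
move=> tS; have := @exp_lip R (- Num.max 0 (P t be)) (- Num.max 0 (Q t be)) 0.
rewrite expR0 mul1r => H; apply: le_trans (H _ _) _; rewrite ?oppr_le0 ?le_max ?lexx//.
rewrite -opprD normrN; apply: le_trans (max_lip _ _) _; exact: PQ.
Qed.

Let CG := 3 * Kb S + 6 * C1.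
Let CG_ge0 : 0 <= CG. Proof. by rewrite addr_ge0 ?mulr_ge0 ?Kb_ge0. Qed.

Lemma mul_diff (q q' g g' e K E : R) : 0 <= q' <= 1 -> `|q - q'| <= e -> `|g| <= K ->
  `|g - g'| <= E -> `|q * g - q' * g'| <= e * K + E.
Proof.
move=> /andP[q0 q1] qe gK gE.
have -> : q * g - q' * g' = (q - q') * g + q' * (g - g') by ring.
apply: le_trans (ler_normD _ _) _; rewrite !normrM; apply: lerD.
  by rewrite ler_pM.
by rewrite (ger0_norm q0) -[leRHS]mul1r ler_pM.
Qed.

Lemma Gf_diff t z : `|t| <= S -> `|z| <= N -> `|Gf P t z - Gf Q t z| <= CG * de t.
Proof.
move=> tS zN; have d0 := PQ tS zN.
apply: le_trans (mul_diff (e := de t) (K := 3 * Kb S) (E := 6 * C1 * de t) _ _ _ _) _.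
- by rewrite ltW ?qf_gt0// qf_le1.
- exact: qf_diff.
- by apply: norm_2sub; exact: le_trans (omf_bound aP _ _) (KbS tS).
- have h : C1 * (de t + `|P t z - Q t z|) <= C1 * (2 * de t).
    by rewrite ler_wpM2l//; move: d0; set u := `|_|; lra.
  have -> : 6 * C1 * de t = 3 * (C1 * (2 * de t)) by ring.
  apply: norm_2sub_diff; apply: le_trans h; [have := omf_diff (P t z - a) (Q t z - a) tS|
      have := omf_diff (P t z + b) (Q t z + b) tS].
    by have -> : P t z - a - (Q t z - a) = P t z - Q t z by ring.
  by have -> : P t z + b - (Q t z + b) = P t z - Q t z by ring.
- by rewrite /CG; lra.
Qed.

Lemma Lf_diff t z : `|t| <= S -> `|z| <= N -> `|Lf P t z - Lf Q t z| <= CG / la * de t.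
Proof.
move=> tS zN; rewrite /Lf -prim_sub; [|exact: jc_cont1 (jc_Gf aP)|exact: jc_cont1 (jc_Gf aQ)].
have jd : jc (fun s z => Gf P s z - Gf Q s z) by apply: jc_sub; exact: jc_Gf.
apply: le_trans (prim_exp_le (la := la) (C := CG * D) (jc_cont1 jd) la0 _) _.
  by move=> s st; rewrite -mulrA; apply: Gf_diff => //; exact: le_trans tS.
by rewrite /de mulrA (mulrAC CG D).
Qed.

Lemma Hf_diff s : `|s| <= S -> `|Hf P s - Hf Q s| <= (Kb S + 2 * C1) * b * de s.
Proof.
move=> sS; have d0 := PQ sS alN.
have jm U : adm U -> jc (fun s y => omf U s (U s al + y)).
  move=> aU; apply: (jc_comp (jc_omf aU) jc_fst); apply: jc_add; last exact: jc_snd.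
  exact: jc_col aU.1.
apply: le_trans (mul_diff (e := de s) (K := Kb S * b) (E := 2 * C1 * b * de s) _ _ _ _) _.
- by rewrite ltW ?qf_gt0// qf_le1.
- exact: qf_diff.
- have := @prim_norm_le R (fun y => omf P s (P s al + y)) 0 b (Kb S) (jc_cont2 (jm P aP)).
  rewrite subr0 (ger0_norm b0); apply => y _; apply: le_trans (omf_bound aP _ _) (KbS sS).
- apply: le_trans (prim_diff_le (C := C1 * (2 * de s)) (jc_cont2 (jm P aP)) (jc_cont2 (jm Q aQ)) _) _.
    move=> y _; apply: le_trans (omf_diff _ _ sS) _.
    have -> : P s al + y - (Q s al + y) = P s al - Q s al by ring.
    by rewrite -/C1 ler_wpM2l//; lra.
  by rewrite subr0 (ger0_norm b0); lra.
- lra.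
Qed.

Definition Kc := (Kb S + 2 * C1) * b + eL * CG * (2 * N).

Lemma Tf_diff t z : `|t| <= S -> `|z| <= N -> `|Tf P t z - Tf Q t z| <= Kc / la * de t.
Proof.
move=> tS zN; rewrite /Tf.
have -> : forall u v u' v', al - u + v - (al - u' + v') = (v - v') - (u - u') :> R by move=> *; ring.
apply: le_trans (ler_normB _ _) _.
have jE U : adm U -> jc (fun t z => expR (Lf U t z)) by move=> aU; exact: jc_exp (jc_Lf aU).
have h1 : `|prim (fun z => expR (Lf P t z)) al z - prim (fun z => expR (Lf Q t z)) al z|
    <= eL * (CG / la * de t) * (2 * N).
  apply: le_trans (prim_diff_le (C := eL * (CG / la * de t)) (jc_cont2 (jE P aP)) (jc_cont2 (jE Q aQ)) _) _.
    move=> y /(minmax_norm alN zN) yN; apply: le_trans (exp_lip (C := Lam S) _ _) _.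
    - apply: le_trans (ler_norm _) _; apply: le_trans (Lf_bound aP _ _) _.
      by rewrite Lam_mono// (ger0_norm S0).
    - apply: le_trans (ler_norm _) _; apply: le_trans (Lf_bound aQ _ _) _.
      by rewrite Lam_mono// (ger0_norm S0).
    - by rewrite ler_wpM2l// Lf_diff.
  apply: ler_wpM2l; first by rewrite !mulr_ge0// invr_ge0 ltW.
  by apply: le_trans (ler_normB _ _) _; move: (zN) alN; lra.
have h2 : `|prim (Hf P) 0 t - prim (Hf Q) 0 t| <= (Kb S + 2 * C1) * b / la * de t.
  rewrite -prim_sub; [|exact: Hf_cont aP|exact: Hf_cont aQ].
  have cH : continuous (fun s => Hf P s - Hf Q s).
    by move=> x; apply: cvgB; exact: Hf_cont.
  apply: le_trans (prim_exp_le (la := la) (C := (Kb S + 2 * C1) * b * D) cH la0 _) _.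
    by move=> s st; rewrite -mulrA; apply: Hf_diff; exact: le_trans tS.
  by rewrite /de mulrA (mulrAC _ D).
by rewrite /Kc mulrDl; lra.
Qed.

End Contraction.

Definition Pit k : R -> R -> R := iter k Tf (fun _ z => z).

Lemma Pit_adm k : adm (Pit k).
Proof.
elim: k => [|k IH]; last exact: Tf_adm.
split; first exact: jc_snd.
move=> t z z' zz; have z0 : 0 <= z' - z by rewrite subr_ge0.
have L0 := Lam_ge0 t.
have h1 : expR (- Lam t) <= 1 by rewrite -expR0 ler_expR oppr_le0.
have h2 : 1 <= expR (Lam t) by rewrite -expR0 ler_expR.
by rewrite ler_piMl// ler_peMl.
Qed.

Section Box.
Variables (S N : R).
Hypothesis S0 : 0 <= S.
Hypothesis alN : `|al| <= N.
Hypothesis beN : `|be| <= N.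

(** In the sup norm on the box weighted by [e^(-la |s|)] the map has Lipschitz constant [Kc / la];
    taking [la >= 2 Kc] gives 1/2. The weight depends on the box, but the map does not. *)
Lemma Tf_half : exists2 la, 0 < la & forall P Q D, adm P -> adm Q -> 0 <= D ->
  (forall s z, `|s| <= S -> `|z| <= N -> `|P s z - Q s z| <= D * expR (la * `|s|)) ->
  forall s z, `|s| <= S -> `|z| <= N -> `|Tf P s z - Tf Q s z| <= D / 2 * expR (la * `|s|).
Proof.
pose la := Num.max 1 (2 * Kc S N).
have la1 : 1 <= la by rewrite le_max lexx.
exists la => [|P Q D aP aQ D0 PQ s z sS zN]; first by apply: lt_le_trans la1.
apply: le_trans (Tf_diff S0 alN beN aP aQ la1 D0 PQ sS zN) _.
rewrite mulrA ler_wpM2r ?expR_ge0// mulrC ler_wpM2l//.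
rewrite ler_pdivrMr; last by apply: lt_le_trans la1.
have : 2 * Kc S N <= la by rewrite le_max lexx orbT.
by clearbody la; move: (Kc S N) => k; lra.
Qed.

Lemma Pit_geom : exists2 C, 0 <= C & forall k s z, `|s| <= S -> `|z| <= N ->
  `|Pit k.+1 s z - Pit k s z| <= C / 2 ^+ k.
Proof.
have [la la0 H] := Tf_half.
have j : jc (fun s z => Pit 1 s z - Pit 0 s z).
  by apply: jc_sub; [exact: (Pit_adm 1).1|exact: (Pit_adm 0).1].
have [C0 C00 HC] := jc_bound (Num.max S N) j.
exists (C0 * expR (la * S)) => [|k s z sS zN]; first by rewrite mulr_ge0 ?expR_ge0.
suff h : forall s z, `|s| <= S -> `|z| <= N ->
    `|Pit k.+1 s z - Pit k s z| <= C0 / 2 ^+ k * expR (la * `|s|).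
  apply: le_trans (h _ _ sS zN) _; rewrite [leRHS]mulrAC ler_wpM2l ?mulr_ge0 ?invr_ge0 ?exprn_ge0//.
  by rewrite ler_expR ler_wpM2l// ltW.
elim: k => [|k IH] {}s {}z {}sS {}zN.
  apply: le_trans (HC s z _ _) _; rewrite ?le_max ?sS ?zN ?orbT//.
  rewrite expr0 divr1 ler_peMr// -expR0 ler_expR mulr_ge0// ltW//.
have -> : C0 / 2 ^+ k.+1 = C0 / 2 ^+ k / 2 by rewrite exprS; field; rewrite expf_neq0.
apply: (H (Pit k.+1) (Pit k)) => //; try exact: (Pit_adm _).
by rewrite mulr_ge0 ?invr_ge0 ?exprn_ge0.
Qed.

End Box.

(** Pointwise limit of the iterates, singled out by a geometric rate with unspecified constant. By
    [le_geom] such a limit is unique, so a single function serves all boxes at once. *)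
Definition Phi t z : R :=
  xget 0 [set l | exists C, forall k, `|l - Pit k t z| <= C / 2 ^+ k].

Lemma Phi_approx S N : 0 <= S -> exists2 C, 0 <= C & forall k s z, `|s| <= S -> `|z| <= N ->
  `|Phi s z - Pit k s z| <= C / 2 ^+ k.
Proof.
move=> S0; pose M := Num.max N (Num.max `|al| `|be|).
have [||C C0 HC] := @Pit_geom S M S0; rewrite ?le_max ?lexx ?orbT//.
exists (2 * C) => [|k s z sS zN]; first by rewrite mulr_ge0.
have [|l Hl] := @geom_lim R (fun k => Pit k s z) C.
  by move=> j; apply: HC; rewrite ?le_max ?zN.
have [C' HC'] : exists C, forall k, `|Phi s z - Pit k s z| <= C / 2 ^+ k.
  by apply: (@xgetPex _ 0 [set l | exists C, forall k, `|l - Pit k s z| <= C / 2 ^+ k]); exists l, (2 * C).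
suff -> : Phi s z = l by [].
apply/eqP; rewrite -subr_eq0 -normr_le0; apply: (@le_geom _ _ (C' + 2 * C)) => j.
rewrite mulrDl; apply: le_trans (ler_distD (Pit j s z) _ _) _; apply: lerD => //.
by rewrite distrC.
Qed.

Lemma small_geom (C e : R) : 0 < e -> exists k, C / 2 ^+ k <= e.
Proof.
move=> e0; apply: contrapT => /forallNP H.
suff : e <= 0 by rewrite leNgt e0.
by apply: (@le_geom _ _ C) => k; apply: ltW; rewrite ltNge; apply/negP; exact: H.
Qed.

Lemma Phi_adm : adm Phi.
Proof.
split.
  apply: jc_unif_lim => N e e0; have [|C C0 HC] := @Phi_approx `|N| N; first by [].
  have [k hk] := small_geom C e0; exists (Pit k); first exact: (Pit_adm k).1.
  move=> t z tN zN; apply: le_trans hk; apply: HC => //.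
  exact: le_trans (ler_norm _).
apply: bilip_lim => t z e e0; have [|C C0 HC] := @Phi_approx `|t| `|z|; first by [].
have [k hk] := small_geom C e0; exists (Pit k); first exact: (Pit_adm k).2.
by move=> z' z'N; apply: le_trans hk; exact: HC.
Qed.

(** Both [Tf Phi] and [Phi] are within a multiple of [2^-k] of the same iterate [Pit k.+1]. *)
Lemma Phi_fix t z : Tf Phi t z = Phi t z.
Proof.
pose S := `|t|; pose N := Num.max `|z| (Num.max `|al| `|be|).
have S0 : 0 <= S by exact: normr_ge0.
have alN : `|al| <= N by rewrite !le_max lexx ?orbT.
have beN : `|be| <= N by rewrite !le_max lexx ?orbT.
have zN : `|z| <= N by rewrite !le_max lexx.
have [la la0 H] := Tf_half S0 alN beN.
have [C C0 HC] := Phi_approx N S0.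
apply/eqP; rewrite -subr_eq0 -normr_le0.
apply: (@le_geom _ _ (C / 2 * expR (la * S) + C)) => k.
apply: le_trans (ler_distD (Pit k.+1 t z) _ _) _; rewrite mulrDl; apply: lerD.
  have := @H Phi (Pit k) (C / 2 ^+ k) Phi_adm (Pit_adm k).
  rewrite mulr_ge0 ?invr_ge0 ?exprn_ge0// => /(_ isT) h.
  have -> : C / 2 * expR (la * S) / 2 ^+ k = C / 2 ^+ k / 2 * expR (la * S).
    by field; rewrite expf_neq0.
  apply: h => // s y sS yN; apply: le_trans (HC _ _ _ sS yN) _.
  rewrite ler_peMr ?mulr_ge0 ?invr_ge0 ?exprn_ge0//.
  by rewrite -expR0 ler_expR mulr_ge0// ltW.
rewrite distrC; apply: le_trans (HC k.+1 t z (lexx _) zN) _.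
rewrite ler_wpM2l// lef_pV2 ?posrE ?exprn_gt0// exprS ler_peMl ?exprn_ge0//.
by rewrite ler1n.
Qed.

End Picard.

Section ChainRules.
Context {R : realType}.
Implicit Types (x y z s t c e h l : R).

Lemma der_epsP (f : R -> R) z l : der f z l -> forall e, 0 < e -> exists2 d : R, 0 < d &
     forall h, `|h| < d -> `|f (z + h) - f z - l * h| <= e * `|h|.
Proof.
move=> [df dl] e e0.
have : h^-1 *: ((f \o shift z) (h *: 1) - f z) @[h --> 0^'] --> l by rewrite -dl.
move=> /cvgrPdist_le /(_ e e0).
rewrite /dnbhs/within; near_simpl => /nbhs_ballP[d /= d0 Hd]; exists d => // h hd.
have [->|h0] := eqVneq h 0; first by rewrite addr0 mulr0 subrr subr0 normr0 mulr0.
have := Hd h; rewrite /ball/= sub0r normrN => /(_ hd h0).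
have hp : 0 < `|h| by rewrite normr_gt0.
rewrite -(ler_pM2r hp) -normrM distrC mulrBl /GRing.scale/= mulr1 (addrC h).
by rewrite mulrAC mulVf// mul1r.
Qed.

(** Caratheodory's form of the chain rule: it asks only that increments of [F] be increments of [g]
    times a factor close to [c0]. It serves where the mean value theorem in space supplies that
    factor, namely for [f s (y s)] and for the inverse flow. *)
Lemma der_car (F g : R -> R) t l c0 : der g t l ->
  (forall e, 0 < e -> exists2 d : R, 0 < d & forall h, `|h| < d ->
    exists2 c, `|c - c0| <= e & F (t + h) - F t = c * (g (t + h) - g t)) ->
  der F t (c0 * l).
Proof.
move=> dg H; apply: der_eps => e e0.
have nl := normr_ge0 l; have nc := normr_ge0 c0.
have e1 : 0 < e / (2 * (`|l| + 1)) by rewrite divr_gt0// mulr_gt0//; lra.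
have e2 : 0 < Num.min 1 (e / (2 * (`|c0| + 1))).
  by rewrite lt_min ltr01 divr_gt0// mulr_gt0//; lra.
have [d1 d10 H1] := H _ e1; have [d2 d20 H2] := der_epsP dg e2.
exists (Num.min d1 d2) => [|h]; first by rewrite lt_min d10.
rewrite lt_min => /andP[/H1[c hc ->] /H2 hg].
have nh := normr_ge0 h; have ng := normr_ge0 (g (t + h) - g t - l * h).
have g1 : `|g (t + h) - g t| <= (`|l| + 1) * `|h|.
  have -> : g (t + h) - g t = (g (t + h) - g t - l * h) + l * h by lra.
  apply: le_trans (ler_normD _ _) _; rewrite normrM mulrDl addrC lerD2l mul1r.
  apply: le_trans hg _; rewrite -[leRHS]mul1r ler_wpM2r//.
  by rewrite ge_min lexx.
have g2 : `|g (t + h) - g t - l * h| <= e / (2 * (`|c0| + 1)) * `|h|.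
  by apply: le_trans hg _; rewrite ler_wpM2r// ge_min lexx orbT.
have -> : c * (g (t + h) - g t) - c0 * l * h =
  (c - c0) * (g (t + h) - g t) + c0 * (g (t + h) - g t - l * h) by lra.
apply: le_trans (ler_normD _ _) _; rewrite !normrM.
have h1 : `|c - c0| * `|g (t + h) - g t| <= e / (2 * (`|l| + 1)) * ((`|l| + 1) * `|h|).
  by apply: ler_pM.
have h2 : `|c0| * `|g (t + h) - g t - l * h| <= (`|c0| + 1) * (e / (2 * (`|c0| + 1)) * `|h|).
  by apply: ler_pM => //; lra.
have E1 : e / (2 * (`|l| + 1)) * ((`|l| + 1) * `|h|) = e / 2 * `|h| by field; lra.
have E2 : (`|c0| + 1) * (e / (2 * (`|c0| + 1)) * `|h|) = e / 2 * `|h| by field; lra.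
rewrite E1 in h1; rewrite E2 in h2; lra.
Qed.

Lemma min_max_close x y z d : `|y - x| < d -> Num.min x y <= z <= Num.max x y -> `|z - x| < d.
Proof.
rewrite !ltr_norml; case: (leP x y) => ? /andP[? ?] /andP[? ?]; apply/andP; split; lra.
Qed.

Lemma mvt_any (f f' : R -> R) x y : (forall z, der f z (f' z)) ->
  exists2 c, Num.min x y <= c <= Num.max x y & f y - f x = f' c * (y - x).
Proof.
move=> df; have [xy|/ltW xy] := leP x y.
  by have [c ? ?] := mvt xy (fun z _ => df z); exists c.
by have [c ? E] := mvt xy (fun z _ => df z); exists c => //; rewrite -[LHS]opprB E; lra.
Qed.

Lemma der_chain2 (f fz : R -> R -> R) (y : R -> R) t ft y' :
  (forall t z, der (f t) z (fz t z)) -> jc fz ->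
  der (f^~ (y t)) t ft -> der y t y' ->
  der (fun s => f s (y s)) t (fz t (y t) * y' + ft).
Proof.
move=> df jz dft dy.
apply: (@der_ext _ (fun s => (f s (y s) - f s (y t)) + f s (y t))).
  by move=> s; rewrite subrK.
apply: der_add => //; apply: (der_car dy) => e e0.
have [d d0 Hd] := (jcP fz).1 jz t (y t) e e0.
have /cvgrPdist_lt /(_ d d0) := der_cont dy.
move=> /nbhs_ballP[d1 /= d10 H1].
exists (Num.min d d1) => [|h]; first by rewrite lt_min d0.
rewrite lt_min => /andP[hd hd1].
have yc : `|y (t + h) - y t| < d.
  rewrite distrC; apply: (H1 (t + h)); rewrite /ball/=.
  by rewrite opprD addrA subrr sub0r normrN.
have [c cb E] := mvt_any (y t) (y (t + h)) (df (t + h)).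
exists (fz (t + h) c); last by rewrite E subrr subr0.
apply/ltW/Hd; last exact: min_max_close cb.
by rewrite addrC addKr.
Qed.

Lemma prim_eq (F f : R -> R) c t : continuous f -> (forall x, der F x (f x)) ->
  prim f c t = F t - F c.
Proof.
move=> cf dF; pose K x := prim f c x - F x.
have : K t = K c.
  apply: derive0_eq => x; rewrite -(subrr (f x)); apply: der_sub => //; exact: der_prim.
by rewrite /K prim_refl; lra.
Qed.

Lemma prim_on (f F : R -> R) x y : continuous f ->
  (forall z, Num.min x y <= z <= Num.max x y -> der F z (f z)) -> prim f x y = F y - F x.
Proof.
move=> cf dF.
have : `|(prim f x y - F y) - (prim f x x - F x)| <= 0 * `|y - x|.
  apply: (@mvt_dist _ (fun z => prim f x z - F z) (fun=> 0)) => [z /dF dz|z _]; last by rewrite normr0.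
  by rewrite -(subrr (f z)); apply: der_sub => //; exact: der_prim.
by rewrite prim_refl mul0r normr_le0 subr_eq0 => /eqP; lra.
Qed.

Lemma prim0 (f : R -> R) c t : continuous f ->
  (forall s, Num.min c t <= s <= Num.max c t -> f s = 0) -> prim f c t = 0.
Proof.
move=> cf f0; apply/eqP; rewrite -normr_le0 -(mul0r `|t - c|).
by apply: prim_norm_le => // s /f0 ->; rewrite normr0.
Qed.

Lemma der_shift (F : R -> R) c x l : der F (x + c) l -> der (fun y => F (y + c)) x l.
Proof.
move=> dF; apply: (der_eq (l := (1 + 0) * l)); first by rewrite addr0 mul1r.
apply: (@der_comp _ F (fun y => y + c)) => //.
by apply: der_add; [exact: der_id|exact: der_cst].
Qed.

End ChainRules.

(** * From the fixed point to smooth solutions of the transport equations *)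

Section Flow.
Context {R : realType}.
Implicit Types (x y z s t : R) (k : nat).
Variables (a b al be : R) (w0 r0 Lam : R -> R) (P : R -> R -> R).
Hypothesis a0 : 0 <= a.
Hypothesis Lam_mono : forall s t, `|s| <= `|t| -> Lam s <= Lam t.
Hypothesis jP : jc P.
Hypothesis bP : bilip Lam P.
Hypothesis fP : forall t z, Tf a b al be w0 r0 P t z = P t z.
Hypothesis sw0 : smooth w0.
Hypothesis sr0 : smooth r0.
Hypothesis w0o : forall z, ~~ (al < z < be) -> w0 z = 0.
Hypothesis r0o : forall z, ~~ (al < z < be) -> r0 z = 0.

Local Notation q := (qf be P).
Local Notation A := (Af be w0 r0 P).
Local Notation om := (omf be w0 r0 P).
Local Notation L := (Lf a b be w0 r0 P).
Local Notation G := (Gf a b be w0 r0 P).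
Local Notation Y := (inv P).

Lemma q_cont : continuous q.
Proof. by apply: (@jc_cont1 _ (fun s _ => q s) 0); exact: jc_qf. Qed.

Lemma AfE t z : A t z = w0 z + r0 z * prim (fun s => q s * expR (P s z)) 0 t.
Proof.
rewrite /Af; have [/andP[_ zb]|zo] := boolP (al < z < be); last by rewrite r0o// !mul0r.
congr (_ + _ * _); rewrite /Ef; congr (prim _ _ _); apply/funext => s.
have h : P s z - Num.max 0 (P s be) <= 0.
  by rewrite subr_le0 le_max (bilip_mono s bP (ltW zb)) orbT.
by rewrite /ex /qf (min_idPr h) -expRD addrC.
Qed.

Lemma regA k : Reg k P -> Reg k A.
Proof.
move=> rP; apply: (@Reg_ext _ _ _ _ (fun t z => esym (AfE t z))).
apply: Reg_add; first exact: sw0.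
apply: Reg_mul; first exact: sr0.
apply: (@Reg_prim _ k (fun s z => q s * expR (P s z))).
by apply: Reg_mul; [apply: Reg_t; exact: q_cont|exact: Reg_exp].
Qed.

Lemma regom k : Reg k P -> Reg k Y -> Reg k om.
Proof. by move=> rP rY; apply: (Reg_comp (regA rP) rY). Qed.

Lemma regL k : Reg k P -> Reg k Y -> Reg k L.
Proof.
move=> rP rY; apply: Reg_prim; apply: Reg_mul; first by apply: Reg_t; exact: q_cont.
have rc (c : R) : Reg k (fun t z => om t (P t z + c)).
  by apply: (Reg_comp (regom rP rY)); apply: Reg_add => //; exact: Reg_cst.
by apply: Reg_sub => //; apply: Reg_mul; [exact: Reg_cst|exact: rc].
Qed.

Lemma jcL : jc L.
Proof. by apply: (@regL 0) => //; exact: (jc_inv Lam_mono). Qed.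

Lemma der_P t z : der (P t) z (expR (L t z)).
Proof.
apply: (der_ext (fP t)); rewrite -[expR _]add0r; apply: der_add; first exact: der_cst.
exact: (@der_prim _ _ al z (@jc_cont2 _ (fun t z => expR (L t z)) t (jc_exp jcL))).
Qed.

Lemma der_Y t x : der (Y t) x (expR (- L t (Y t x))).
Proof.
have Ex : x = P t (Y t x) by rewrite (invK _ _ jP bP).
rewrite {1}Ex expRN; apply: is_derive_inverse.
- by near=> z; rewrite (inv_id _ _ jP bP).
- by near=> z; exact: jc_cont2.
- exact: der_P.
- by rewrite gt_eqF// expR_gt0.
Unshelve. all: by end_near. Qed.

(** Regularity climbs one order at a time: [L] is as regular as P and its inverse, and their space
    derivatives [e^L] and [e^(-L)] (read at the inverse) then gain one order for both. *)
Lemma regPY k : Reg k P /\ Reg k Y.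
Proof.
elim: k => [|k [rP rY]]; first by split; [|exact: (jc_inv Lam_mono)].
have rL := regL rP rY; split; split => //.
- by exists (fun t z => expR (L t z)); [exact: der_P|exact: Reg_exp].
- exact: (jc_inv Lam_mono).
- exists (fun t x => expR (- L t (Y t x))); first exact: der_Y.
  by apply: Reg_exp; apply: Reg_opp; exact: (Reg_comp rL rY).
Qed.

Lemma reg_om k : Reg k om. Proof. by have [? ?] := regPY k; exact: regom. Qed.
Lemma reg_L k : Reg k L. Proof. by have [? ?] := regPY k; exact: regL. Qed.
Lemma reg_A k : Reg k A. Proof. by have [? ?] := regPY k; exact: regA. Qed.

Definition rhf t x := r0 (Y t x).

Lemma reg_rh k : Reg k rhf.
Proof. by have [_ rY] := regPY k; exact: (@Reg_comp _ k (fun _ => r0)). Qed.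

Lemma om_P t z : om t (P t z) = A t z.
Proof. by rewrite /omf (inv_id _ _ jP bP). Qed.

Lemma rh_P t z : rhf t (P t z) = r0 z.
Proof. by rewrite /rhf (inv_id _ _ jP bP). Qed.

Lemma A_out t z : ~~ (al < z < be) -> A t z = 0.
Proof. by move=> h; rewrite /Af w0o// r0o// mul0r addr0. Qed.

Lemma om_out t x : ~~ (P t al < x < P t be) -> om t x = 0.
Proof.
rewrite -{1 2}(invK t x jP bP) !(bilip_lt _ _ _ bP); exact: A_out.
Qed.

Lemma rh_out t x : ~~ (P t al < x < P t be) -> rhf t x = 0.
Proof.
rewrite -{1 2}(invK t x jP bP) !(bilip_lt _ _ _ bP); exact: r0o.
Qed.

Lemma L0 z : L 0 z = 0. Proof. exact: prim_refl. Qed.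

Lemma jcG : jc G.
Proof.
have rc (c : R) : jc (fun t z => om t (P t z + c)).
  by apply: (jc_comp (reg_om 0) jc_fst); apply: jc_add => //; exact: jc_cst.
apply: jc_mul; first exact: jc_qf.
by apply: jc_sub => //; apply: jc_mul; [exact: jc_cst|exact: rc].
Qed.

Lemma der_L t z : der (L ^~ z) t (q t * (2 * om t (P t z - a) - om t (P t z + b))).
Proof. by apply: (@der_prim _ (G^~ z)); exact: jc_cont1 jcG. Qed.

Lemma der_A t z : der (A ^~ z) t (r0 z * (q t * expR (P t z))).
Proof.
apply: (der_ext (fun t => esym (AfE t z))); rewrite -[_ * _]add0r.
apply: der_add; first exact: der_cst.
apply: der_cmul; apply: (@der_prim _ (fun s => q s * expR (P s z))).
apply: (@jc_cont1 _ (fun s z => q s * expR (P s z))).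
by apply: jc_mul; [exact: jc_qf|exact: jc_exp].
Qed.

Lemma A0 z : A 0 z = w0 z. Proof. by rewrite AfE prim_refl mulr0 addr0. Qed.

Definition Wf t x := prim (om t) (P t al) x.
Definition Vf t x := 2 * Wf t (x - a) - Wf t (x + b).

Lemma om_cont t : continuous (om t).
Proof. exact: jc_cont2 (reg_om 0). Qed.

Lemma der_W t x : der (Wf t) x (om t x).
Proof. by apply: der_prim; exact: om_cont. Qed.

Lemma der_V t x : der (Vf t) x (2 * om t (x - a) - om t (x + b)).
Proof.
have dsh (c : R) : der (fun x => Wf t (x + c)) x (om t (x + c)).
  by apply: der_shift; exact: der_W.
by apply: der_sub => //; apply: der_cmul; exact: dsh.
Qed.

Lemma W_left t x : x <= P t al -> Wf t x = 0.
Proof.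
move=> xa; apply: prim0; first exact: om_cont.
move=> s; rewrite (min_idPr xa) (max_idPl xa) => /andP[_ sa].
by apply: om_out; rewrite ltNge sa.
Qed.

Lemma HfE t : Hf b al be w0 r0 P t = - (q t * Vf t (P t al)).
Proof.
have Wl : Wf t (P t al - a) = 0 by apply: W_left; rewrite gerBl.
have h : prim (fun y => om t (P t al + y)) 0 b = Wf t (P t al + b).
  have cs : continuous (fun y => om t (P t al + y)).
    apply: (@jc_cont2 _ (fun t y => om t (P t al + y))); apply: (jc_comp (reg_om 0) jc_fst).
    by apply: jc_add; [exact: jc_col|exact: jc_snd].
  rewrite (prim_eq (F := fun y => Wf t (P t al + y)) 0 b cs).
    by rewrite addr0 [X in _ - X]W_left// subr0.
  move=> x; rewrite addrC; apply: (@der_ext _ (fun y => Wf t (y + P t al))) => [y|]; first by rewrite addrC.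
  by apply: der_shift; exact: der_W.
by rewrite /Hf h /Vf Wl mulr0 sub0r mulrN opprK.
Qed.

(** The fixed-point equation prescribes only the time derivative of [L], that is, the space
    derivative of the speed. Integrating it over labels from [al], whose own speed is [- Hf] by
    [HfE], recovers the full speed [q * Vf]. *)
Lemma der_Pt t z : der (P^~ z) t (q t * Vf t (P t z)).
Proof.
have jE : jc (fun t z => expR (L t z)) by exact: jc_exp jcL.
have jGE : jc (fun t z => G t z * expR (L t z)) by apply: jc_mul => //; exact: jcG.
apply: (der_ext (fun t => fP t z)).
have -> : q t * Vf t (P t z) = 0 - Hf b al be w0 r0 P t +
    prim (fun z => G t z * expR (L t z)) al z.
  have -> : prim (fun z => G t z * expR (L t z)) al z =
      q t * Vf t (P t z) - q t * Vf t (P t al).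
    apply: (prim_eq (F := fun z => q t * Vf t (P t z))); first exact: jc_cont2 jGE.
    move=> x; apply: der_eq (der_cmul (q t) (der_comp (der_V t (P t x)) (der_P t x))).
    by rewrite /Gf mulrCA mulrC.
  rewrite HfE; move: (q t) (Vf t (P t z)) (Vf t (P t al)) => u v v'; ring.
apply: der_add.
  apply: der_sub; first exact: der_cst.
  apply: der_prim.
  have -> : Hf b al be w0 r0 P = (fun t => q t * prim (fun y => om t (P t al + y)) 0 b) by [].
  apply: (@jc_cont1 _ (fun s _ => q s * prim (fun y => om s (P s al + y)) 0 b) 0).
  apply: jc_mul; first exact: jc_qf.
  apply: (@jc_comp _ (fun s z => prim (fun y => om s (P s al + y)) 0 z) (fun s _ => s) (fun _ _ => b) _ (@jc_fst _) (@jc_cst _ b)).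
  apply: jc_prim2; apply: (jc_comp (reg_om 0) jc_fst).
  by apply: jc_add; [exact: jc_col|exact: jc_snd].
apply: (@der_prim_par2 _ (fun t z => expR (L t z)) (fun t z => G t z * expR (L t z))) => //.
by move=> s x; apply: der_exp; exact: der_L.
Qed.

Lemma P0 z : P 0 z = z.
Proof.
rewrite -fP /Tf prim_refl subr0.
rewrite (prim_eq (F := id)); first by rewrite /=; lra.
  by apply: (@jc_cont2 _ (fun t z => expR (L t z)) 0); exact: jc_exp jcL.
by move=> x; rewrite L0 expR0; exact: der_id.
Qed.

(** With the label [Y t x] kept fixed, its particle moves away from [x] by minus the increment of
    [P (t + h)] between [Y t x] and [Y (t + h) x]; the mean value theorem turns this into the factor
    that [der_car] asks for. *)
Lemma der_Yt t x : der (Y^~ x) t (- (q t * Vf t x * expR (- L t (Y t x)))).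
Proof.
have dP := der_Pt t (Y t x); rewrite (invK _ _ jP bP) in dP.
apply: der_eq (@der_car _ (Y^~ x) (P^~ (Y t x)) t _ (- expR (- L t (Y t x))) dP _); first ring.
have jE : jc (fun t z => expR (- L t z)) by apply: jc_exp; apply: jc_opp; exact: jcL.
move=> e e0; have [d d0 Hd] := (jcP _).1 jE t (Y t x) e e0.
have [d1 d10 H1] := (jcP _).1 (jc_inv Lam_mono jP bP) t x d d0.
exists (Num.min d d1) => [|h]; first by rewrite lt_min d0.
rewrite lt_min => /andP[hd hd1].
have th c : `|h| < c -> `|t + h - t| < c by rewrite addrC addKr.
have yc : `|Y (t + h) x - Y t x| < d by apply: H1; [exact: th|rewrite subrr normr0].
have [c cb E] := mvt_any (Y t x) (Y (t + h) x) (der_P (t + h)).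
exists (- expR (- L (t + h) c)).
  rewrite -opprD normrN; apply/ltW/Hd; [exact: th|exact: min_max_close cb].
move: E; rewrite (invK _ _ jP bP) => E.
rewrite (invK _ _ jP bP).
have -> : P (t + h) (Y t x) - x = - (x - P (t + h) (Y t x)) by rewrite opprB.
by rewrite E mulrNN mulrA -expRD addNr expR0 mul1r.
Qed.

Lemma om_pde : exists2 omx, (forall k, Reg k omx) & forall t x,
  der (om t) x (omx t x) /\
  der (om^~ x) t (q t * (rhf t x * expR x - Vf t x * omx t x)).
Proof.
have [_ [Az dAz _]] := reg_A 1.
have rAz k : Reg k Az.
  have [_ [Az' dAz' r]] := reg_A k.+1.
  by apply: Reg_ext r => t z; exact: der_unique (dAz' t z) (dAz t z).
exists (fun t x => expR (- L t (Y t x)) * Az t (Y t x)).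
  move=> k; have [_ rY] := regPY k.
  by apply: Reg_mul; [apply: Reg_exp; apply: Reg_opp; apply: (Reg_comp (reg_L k))|apply: (Reg_comp (rAz k))].
move=> t x; split; first by apply: der_comp; [exact: dAz|exact: der_Y].
apply: der_eq (der_chain2 dAz (rAz 0%N) (der_A t (Y t x)) (der_Yt t x)).
rewrite (invK _ _ jP bP) /rhf.
move: (Vf t x) (expR (- _)) (Az _ _) (q t) (r0 _) => v e z u r; ring.
Qed.

Lemma rh_pde : exists2 rhx, (forall k, Reg k rhx) & forall t x,
  der (rhf t) x (rhx t x) /\
  der (rhf^~ x) t (q t * (- Vf t x * rhx t x)).
Proof.
have [rz drz srz] := smooth_der sr0.
exists (fun t x => expR (- L t (Y t x)) * rz (Y t x)).
  move=> k; have [_ rY] := regPY k.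
  apply: Reg_mul; [apply: Reg_exp; apply: Reg_opp; apply: (Reg_comp (reg_L k))|] => //.
  by apply: (@Reg_comp _ k (fun _ => rz)) => //; exact: srz.
move=> t x; split; first by apply: der_comp; [exact: drz|exact: der_Y].
apply: (der_eq _ (@der_comp _ r0 (Y^~ x) t _ _ (drz (Y t x)) (der_Yt t x))).
by rewrite /rhf; move: (Vf t x) (expR (- _)) (rz _) (q t) => v e z u; ring.
Qed.

End Flow.

(** * Growth estimates along the flow *)

Section Bootstrap.
Context {R : realType}.
Implicit Types (x y z s t d : R).
Variables (a b g ep eta r : R) (w0 w0' r0 r0' q th : R -> R).
Variables (P L A E Ez om W : R -> R -> R).
Hypothesis a0 : 0 <= a.
Hypothesis b0 : 0 <= b.
Hypothesis ab1 : a + b <= 1.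
Hypothesis ep0 : 0 < ep.
Hypothesis gE : g = expR ep + ep.
Hypothesis g2 : expR (g * (a + b)) < 2.
Hypothesis r8 : 8 <= r.
Hypothesis w0_ge0 : forall z, 0 <= w0 z.
Hypothesis w0_le1 : forall z, w0 z <= 1.
Hypothesis w0_1 : forall z, 3 <= z <= r -> w0 z = 1.
Hypothesis dw0 : forall z, der w0 z (w0' z).
Hypothesis w0'_le0 : forall z, 3 <= z -> w0' z <= 0.
Hypothesis r0_ge0 : forall z, 0 <= r0 z.
Hypothesis r0_small : forall z, r0 z * expR 12 <= 1.
Hypothesis dr0 : forall z, der r0 z (r0' z).
Hypothesis r0'_le0 : forall z, ~~ (6 <= z <= 7) -> 3 <= z -> r0' z <= 0.
Hypothesis r0'_small : forall z, r0' z * expR 12 <= ep / 2.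
Hypothesis r0_left : forall z, z <= 6 -> r0 z = 0.
Hypothesis eta0 : 0 < eta.
Hypothesis r0_eta : forall z, 7 <= z <= r -> r0 z = eta.
Hypothesis q0 : forall s, 0 < q s.
Hypothesis dth : forall t, der th t (q t).
Hypothesis th0 : th 0 = 0.
Hypothesis P0 : forall z, P 0 z = z.
Hypothesis dPz : forall t z, der (P t) z (expR (L t z)).
Hypothesis L0 : forall z, L 0 z = 0.
Hypothesis dL : forall t z, der (L^~ z) t (q t * (2 * om t (P t z - a) - om t (P t z + b))).
Hypothesis dPt : forall t z, der (P^~ z) t (q t * (2 * W t (P t z - a) - W t (P t z + b))).
Hypothesis dW : forall t x, der (W t) x (om t x).
Hypothesis Wl : forall t x, x <= P t 2 -> W t x = 0.
Hypothesis omP : forall t z, om t (P t z) = A t z.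
Hypothesis surj : forall t x, exists z, P t z = x.
Hypothesis AE : forall t z, A t z = w0 z + r0 z * E t z.
Hypothesis E0 : forall z, E 0 z = 0.
Hypothesis dE : forall t z, der (E^~ z) t (q t * expR (P t z)).
Hypothesis Ez0 : forall z, Ez 0 z = 0.
Hypothesis dEz : forall t z, der (E t) z (Ez t z).
Hypothesis dEzt : forall t z, der (Ez^~ z) t (q t * expR (P t z) * expR (L t z)).
Hypothesis GM : forall S : R, exists M : R, forall s z, 0 <= s <= S ->
  `|q s * (2 * om s (P s z - a) - om s (P s z + b))| <= M.

Let g_gt1 : 1 < g.
Proof. by rewrite gE; have := expR_ge1Dx ep; move: ep0; lra. Qed.

Let g0 : 0 <= g. Proof. by move: g_gt1; lra. Qed.

Lemma Pmono t z z' : z <= z' -> P t z <= P t z'.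
Proof.
move=> zz; have := mvt_ge (C := 0) zz (fun x _ => dPz t x) (fun x _ => expR_ge0 _).
by rewrite mul0r; lra.
Qed.

Lemma Pmono_le t z z' : (P t z <= P t z') = (z <= z').
Proof.
apply/idP/idP; last exact: Pmono.
move=> h; rewrite leNgt; apply/negP => zz.
have [c _ E1] := mvt (ltW zz) (fun x _ => dPz t x).
have : 0 < expR (L t c) * (z - z') by rewrite mulr_gt0 ?expR_gt0// subr_gt0.
by rewrite -E1; move: h; lra.
Qed.

Lemma th_mono s t : s <= t -> th s <= th t.
Proof.
move=> st; have := mvt_ge (C := 0) st (fun x _ => dth x) (fun x _ => ltW (q0 x)).
by rewrite mul0r; lra.
Qed.

Lemma th_ge0 t : 0 <= t -> 0 <= th t.
Proof. by move=> /th_mono; rewrite th0. Qed.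

Lemma E_mono s t z : s <= t -> E s z <= E t z.
Proof.
move=> st; have := mvt_ge (C := 0) st (fun x _ => dE x z).
rewrite mul0r subr_ge0; apply => x _.
by rewrite mulr_ge0 ?expR_ge0// ltW.
Qed.

Lemma E_ge0 t z : 0 <= t -> 0 <= E t z.
Proof. by move=> /(E_mono z); rewrite E0. Qed.

Lemma A_ge0 t z : 0 <= t -> 0 <= A t z.
Proof. by move=> t0; rewrite AE addr_ge0// mulr_ge0// E_ge0. Qed.

Lemma om_ge0 t x : 0 <= t -> 0 <= om t x.
Proof. by move=> t0; have [z <-] := surj t x; rewrite omP; exact: A_ge0. Qed.

Lemma W_mono t x y : 0 <= t -> x <= y -> W t x <= W t y.
Proof.
move=> t0 xy; have := mvt_ge (C := 0) xy (fun x _ => dW t x) (fun x _ => om_ge0 _ t0).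
by rewrite mul0r; lra.
Qed.

Lemma W_ge0 t x : 0 <= t -> 0 <= W t x.
Proof.
move=> t0; have [xl|/ltW xl] := leP x (P t 2); first by rewrite Wl.
by rewrite -(Wl (lexx (P t 2))); exact: W_mono.
Qed.

Lemma V_left t : 0 <= t -> 2 * W t (P t 2 - a) - W t (P t 2 + b) = - W t (P t 2 + b).
Proof. by move=> t0; rewrite Wl ?mulr0 ?sub0r// gerBl. Qed.

Lemma P2_le t : 0 <= t -> P t 2 <= 2.
Proof.
move=> t0; have := mvt_le (C := 0) t0 (fun s _ => dPt s 2).
rewrite mul0r P0 subr_le0; apply => s /andP[s0 _].
by rewrite V_left// mulrN oppr_le0 mulr_ge0// ?W_ge0// ltW.
Qed.

(* Right of label 6 the stretching L is nondecreasing in time up to an error ep, which makes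
   d_z A at most g A d_z P; left of label 7 it is small. *)
Definition boot t := (forall s s' z, 0 <= s -> s <= s' -> s' <= t -> 6 <= z ->
    L s z <= L s' z + ep) /\
  (forall s z, 0 <= s <= t -> z <= 7 -> `|L s z| <= 1 / 2).

Lemma expR_half x : `|x| <= 1 / 2 -> 1 / 2 <= expR x <= 2.
Proof.
rewrite ler_norml => /andP[x1 x2]; apply/andP; split.
  by have := expR_ge1Dx x; lra.
have h := expR_ge1Dx (- x); rewrite expRN in h.
have : 2^-1 <= (expR x)^-1 by lra.
by rewrite lef_pV2 ?posrE ?expR_gt0//; lra.
Qed.

Section Consequences.
Variable t : R.
Hypothesis t0 : 0 <= t.
Hypothesis tT : th t <= 1 / 16.
Hypothesis bt : boot t.

(** Origin of the constant [expR 12]: [P s 2 <= 2], and the labels from 2 to 7 are stretched by a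
    factor of at most 2, whence [2 + 2 * 5]. *)
Lemma P7_le s : 0 <= s <= t -> P s 7 <= 12.
Proof.
move=> st; have /andP[s0 _] := st.
have : P s 7 - P s 2 <= 2 * (7 - 2).
  apply: (mvt_le (f' := fun z => expR (L s z))) => [|x _|x /andP[_ x7]]; first lra.
    exact: dPz.
  by have /andP[_] := expR_half (bt.2 s x st x7).
by have := P2_le s0; lra.
Qed.

Lemma E7_le z : z <= 7 -> E t z <= th t * expR 12.
Proof.
move=> z7; have := mono_diff t0 (fun s _ => dE s z) (fun s _ => der_cmul (expR 12) (dth s)).
rewrite E0 th0 mulr0 !subr0 mulrC; apply => s st.
rewrite mulrC ler_pM2r ?q0// ler_expR; apply: le_trans (P7_le st).
exact: Pmono.
Qed.

Lemma E7_le' z : z <= 7 -> E t z <= expR 12.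
Proof.
move=> /E7_le h; apply: le_trans h _; rewrite ler_piMl ?expR_ge0//; move: tT; lra.
Qed.

Lemma A7_le z : z <= 7 -> A t z <= 2.
Proof.
move=> z7; rewrite AE; have := w0_le1 z; have := r0_small z.
have : r0 z * E t z <= r0 z * expR 12 by rewrite ler_wpM2l// E7_le'.
lra.
Qed.

(** The first half of [boot] replaces the earlier stretching [e^(L s)] under the time integral by
    [e^ep e^(L t)], which then comes out of the integral. *)
Lemma Ez_le z : 6 <= z -> Ez t z <= expR ep * expR (L t z) * E t z.
Proof.
move=> z6; have := mono_diff t0 (fun s _ => dEzt s z) (fun s _ => der_cmul (expR ep * expR (L t z)) (dE s z)).
rewrite Ez0 E0 mulr0 !subr0; apply => s /andP[s0 st].
rewrite mulrC ler_wpM2r ?mulr_ge0 ?expR_ge0// ?(ltW (q0 _))// -expRD ler_expR addrC.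
exact: bt.1.
Qed.

(** Origin of [g = expR ep + ep]. The slope of [r0] is positive only on [6, 7], where [A >= 1],
    [e^L >= 1/2] and [r0' * expR 12 <= ep / 2] make it cost [ep]. The term [r0 * Ez] costs [expR ep]
    by [Ez_le], as [r0] vanishes left of 6. The slope of [w0] has the good sign beyond 3. *)
Lemma Az_le z : 3 <= z ->
  w0' z + (r0' z * E t z + r0 z * Ez t z) <= g * A t z * expR (L t z).
Proof.
move=> z3; have eL := expR_gt0 (L t z).
have Eg := E_ge0 z t0; have Ag := A_ge0 z t0.
have wl := w0'_le0 z3.
have rE : 0 <= r0 z * E t z by rewrite mulr_ge0.
have h1 : r0' z * E t z <= ep * A t z * expR (L t z).
  have rhs : 0 <= ep * A t z * expR (L t z) by rewrite !mulr_ge0// ltW.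
  have [/andP[z6 z7]|zo] := boolP (6 <= z <= 7); last first.
    by apply: le_trans rhs; rewrite mulr_le0_ge0// r0'_le0.
  have [rn|/ltW rp] := leP (r0' z) 0.
    by apply: le_trans rhs; rewrite mulr_le0_ge0.
  apply: (@le_trans _ _ (r0' z * expR 12)); first by rewrite ler_wpM2l// E7_le'.
  apply: le_trans (r0'_small z) _.
  have A1 : 1 <= A t z.
    by rewrite AE w0_1; [lra|apply/andP; split; move: z6 z7 r8; lra].
  have /andP[L1 _] := expR_half (bt.2 t z ltac:(by rewrite t0 lexx) z7).
  have h2 : ep * 1 * (1 / 2) <= ep * A t z * expR (L t z).
    apply: ler_pM; rewrite ?mulr_ge0// ?(ltW ep0)//.
      by rewrite ler_wpM2l// ltW.
  by lra.
have h2 : r0 z * Ez t z <= expR ep * A t z * expR (L t z).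
  have [z6|z6] := leP 6 z.
    apply: (@le_trans _ _ (r0 z * (expR ep * expR (L t z) * E t z))).
      by rewrite ler_wpM2l// Ez_le.
    have -> : r0 z * (expR ep * expR (L t z) * E t z) =
        expR ep * (r0 z * E t z) * expR (L t z).
      by move: (r0 z) (expR _) (expR _) (E t z) => u1 u2 u3 u4; ring.
    rewrite ler_wpM2r ?expR_ge0// ler_wpM2l ?expR_ge0//.
    by rewrite AE; have := w0_ge0 z; lra.
  by rewrite r0_left ?mul0r ?mulr_ge0 ?expR_ge0// ltW.
rewrite gE !mulrDl; move: wl h1 h2.
by move: (w0' z) (r0' z * _) (r0 z * _) (_ * _ * _) (_ * _ * _) => u1 u2 u3 u4 u5; lra.
Qed.


(** By [Az_le] the product of [A] with [e^(- g P)] is nonincreasing in the label. *)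
Lemma A_growth z z' : 3 <= z -> z <= z' ->
  A t z' <= A t z * expR (g * (P t z' - P t z)).
Proof.
move=> z3 zz.
have dA y : der (A t) y (w0' y + (r0' y * E t y + r0 y * Ez t y)).
  apply: (der_ext (fun z => esym (AE t z))).
  by apply: der_add => //; exact: der_mul.
have dF y : der (fun y => A t y * expR (- g * P t y)) y
   ((w0' y + (r0' y * E t y + r0 y * Ez t y)) * expR (- g * P t y) +
     A t y * (- g * expR (L t y) * expR (- g * P t y))).
  by apply: der_mul => //; apply: der_exp; exact: der_cmul.
have := mvt_le (C := 0) zz (fun x _ => dF x).
rewrite mul0r subr_le0 => H.
have {}H : A t z' * expR (- g * P t z') <= A t z * expR (- g * P t z).
  apply: H => y /andP[zy _]; have := Az_le (le_trans z3 zy).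
  have := expR_gt0 (- g * P t y).
  move: (_ + _) (A t y) (expR (L t y)) (expR _) => u1 u2 u3 u4 u40 h.
  have -> : u1 * u4 + u2 * (- g * u3 * u4) = (u1 - g * u2 * u3) * u4 by ring.
  by rewrite mulr_le0_ge0 ?(ltW u40)// subr_le0.
rewrite mulrBr expRD mulrA -(ler_pM2r (expR_gt0 (- g * P t z'))).
apply: le_trans H _; rewrite le_eqVlt; apply/orP; left; apply/eqP.
by rewrite mulrAC -!mulrA -!expRD; congr (_ * expR _); ring.
Qed.

Lemma om_growth x x' : P t 3 <= x -> x <= x' ->
  om t x' <= om t x * expR (g * (x' - x)).
Proof.
have [z <-] := surj t x; have [z' <-] := surj t x'.
rewrite !omP !(Pmono_le t) => z3 zz; exact: A_growth.
Qed.

(** Labels 3 and 6 stay at distance at least 3/2, while [a <= 1]: the point at distance [a] to the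
    left of any label beyond 6 remains where [om_growth] applies. *)
Lemma P63 : P t 3 <= P t 6 - a.
Proof.
have : (1 / 2) * (6 - 3) <= P t 6 - P t 3.
  apply: (mvt_ge (f' := fun z => expR (L t z))) => [|x _|x /andP[_ x7]]; first lra.
    exact: dPz.
  have x7' : x <= 7 by lra.
  by have /andP[] := expR_half (bt.2 t x ltac:(by rewrite t0 lexx) x7').
by move: ab1 b0; lra.
Qed.

Lemma om7_le x : x <= P t 7 -> om t x <= 2.
Proof. by have [z <-] := surj t x; rewrite omP Pmono_le; exact: A7_le. Qed.

(** The rate of L at label 7 looks ahead by [b], beyond the region where omega is at most 2; the
    growth bound costs a further factor [e^(g b) < 2]. *)
Lemma om7b_le x : x <= P t 7 + b -> om t x <= 4.
Proof.
have [x7 _|/ltW x7 xb] := leP x (P t 7); first by have := om7_le x7; lra.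
apply: le_trans (om_growth (Pmono t _) x7) _; first lra.
have -> : 4 = 2 * 2 :> R by lra.
apply: ler_pM; rewrite ?expR_ge0 ?om_ge0 ?om7_le//.
apply/ltW; apply: le_lt_trans g2; rewrite ler_expR ler_wpM2l//.
by move: a0; lra.
Qed.

Lemma rate6 z : 6 <= z ->
  (2 * expR (- (g * a)) - expR (g * b)) * A t z <=
  2 * om t (P t z - a) - om t (P t z + b).
Proof.
move=> z6; have := Pmono t z6 => Pz.
have h1 : om t (P t z) <= om t (P t z - a) * expR (g * a).
  have -> : g * a = g * (P t z - (P t z - a)) by ring.
  by apply: om_growth; rewrite ?gerBl//; move: P63 Pz; lra.
have h2 : om t (P t z + b) <= om t (P t z) * expR (g * b).
  have -> : g * b = g * (P t z + b - P t z) by ring.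
  by apply: om_growth; rewrite ?lerDl//; move: P63 Pz a0; lra.
rewrite -omP expRN; move: h1 h2; rewrite -ler_pdivrMr ?expR_gt0//.
by move: (om t _) (om t _) (om t _) (expR _) (_^-1) => u1 u2 u3 u4 u5; lra.
Qed.

Lemma kap_gt0 : 0 < 2 * expR (- (g * a)) - expR (g * b).
Proof.
have -> : expR (g * b) = expR (- (g * a)) * expR (g * (a + b)).
  by rewrite -expRD; congr expR; ring.
have := expR_gt0 (- (g * a)); move: g2.
move: (expR (g * (a + b))) (expR (- (g * a))) => u v h1 h2.
have -> : 2 * v - v * u = v * (2 - u) by ring.
by rewrite mulr_gt0// subr_gt0.
Qed.

Lemma rate6_ge0 z : 6 <= z -> 0 <= 2 * om t (P t z - a) - om t (P t z + b).
Proof.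
by move=> /rate6; apply: le_trans; rewrite mulr_ge0 ?A_ge0// ltW// kap_gt0.
Qed.

Lemma rate7 z : z <= 7 -> `|2 * om t (P t z - a) - om t (P t z + b)| <= 4.
Proof.
move=> z7; have Pz := Pmono t z7.
have h1 : om t (P t z - a) <= 2 by apply: om7_le; move: a0; lra.
have h2 : om t (P t z + b) <= 4 by apply: om7b_le; lra.
have := om_ge0 (P t z - a) t0; have := om_ge0 (P t z + b) t0.
by move: h1 h2; rewrite ler_norml; move: (om t _) (om t _) => u v *; apply/andP; split; lra.
Qed.

End Consequences.
Lemma boot_le s t : s <= t -> boot t -> boot s.
Proof.
move=> st [H1 H2]; split=> [u u' z u0 uu us z6|u z /andP[u0 us] z7].
  by apply: H1 => //; exact: le_trans st.
by apply: H2 => //; rewrite u0; exact: le_trans st.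
Qed.

Lemma th_le s t : s <= t -> th t <= 1 / 16 -> th s <= 1 / 16.
Proof. by move=> /th_mono st; exact: le_trans. Qed.

(** First improvement of [boot]: the error [ep] drops to 0, because the rate of L is nonnegative
    beyond label 6. *)
Lemma L_mono t s s' z : th t <= 1 / 16 -> boot t ->
  0 <= s -> s <= s' -> s' <= t -> 6 <= z -> L s z <= L s' z.
Proof.
move=> tT bt s0 ss st z6; have := mvt_ge (C := 0) ss (fun x _ => dL x z).
rewrite mul0r subr_ge0; apply => x /andP[sx xs].
have x0 := le_trans s0 sx; have xt := le_trans xs st.
apply: mulr_ge0; first exact: ltW.
by apply: (rate6_ge0 x0 (th_le xt tT) (boot_le xt bt)).
Qed.

(** Second improvement of [boot], from 1/2 to 1/4, and the origin of the time 1/16: by [rate7] the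
    rate is at most 4 per unit of original time. *)
Lemma L7_le t s z : th t <= 1 / 16 -> boot t -> 0 <= s <= t -> z <= 7 ->
  `|L s z| <= 1 / 4.
Proof.
move=> tT bt /andP[s0 st] z7.
have bd x : 0 <= x <= s -> `|2 * om x (P x z - a) - om x (P x z + b)| <= 4.
  move=> /andP[x0 xs]; have xt := le_trans xs st.
  exact: (rate7 x0 (th_le xt tT) (boot_le xt bt)).
have dt4 (c : R) x : der (fun x => c * th x) x (c * q x) by exact: der_cmul.
have h1 : L s z - L 0 z <= 4 * th s - 4 * th 0.
  apply: (@mono_diff _ (L^~ z) _ (fun x => 4 * th x) (fun x => 4 * q x) 0 s s0 (fun x _ => dL x z) (fun x _ => dt4 4 x)).
  move=> x /bd; rewrite ler_norml => /andP[_ h].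
  by rewrite mulrC ler_wpM2r// ltW.
have h2 : - 4 * th s - - 4 * th 0 <= L s z - L 0 z.
  apply: (@mono_diff _ (fun x => - 4 * th x) (fun x => - 4 * q x) (L^~ z) _ 0 s s0 (fun x _ => dt4 (- 4) x) (fun x _ => dL x z)).
  move=> x /bd; rewrite ler_norml => /andP[h _].
  by rewrite [leRHS]mulrC ler_wpM2r// ltW.
move: h1 h2; rewrite L0 th0 !mulr0 !subr0 => h1 h2.
have := th_le st tT; rewrite ler_norml => ?; apply/andP; split; lra.
Qed.

(** The margins won by [L_mono] and [L7_le], namely [ep] and 1/4, are what a step of length [d] at
    rate at most [M] may spend. *)
Lemma boot_step t d M : 0 <= t -> th t <= 1 / 16 -> boot t -> 0 <= d ->
  M * d <= ep -> M * d <= 1 / 4 ->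
  (forall s z, t <= s <= t + d ->
    `|q s * (2 * om s (P s z - a) - om s (P s z + b))| <= M) ->
  boot (t + d).
Proof.
move=> t0 tT bt d0 Me M4 HM.
have M0 : 0 <= M by apply: le_trans (HM t 0 _); rewrite ?lexx ?lerDl.
have dif s s' z : t <= s -> s <= s' -> s' <= t + d -> `|L s' z - L s z| <= M * d.
  move=> ts ss sd; apply: (@le_trans _ _ (M * (s' - s))).
    apply: (mvt_bound ss (fun x _ => dL x z)) => x /andP[sx xs].
    by apply: HM; rewrite (le_trans ts sx)/= (le_trans xs sd).
  by rewrite ler_wpM2l//; move: ts sd; lra.
split=> [s s' z s0 ss sd z6|s z /andP[s0 sd] z7].
  have [st'|/ltW ts'] := leP s' t.
    by apply: le_trans (L_mono tT bt s0 ss st' z6) _; rewrite lerDl ltW.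
  have [st|/ltW ts] := leP s t.
    have := L_mono tT bt s0 st (lexx t) z6; have := dif t s' z (lexx t) ts' sd.
    by rewrite ler_norml => /andP[]; move: Me; lra.
  by have := dif s s' z ts ss sd; rewrite ler_norml => /andP[]; move: Me; lra.
have [st|/ltW ts] := leP s t.
  by apply: le_trans (L7_le tT bt _ z7) _; rewrite ?s0//; lra.
have := dif t s z (lexx t) ts sd; have := L7_le tT bt (s := t) _ z7.
rewrite t0 lexx => /(_ isT); rewrite !ler_norml => /andP[? ?] /andP[? ?].
by apply/andP; split; move: M4; lra.
Qed.

Lemma boot0 : boot 0.
Proof.
split=> [s s' z s0 ss s'0 z6|s z /andP[s0 s00] z7].
  have -> : s = 0 by apply/eqP; rewrite eq_le s0 (le_trans ss).
  have -> : s' = 0 by apply/eqP; rewrite eq_le s'0 (le_trans s0).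
  by rewrite lerDl ltW.
have -> : s = 0 by apply/eqP; rewrite eq_le s0 s00.
by rewrite L0 normr0; lra.
Qed.

Lemma boot_all t : 0 <= t -> th t <= 1 / 16 -> boot t.
Proof.
move=> t0 tT; have [M HM] := GM t.
have M0 : 0 <= M by apply: le_trans (HM 0 0 _); rewrite ?lexx.
(* [M] bounds the rate on all of [0, t], so the step length is uniform and finitely many steps reach
   [t]. *)
pose d := Num.min ep (1 / 4) / (M + 1).
have m0 : 0 < Num.min ep (1 / 4) by rewrite lt_min ep0/=; lra.
have d0 : 0 < d by rewrite divr_gt0//; move: M0; lra.
have Md : M * d <= Num.min ep (1 / 4).
  rewrite /d mulrA ler_pdivrMr; last by move: M0; lra.
  by rewrite mulrC ler_wpM2l ?(ltW m0)//; lra.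
have Me : M * d <= ep by apply: le_trans Md _; rewrite ge_min lexx.
have M4 : M * d <= 1 / 4 by apply: le_trans Md _; rewrite ge_min lexx orbT.
have H n : boot (Num.min (n%:R * d) t).
  elim: n => [|n IH]; first by rewrite mul0r (min_idPl t0); exact: boot0.
  set s := Num.min _ t in IH.
  have s0 : 0 <= s by rewrite le_min t0 mulr_ge0// ltW.
  have st : s <= t by rewrite ge_min lexx orbT.
  pose d' := Num.min d (t - s).
  have d'0 : 0 <= d' by rewrite le_min ltW//= subr_ge0.
  have d'd : d' <= d by rewrite ge_min lexx.
  have d't : d' <= t - s by rewrite ge_min lexx orbT.
  have -> : Num.min (n.+1%:R * d) t = s + d'.
    rewrite /d' /s -natr1 mulrDl mul1r; move: d0.
    case: (leP (n%:R * d) t) => h1; case: (leP (n%:R * d + d) t) => h2 d0;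
      case: leP; lra.
  have Md' : M * d' <= M * d by rewrite ler_wpM2l.
  apply: (boot_step s0 (th_le st tT) IH d'0 (le_trans Md' Me) (le_trans Md' M4)).
  by move=> x z /andP[sx xs]; apply: HM; apply/andP; split; move: d't s0; lra.
pose n := (Num.truncn (t / d)).+1.
have nt : t <= n%:R * d by rewrite -ler_pdivrMr// ltW// truncnS_gt.
by have := H n; rewrite (min_idPr nt).
Qed.

(** Label 2 is moved only by the term [W (P t 2 + b) <= 4 b], so it retreats by at most 4/16. This
    keeps the support at z > 0, that is, away from x = 1. *)
Lemma P2_ge t : 0 <= t -> th t <= 1 / 16 -> 1 <= P t 2.
Proof.
move=> t0 tT.
have : - 4 * th t - - 4 * th 0 <= P t 2 - P 0 2.
  apply: (@mono_diff _ (fun x => - 4 * th x) (fun x => - 4 * q x) (P^~ 2) _ 0 t t0 _ (fun x _ => dPt x 2)).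
    by move=> x _; exact: der_cmul.
  move=> x /andP[x0 xt]; rewrite V_left// [leRHS]mulrC ler_wpM2r ?(ltW (q0 _))// lerN2.
  have bx := boot_all x0 (th_le xt tT).
  have h : P x 2 <= P x 2 + b by rewrite lerDl.
  have := mvt_le (C := 4) h (fun y _ => dW x y).
  rewrite (Wl (lexx (P x 2))) subr0 addrAC subrr add0r => H.
  apply: le_trans (H _) _; last by move: ab1 a0; lra.
  move=> y /andP[_ yb]; apply: (om7b_le x0 (th_le xt tT) bx).
  apply: le_trans yb _; rewrite lerD2r; apply: Pmono; lra.
by rewrite th0 P0 mulr0 subr0; move: tT; lra.
Qed.

(** One of the two copies of [W (P t 6 - a)] is dropped as nonnegative; the other leaves the
    integral of omega over an interval of length [a + b <= 1], at most 4. The bound starts the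
    cascade. *)
Lemma P6_ge t : 0 <= t -> th t <= 1 / 16 -> 5 <= P t 6.
Proof.
move=> t0 tT.
have : - 4 * th t - - 4 * th 0 <= P t 6 - P 0 6.
  apply: (@mono_diff _ (fun x => - 4 * th x) (fun x => - 4 * q x) (P^~ 6) _ 0 t t0 _ (fun x _ => dPt x 6)).
    by move=> x _; exact: der_cmul.
  move=> x /andP[x0 xt]; rewrite [leRHS]mulrC ler_wpM2r ?(ltW (q0 _))//.
  have bx := boot_all x0 (th_le xt tT).
  have h : P x 6 - a <= P x 6 + b by move: a0 b0; lra.
  have := mvt_le (C := 4) h (fun y _ => dW x y).
  have W0 := W_ge0 (P x 6 - a) x0.
  have -> : P x 6 + b - (P x 6 - a) = a + b by ring.
  move=> H; suff : W x (P x 6 + b) - W x (P x 6 - a) <= 4 * (a + b).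
    by move: ab1 W0; move: (W x _) (W x _) => u v; lra.
  apply: H => y /andP[_ yb]; apply: (om7b_le x0 (th_le xt tT) bx).
  by apply: le_trans yb _; rewrite lerD2r; apply: Pmono; lra.
by rewrite th0 P0 mulr0 subr0; move: tT; lra.
Qed.

Lemma Pdiff_ge t z z' m : 6 <= z -> z <= z' ->
  (forall y, z <= y <= z' -> m <= L t y) -> expR m * (z' - z) <= P t z' - P t z.
Proof.
move=> z6 zz Hm; apply: (mvt_ge zz (fun x _ => dPz t x)) => x /Hm.
by rewrite ler_expR.
Qed.

Let kap := 2 * expR (- (g * a)) - expR (g * b).

(* One step of the cascade: once the labels beyond [z] sit above [m] during [s, s'], the double
   time integral of exp m bounds the logarithm of their stretching from below. *)
Lemma L_gain s s' z m : 0 <= s -> s <= s' -> th s' <= 1 / 16 -> 7 <= z <= r ->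
  (forall x, s <= x <= s' -> m <= P x z) ->
  kap * eta * expR m * ((th s' - th s) ^+ 2 / 2) <= L s' z.
Proof.
move=> s0 ss sT zr Hm; have /andP[z7 _] := zr.
have bs := boot_all (le_trans s0 ss) sT.
have EG x : s <= x <= s' -> expR m * (th x - th s) <= E x z.
  move=> /andP[sx xs].
  have : expR m * th x - expR m * th s <= E x z - E s z.
    apply: (@mono_diff _ (fun x => expR m * th x) (fun x => expR m * q x) (E^~ z)) => //.
    - by move=> y _; exact: der_cmul.
    - by move=> y _; exact: dE.
    - move=> y /andP[sy yx]; rewrite mulrC ler_wpM2l ?(ltW (q0 _))// ler_expR.
      by apply: Hm; rewrite sy (le_trans yx).
  by have := E_ge0 z s0; rewrite mulrBr; lra.
pose c := kap * eta * expR m.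
have dF x : der (fun x => c * ((th x - th s) * (th x - th s) / 2)) x (c * (q x * (th x - th s))).
  have d1 : der (fun x => th x - th s) x (q x).
    by apply: (der_eq (subr0 _)); apply: der_sub => //; exact: der_cst.
  apply: der_eq (der_cmul c (der_mul (der_mul d1 d1) (der_cst 2^-1 x))).
  by field.
have : c * ((th s' - th s) * (th s' - th s) / 2) - c * ((th s - th s) * (th s - th s) / 2) <= L s' z - L s z.
  apply: (@mono_diff _ (fun x => c * ((th x - th s) * (th x - th s) / 2)) (fun x => c * (q x * (th x - th s))) (L^~ z)) => //.
    by move=> x _; exact: dL.
  move=> x /andP[sx xs]; have x0 := le_trans s0 sx; have xT := th_le xs sT.
  rewrite mulrCA ler_wpM2l ?(ltW (q0 _))//.
  apply: le_trans (rate6 x0 xT (boot_le xs bs) _); last lra.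
  rewrite /c -/kap -!mulrA ler_wpM2l ?(ltW kap_gt0)//.
  rewrite AE r0_eta//; apply: (@le_trans _ _ (eta * E x z)); last by rewrite lerDr.
  by rewrite ler_wpM2l ?(ltW eta0)// EG// sx.
rewrite subrr !mul0r mulr0 subr0 -expr2 -/c.
have := L_mono sT bs (lexx 0) s0 ss (z := z); rewrite L0 => /(_ ltac:(lra)).
by lra.
Qed.

Hypothesis r_big : 6 <= kap * eta * expR (r - 2) * (32^-1 * 32^-1 * 2^-1).

(** Balance of the cascade: the k-th time gap [2^-k / 32] enters [L_gain] squared, giving [4^-k],
    while the position [r - 2 + 3 k] gives [e^(3 k) >= 8^k]; with [r_big] the stretching exponent is
    at least [6 * 2^k]. Since [e^y >= y], a label interval of length [2^-k / 2] becomes at least 3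
    long, which is the next advance by 3. *)
Lemma th_small t : 0 <= t -> th t < 1 / 16.
Proof.
move=> t0; rewrite ltNge; apply/negP => tT.
have cth : continuous th by move=> x; exact: der_cont (dth x).
have ivt v : 0 <= v <= 1 / 16 -> exists2 s, 0 <= s & th s = v.
  move=> /andP[v0 v1]; have [||s] := @IVT R th 0 t v t0.
  - exact: continuous_subspaceT.
  - by rewrite th0; rewrite (min_idPl _) ?(max_idPr _) ?v0 ?(le_trans v1)// th_ge0.
  - by rewrite in_itv/= => /andP[s0 _] E1; exists s.
have pk k : 0 < (2 : R) ^+ k by rewrite exprn_gt0.
have ik k : 0 < ((2 : R) ^+ k)^-1 <= 1.
  by rewrite invr_gt0 pk invf_le1// exprn_ege1// ler1n.
have [s Hs] : {s : nat -> R & forall k, 0 <= s k /\ th (s k) = 1 / 16 * (1 - (2 ^+ k)^-1)}.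
  apply: (@choice _ _ (fun k x => 0 <= x /\ th x = 1 / 16 * (1 - (2 ^+ k)^-1))) => k.
  have [|x x0 xE] := ivt (1 / 16 * (1 - (2 ^+ k)^-1)); last by exists x.
  by have /andP[? ?] := ik k; apply/andP; split; lra.
have [S S0 ST] := ivt (1 / 16) ltac:(apply/andP; split; lra).
have STl : th S <= 1 / 16 by rewrite ST.
have thle x y : th x < th y -> x <= y.
  by move=> h; rewrite leNgt; apply/negP => /ltW /th_mono; rewrite leNgt h.
have ss k : s k <= s k.+1.
  apply: thle; rewrite !(Hs _).2; have /andP[? ?] := ik k.
  have -> : (2 ^+ k.+1)^-1 = (2 ^+ k)^-1 / 2 :> R by rewrite exprS invfM mulrC.
  lra.
have sS k : s k <= S by apply: thle; rewrite (Hs k).2 ST; have /andP[? ?] := ik k; lra.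
pose rk k := r - (2 ^+ k)^-1.
have rk7 k : 7 <= rk k <= r.
  by have /andP[? ?] := ik k; move: r8 => ?; rewrite /rk; apply/andP; split; lra.
have e38 k : 8 ^+ k <= expR (3 * k%:R) :> R.
  rewrite mulrC expRM_natl lerXn2r ?nnegrE ?expR_ge0//.
  have -> : (3 : R) = 3%:R * 1 by rewrite mulr1.
  rewrite expRM_natl.
  have h : 2 <= expR 1 :> R by have := expR_ge1Dx (1 : R); lra.
  have -> : (8 : R) = 2 ^+ 3 by rewrite !exprS expr0; ring.
  by rewrite lerXn2r ?nnegrE ?expR_ge0.
have claim k : forall x, s k <= x <= S -> r - 2 + 3 * k%:R <= P x (rk k).
  elim: k => [|k IH] x /andP[sx xS].
    have x0 : 0 <= x by apply: le_trans sx; exact: (Hs 0%N).1.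
    have xT := th_le xS STl; have bx := boot_all x0 xT.
    (* Start of the cascade: beyond label 6 lengths never shrink, as [L >= 0] there, and
       [P x 6 >= 5]; so [r - 1] sits at [5 + (r - 7) = r - 2] at least. *)
    have rE : rk 0%N = r - 1 by rewrite /rk expr0 invr1.
    have : expR 0 * (rk 0%N - 6) <= P x (rk 0%N) - P x 6.
      apply: Pdiff_ge => // [|y /andP[y6 _]]; first by rewrite rE; move: r8; lra.
      by rewrite -(L0 y); apply: (L_mono xT bx).
    by have := P6_ge x0 xT; rewrite expR0 mul1r rE mulr0; lra.
  have sk0 := (Hs k).1; have sk10 := (Hs k.+1).1.
  have x0 : 0 <= x by exact: le_trans sx.
  have xT := th_le xS STl; have bx := boot_all x0 xT.
  set m := r - 2 + 3 * k%:R in IH.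
  have /andP[i0 i1] := ik k.
  have iS : (2 ^+ k.+1)^-1 = (2 ^+ k)^-1 / 2 :> R by rewrite exprS invfM mulrC.
  have rr : rk k <= rk k.+1 by rewrite /rk iS; lra.
  have /andP[rk7' rkr] := rk7 k; have /andP[_ rkr1] := rk7 k.+1.
  have gain y : rk k <= y <= rk k.+1 -> 6 * 2 ^+ k <= L x y.
    move=> /andP[y1 y2]; have yr : 7 <= y <= r by apply/andP; split; lra.
    (* What is gained by the time [s k.+1] is kept until [x], because L is nondecreasing in time
       beyond label 6. *)
    apply: (@le_trans _ _ (L (s k.+1) y)); last first.
      by apply: (L_mono xT bx) => //; move: yr => /andP[]; lra.
    apply: le_trans (L_gain (m := m) sk0 (ss k) (th_le (sS _) STl) yr _); last first.
      move=> v /andP[v1 v2]; apply: le_trans (IH v _) _.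
        by rewrite v1 (le_trans v2 (sS _)).
      exact: Pmono.
    have -> : th (s k.+1) - th (s k) = (2 ^+ k)^-1 / 32.
      by rewrite !(Hs _).2 iS; lra.
    rewrite /m expRD.
    have h4 : 2 ^+ k <= expR (3 * k%:R) * ((2 ^+ k)^-1) ^+ 2 :> R.
      rewrite exprVn -exprM ler_pdivlMr ?exprn_gt0//.
      apply: le_trans (e38 k); rewrite -exprD.
      have -> : (8 : R) = 2 ^+ 3 by rewrite !exprS expr0; ring.
      by rewrite -exprM -[(k + _)%N]/(k + k * 2)%N addnC -mulnSr mulnC.
    have e0 := expR_gt0 (3 * k%:R : R).
    have pk0 := pk k.
    apply: (@le_trans _ _ (kap * eta * expR (r - 2) * (32^-1 * 32^-1 * 2^-1) * 2 ^+ k)); first by rewrite ler_wpM2r// ltW.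
    have -> : kap * eta * (expR (r - 2) * expR (3 * k%:R)) * (((2 ^+ k)^-1 / 32) ^+ 2 / 2) =
        kap * eta * expR (r - 2) * (32^-1 * 32^-1 * 2^-1) * (expR (3 * k%:R) * ((2 ^+ k)^-1) ^+ 2).
      move: (kap * eta) (expR (r - 2)) (expR (3 * k%:R)) ((2 ^+ k)^-1) (32^-1) (2^-1) => c u v w c1 c2; ring.
    by rewrite ler_wpM2l//; apply: le_trans r_big.
  have := Pdiff_ge (t := x) (z := rk k) (z' := rk k.+1) (m := 6 * 2 ^+ k) ltac:(lra) rr gain.
  have -> : rk k.+1 - rk k = (2 ^+ k)^-1 / 2 by rewrite /rk iS; lra.
  have h3 : 3 <= expR (6 * 2 ^+ k) * ((2 ^+ k)^-1 / 2) :> R.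
    have := expR_ge1Dx (6 * 2 ^+ k : R); move: (pk k) => p0 h.
    apply: (@le_trans _ _ (6 * 2 ^+ k * ((2 ^+ k)^-1 / 2))).
      by rewrite mulrA mulfK ?gt_eqF//; lra.
    by rewrite ler_wpM2r ?divr_ge0 ?(ltW i0)//; lra.
  have := IH x ltac:(rewrite xS (le_trans (ss k) sx)//).
  by rewrite /m -natr1; move: h3; move: (expR _ * _) (P x _) (P x _) => u v w; lra.
(* The claim holds for every k at the single time [S], so the finite position of label [r] would
   exceed [r - 2 + 3 n] for all n. *)
pose n := (Num.truncn (P S r - r + 2)).+1.
have := claim n S; rewrite sS lexx => /(_ isT).
have : P S (rk n) <= P S r by apply: Pmono; case/andP: (rk7 n).
have : P S r - r + 2 < n%:R by exact: truncnS_gt.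
have : 0 <= n%:R :> R by [].
lra.
Qed.

End Bootstrap.

(** * Uniqueness in K^n *)

Section FunctionSpaces.
Context {R : realType}.
Implicit Types (f g : R -> R) (x y t s d : R) (n k : nat).

Lemma derivable_der f x : derivable f x 1 -> der f x (derive1 f x).
Proof. by move=> df; rewrite /der derive1E; exact: derivableP. Qed.

Lemma der_derive1 f x l : der f x l -> derive1 f x = l.
Proof. by move=> [_ <-]; rewrite derive1E. Qed.

Lemma inK_der n f x : (1 <= n)%N -> inK n f -> der f x (derive1 f x).
Proof. by move=> n1 [[H _] _ _]; apply: derivable_der; exact: (H 0%N n1). Qed.

Lemma inK_out n f x : inK n f -> ~~ (0 < x < 1) -> f x = 0.
Proof.
move=> [_ _ sf]; apply: contraNeq => fx.
by have := sf x; rewrite /= in_itv/=; apply; exact: subset_closure.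
Qed.

Lemma Cnorm_ge n k f x : (k <= n)%N -> 0 < x < 1 ->
  (`|derive1n k f x|%:E <= Cnorm n f)%E.
Proof.
move=> kn x01; pose S j := ereal_sup [set `|derive1n j f x|%:E | x in `]0%R, 1%R[].
have S0 j : (0 <= S j)%E.
  apply: (@le_trans _ _ `|derive1n j f x|%:E); first by rewrite lee_fin.
  by apply: ereal_sup_ubound; exists x => //=; rewrite in_itv.
have kn' : (k < n.+1)%N by [].
rewrite /Cnorm (bigD1 (Ordinal kn'))//=.
apply: (@le_trans _ _ (S k)); last first.
  by rewrite leeDl//; apply: sume_ge0 => j _; exact: (S0 j).
by apply: ereal_sup_ubound; exists x => //=; rewrite in_itv.
Qed.

Lemma Cnorm_ge0 n f : (0 <= Cnorm n f)%E.
Proof.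
have h : 0 < (1 / 2 : R) < 1 by apply/andP; split; lra.
by apply: le_trans (Cnorm_ge f (leq0n n) h); rewrite lee_fin.
Qed.

Lemma supp_min n f : inK n f -> (exists x, f x != 0) ->
  [/\ 0 < inf (supp f) & forall x, f x != 0 -> inf (supp f) <= x].
Proof.
move=> [_ cf sf] [x0 fx0].
have s0 : supp f x0 by exact: subset_closure.
have [||c cS Hc] := @compact_EVT_min _ _ (id : R -> R) (supp f) _ cf.
- by exists x0.
- by apply: continuous_subspaceT => x; exact: cvg_id.
have c0 : 0 < c.
  by move: cS; rewrite inE => /sf; rewrite /= in_itv/= => /andP[].
have ic : c <= inf (supp f).
  apply: lb_le_inf; first by exists x0.
  by move=> y ys; apply: Hc; rewrite inE.
split=> [|x fx]; first exact: lt_le_trans ic.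
apply: ge_inf; last exact: subset_closure.
by exists c => y ys; apply: Hc; rewrite inE.
Qed.

(** What uniqueness takes from [Ksize]: a Lipschitz bound, and a support at distance at least
    [1 / M] from 0, which makes the singular factors [1 / x] harmless. *)
Lemma Ksize_bound n f M : (1 <= n)%N -> inK n f -> (Ksize n f <= M%:E)%E ->
  (forall x, 0 < x < 1 -> `|derive1 f x| <= M) /\
  (forall x, f x != 0 -> 1 <= x * M).
Proof.
move=> n1 Kf KM.
have i0 : 0 <= (inf (supp f))^-1.
  rewrite invr_ge0; have [/(supp_min Kf)[/ltW//]|ne] := pselect (exists x, f x != 0).
  suff -> : supp f = set0 by rewrite inf0.
  rewrite /supp (_ : [set x | f x != 0] = set0) ?closure0//.
  by apply/seteqP; split => // x /= fx; apply: ne; exists x.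
split=> [x x01|x fx].
  rewrite -lee_fin; apply: le_trans KM; apply: le_trans (Cnorm_ge f n1 x01) _.
  by rewrite leeDl.
have [p0 Hp] := supp_min Kf (ex_intro _ x fx).
have : ((inf (supp f))^-1%:E <= M%:E)%E.
  by apply: le_trans KM; rewrite leeDr// Cnorm_ge0.
rewrite lee_fin => iM.
apply: (@le_trans _ _ (x * (inf (supp f))^-1)).
  by rewrite ler_pdivlMr// mul1r Hp.
by rewrite ler_wpM2l//; apply: le_trans (Hp x fx); exact: ltW.
Qed.

Lemma inK_sub_out n f g x : inK n f -> inK n g -> ~~ (0 < x < 1) -> f x - g x = 0.
Proof. by move=> Kf Kg h; rewrite (inK_out Kf h) (inK_out Kg h) subrr. Qed.

Lemma time_cont n T (F : R -> R -> R) : continuous_in_K n T F ->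
  forall t0, 0 <= t0 < T -> forall e, 0 < e -> exists2 d : R, 0 < d &
    forall t, 0 <= t < T -> `|t - t0| < d -> forall x, `|F t x - F t0 x| < e.
Proof.
move=> [KF cF _] t0 t0T e e0.
have := cF t0 t0T => /(_ [set y | (y < e%:E)%E]) H.
have /H : nbhs (0%E : \bar R) [set y | (y < e%:E)%E].
  by apply: open_ereal_lt'; rewrite lte_fin.
rewrite /within/= => /nbhs_ballP[d /= d0 Hd]; exists d => // t tT td x.
have [x01|xo] := boolP (0 < x < 1); last first.
  by rewrite (inK_sub_out (KF _ tT) (KF _ t0T) xo) normr0.
rewrite -lte_fin; apply: le_lt_trans (Hd t _ _); last by rewrite /= in_itv.
  by have := Cnorm_ge (F t \- F t0) (leq0n n) x01; rewrite derive1n0.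
by rewrite /ball/= distrC.
Qed.

(** Joint continuity on the closed rectangle, so that the maximum in [unique] is attained. *)
Lemma within_cont n T T' (F : R -> R -> R) : continuous_in_K n T F -> (1 <= n)%N -> T' < T ->
  {within `[0, T']%classic `*` `[0, 1]%classic, continuous (fun p : R * R => F p.1 p.2)}.
Proof.
move=> cK n1 TT; apply/subspace_continuousP => -[t0 x0] [/=].
rewrite !in_itv/= => /andP[t00 t0T] _.
have t0TT : 0 <= t0 < T by rewrite t00 (le_lt_trans t0T).
apply/cvgrPdist_lt => e e0; have e2 : 0 < e / 2 by rewrite divr_gt0.
have [d d0 Hd] := time_cont cK t0TT e2.
have [KF _ _] := cK.
have /cvgrPdist_lt /(_ _ e2) := der_cont (inK_der x0 n1 (KF _ t0TT)).
move=> /nbhs_ballP[d1 /= d10 H1].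
rewrite /within/=; near_simpl.
apply/(@nbhs_ballP R (R * R)%type (t0, x0)); exists (Num.min d d1); first by rewrite /= lt_min d0.
move=> [t x] [/=]; rewrite /ball/= !lt_min => /andP[td _] /andP[_ xd] [/=].
rewrite !in_itv/= => /andP[t1 tT] _.
have tT' : 0 <= t < T by rewrite t1 (le_lt_trans tT).
have h1 := Hd t tT' ltac:(by rewrite distrC) x.
have h2 := H1 x xd; rewrite /= in h2.
have := ler_distD (F t0 x) (F t x) (F t0 x0).
by rewrite distrC (distrC (F t0 x) (F t0 x0)); lra.
Qed.

Lemma der_left f x l : der f x l -> l < 0 -> forall e, 0 < e ->
  exists2 h, 0 < h < e & f x < f (x - h).
Proof.
move=> df l0 e e0; have e2 : 0 < - l / 2 by lra.
have [d d0 Hd] := der_epsP df e2.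
pose h := Num.min d e / 2.
have h0 : 0 < h by rewrite divr_gt0// lt_min d0.
have md : Num.min d e <= d by rewrite ge_min lexx.
have me : Num.min d e <= e by rewrite ge_min lexx orbT.
exists h; first by apply/andP; split => //; rewrite /h in h0 *; lra.
have := Hd (- h); rewrite normrN gtr0_norm// => /(_ _) H.
have {}H := H ltac:(rewrite /h in h0 *; lra).
move: H; rewrite ler_norml => /andP[H _].
have : 0 < - l * h by rewrite mulr_gt0// oppr_gt0.
by lra.
Qed.

Lemma der_opp_arg f x l : der f x l -> der (fun y => f (- y)) (- x) (- l).
Proof.
move=> df; apply: (der_eq (l := (- 1) * l)); first by rewrite mulN1r.
apply: (@der_comp _ f (fun y => - y)); first by rewrite opprK.
by apply: der_opp; exact: der_id.
Qed.

Lemma der_max f x l d : der f x l -> 0 < d ->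
  (forall y, `|y - x| < d -> f y <= f x) -> l = 0.
Proof.
move=> df d0 H; have [l0|l0|//] := ltgtP l 0.
  have [h /andP[h0 hd]] := der_left df l0 d0.
  by rewrite ltNge H// addrAC subrr add0r normrN gtr0_norm.
have l0' : - l < 0 by rewrite oppr_lt0.
have [h /andP[h0 hd]] := der_left (der_opp_arg df) l0' d0.
by rewrite opprK opprB opprK ltNge H// addrK gtr0_norm.
Qed.

End FunctionSpaces.

(** * Maximum principle for the difference of two solutions *)

Section Uniqueness.
Context {R : realType}.
Implicit Types (f g w : R -> R) (x y t s c d : R) (n k : nat).
Variables (b1 b2 : R).
Hypothesis b2_gt0 : 0 < b2.
Hypothesis b21 : b2 <= b1.

Lemma div_cont w c : continuous w -> 0 < c -> (forall x, x < c -> w x = 0) ->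
  continuous (fun y => w y / y).
Proof.
move=> cw c0 wc y; have [yc|cy] := ltP y c.
  apply/cvgrPdist_lt => e e0; near=> z.
  rewrite (wc y yc) (wc z) ?mul0r ?subrr ?normr0//.
  by near: z; exact: lt_nbhsl.
apply: cvgM; first exact: cw.
by apply: cvgV; [rewrite gt_eqF//; exact: lt_le_trans cy|exact: cvg_id].
Unshelve. all: by end_near. Qed.

Lemma velocity_prim w x : 0 <= x ->
  velocity b1 b2 w x =
  x * prim (fun y => w y / y) (Num.min (b2 * x) 1) (Num.min (b1 * x) 1) -
  x * prim (fun y => w y / y) (Num.min (b1 * x) 1) 1.
Proof.
move=> x0; have h : b2 * x <= b1 * x by rewrite ler_wpM2r.
have h1 : Num.min (b2 * x) 1 <= Num.min (b1 * x) 1.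
  by rewrite le_min !ge_min h lexx orbT.
have h2 : Num.min (b1 * x) 1 <= 1 by rewrite ge_min lexx orbT.
by rewrite /velocity /prim h1 h2.
Qed.

(** The bound on [w - w'] is weighted by [y] so that the quotients by [y] differ by at most [C]; the
    velocity then involves two integrals over subintervals of [0, 1]. *)
Lemma velocity_diff w w' c C x : continuous w -> continuous w' -> 0 < c ->
  (forall x, x < c -> w x = 0) -> (forall x, x < c -> w' x = 0) ->
  (forall y, `|w y - w' y| <= C * y \/ y < c) -> 0 <= C -> 0 < x < 1 ->
  `|velocity b1 b2 w x - velocity b1 b2 w' x| <= 2 * C.
Proof.
move=> cw cw' c0 wc wc' H C0 /andP[x0 x1].
have bd y : `|w y / y - w' y / y| <= C.
  have [h|yc] := H y; last by rewrite wc// wc'// mul0r subrr normr0.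
  have [yc|yc] := ltP y c; first by rewrite wc// wc'// mul0r subrr normr0.
  have y0 : 0 < y by exact: lt_le_trans yc.
  by rewrite -mulrBl normrM normfV (gtr0_norm y0) ler_pdivrMr.
have pd p1 p2 : 0 <= p1 <= 1 -> 0 <= p2 <= 1 ->
    `|prim (fun y => w y / y) p1 p2 - prim (fun y => w' y / y) p1 p2| <= C.
  move=> /andP[? ?] /andP[? ?].
  apply: le_trans (prim_diff_le (C := C) (div_cont cw c0 wc) (div_cont cw' c0 wc') (fun y _ => bd y)) _.
  by rewrite -[leRHS]mulr1 ler_wpM2l// ler_norml; apply/andP; split; lra.
have m01 (u : R) : 0 <= u -> 0 <= Num.min u 1 <= 1.
  by move=> u0; rewrite le_min u0 ler01 ge_min lexx orbT.
have p1 := m01 (b2 * x) (mulr_ge0 (ltW b2_gt0) (ltW x0)).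
have p2 := m01 (b1 * x) (mulr_ge0 (le_trans (ltW b2_gt0) b21) (ltW x0)).
have alg u1 u2 u3 u4 : `|u1 - u3| <= C -> `|u2 - u4| <= C ->
    `|x * u1 - x * u2 - (x * u3 - x * u4)| <= 2 * C.
  move=> h1 h2.
  have -> : x * u1 - x * u2 - (x * u3 - x * u4) = x * ((u1 - u3) - (u2 - u4)) by ring.
  rewrite normrM (gtr0_norm x0) -[leRHS]mul1r ler_pM ?(ltW x0) ?(ltW x1)//.
  by apply: le_trans (ler_normB _ _) _; lra.
rewrite !velocity_prim ?(ltW x0)//; apply: alg; first exact: pd.
by apply: pd => //; rewrite ler01 lexx.
Qed.

(* At a positive maximum of e^(-Kt) f the spatial derivative vanishes and the time derivative is
   at least K f; this replaces a Gronwall estimate along characteristics. *)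
Lemma touch (f : R -> R -> R) K t0 x0 T' fx ft :
  0 < t0 <= T' -> 0 < x0 < 1 ->
  (forall t x, 0 <= t <= T' -> 0 <= x <= 1 ->
    f t x * expR (- K * t) <= f t0 x0 * expR (- K * t0)) ->
  der (f t0) x0 fx -> der (f^~ x0) t0 ft ->
  fx = 0 /\ K * f t0 x0 <= ft.
Proof.
move=> /andP[t00 t0T] /andP[x00 x01] H dx dt; split.
  apply: (der_max (d := Num.min x0 (1 - x0)) dx) => [|y].
    by rewrite lt_min x00 subr_gt0.
  rewrite lt_min !ltr_norml => /andP[/andP[h1 h2] /andP[h3 h4]].
  rewrite -(ler_pM2r (expR_gt0 (- K * t0))); apply: H.
    by rewrite ltW.
  by apply/andP; split; lra.
have dE : der (fun t => f t x0 * expR (- K * t)) t0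
    (ft * expR (- K * t0) + f t0 x0 * (- K * 1 * expR (- K * t0))).
  by apply: der_mul => //; apply: der_exp; apply: der_cmul; exact: der_id.
rewrite leNgt; apply/negP => lt.
have neg : ft * expR (- K * t0) + f t0 x0 * (- K * 1 * expR (- K * t0)) < 0.
  have e0 := expR_gt0 (- K * t0).
  have -> : ft * expR (- K * t0) + f t0 x0 * (- K * 1 * expR (- K * t0)) =
    - ((K * f t0 x0 - ft) * expR (- K * t0)).
    by move: (expR _) (f t0 x0) => u v; ring.
  by rewrite oppr_lt0 mulr_gt0// subr_gt0.
have [h /andP[h0 ht]] := der_left dE neg t00.
rewrite ltNge H//; last by rewrite !ltW.
by apply/andP; split; lra.
Qed.

Section Two.
Variables (n : nat) (T : R) (w0 r0 : R -> R) (w1 r1 w2 r2 : R -> R -> R).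
Hypothesis n1 : (1 <= n)%N.
Hypothesis S1 : regular_solution b1 b2 n T w0 r0 w1 r1.
Hypothesis S2 : regular_solution b1 b2 n T w0 r0 w2 r2.

Lemma common_bound T' F : 0 <= T' < T -> continuous_in_K n T F ->
  exists M, forall t, 0 <= t <= T' ->
    (forall x, 0 < x < 1 -> `|derive1 (F t) x| <= M) /\ (forall x, F t x != 0 -> 1 <= x * M).
Proof.
move=> /andP[T0 TT] [KF _ H]; have [M HM] := H T' ltac:(by rewrite T0).
exists M => t /andP[t0 tT].
by apply: (Ksize_bound n1 (KF t _)); [rewrite t0 (le_lt_trans tT)|apply: HM; rewrite t0].
Qed.

(** [touch] is applied to the larger of the two differences at a maximum point of [m]. A positive
    maximum lies at 0 < x < 1, outside of which all profiles vanish, and at a positive time, since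
    the initial data agree. *)
Lemma unique t x : 0 <= t < T -> w2 t x = w1 t x /\ r2 t x = r1 t x.
Proof.
move=> tT; have [[cw1 cr1] P1 iw1 ir1] := S1; have [[cw2 cr2] P2 iw2 ir2] := S2.
have [Kw1 _ _] := cw1; have [Kw2 _ _] := cw2; have [Kr1 _ _] := cr1; have [Kr2 _ _] := cr2.
have [M1 HM1] := common_bound tT cw1; have [M2 HM2] := common_bound tT cw2.
have [M3 HM3] := common_bound tT cr1; have [M4 HM4] := common_bound tT cr2.
pose M := 1 + `|M1| + `|M2| + `|M3| + `|M4|.
have := ler_norm M1; have := ler_norm M2; have := ler_norm M3; have := ler_norm M4.
have := normr_ge0 M1; have := normr_ge0 M2; have := normr_ge0 M3; have := normr_ge0 M4.
move=> n4 n3 n2 n1' l4 l3 l2 l1.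
have MM1 : M1 <= M by rewrite /M; lra.
have MM2 : M2 <= M by rewrite /M; lra.
have MM3 : M3 <= M by rewrite /M; lra.
have MM4 : M4 <= M by rewrite /M; lra.
have M_ge1 : 1 <= M by rewrite /M; lra.
have M0 : 0 < M by lra.
clearbody M.
clear n4 n3 n2 n1' l4 l3 l2 l1.
have /andP[t_ge0 tltT] := tT.
have sT s : 0 <= s <= t -> 0 <= s < T by move=> /andP[-> /le_lt_trans]; apply.
have van F Mi (Hi : forall s, 0 <= s <= t ->
    (forall x, 0 < x < 1 -> `|derive1 (F s) x| <= Mi) /\ (forall x, F s x != 0 -> 1 <= x * Mi)) :
    Mi <= M -> (forall s, 0 <= s < T -> inK n (F s)) ->
    forall s y, 0 <= s <= t -> y < M^-1 -> F s y = 0.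
  move=> iM KF s y st yM; apply/eqP/negPn/negP => Fy.
  have [y0|yn] := boolP (0 < y < 1); last by move: Fy; rewrite (inK_out (KF s (sT s st)) yn) eqxx.
  have := (Hi s st).2 y Fy; have /andP[y00 _] := y0.
  have h : y * Mi <= y * M by rewrite ler_wpM2l// ltW.
  have : y * M < 1 by rewrite -ltr_pdivlMr// mul1r.
  lra.
have vw1 := van _ _ HM1 MM1 Kw1; have vw2 := van _ _ HM2 MM2 Kw2.
have vr1 := van _ _ HM3 MM3 Kr1; have vr2 := van _ _ HM4 MM4 Kr2.
(* At a maximum [D] the velocity difference [2 D M] meets a slope of at most [M], and the source
   differs by at most [D M]; the final 1 makes the inequality strict. *)
pose K := 2 * M * M + M + 1.
pose m (p : R * R) := Num.max `|w2 p.1 p.2 - w1 p.1 p.2| `|r2 p.1 p.2 - r1 p.1 p.2| * expR (- K * p.1).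
have cK : compact (`[0, t]%classic `*` `[0, 1]%classic : set (R * R)).
  by apply: compact_setX; exact: segment_compact.
have [||[t0 x0]] := @compact_EVT_max _ _ m _ _ cK.
- by exists (0, 0); split => /=; rewrite in_itv/= lexx ?t_ge0 ?ler01.
- have cF F : continuous_in_K n T F ->
    {within `[0, t]%classic `*` `[0, 1]%classic, continuous (fun p : R * R => F p.1 p.2)}.
    by move=> cF; exact: (within_cont cF n1 tltT).
  have -> : m = (fun p => (`|w2 p.1 p.2 - w1 p.1 p.2| + `|r2 p.1 p.2 - r1 p.1 p.2| +
      `| `|w2 p.1 p.2 - w1 p.1 p.2| - `|r2 p.1 p.2 - r1 p.1 p.2| |) / 2 * expR (- K * p.1)).
    by apply/funext => p; rewrite /m maxr_absE.
  move=> p; apply: cvgM; last first.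
    apply: (continuous_subspaceT (f := fun p : R * R => expR (- K * p.1))) => {}p.
    apply: continuous_comp; last exact: continuous_expR.
    by apply: cvgM; [exact: cvg_cst|exact: cvg_fst].
  have cu : `|w2 x.1 x.2 - w1 x.1 x.2| @[x --> (p : subspace (`[0, t]%classic `*` `[0, 1]%classic))] -->
      `|w2 p.1 p.2 - w1 p.1 p.2|.
    by apply: cvg_norm; apply: cvgB; [exact: (cF _ cw2)|exact: (cF _ cw1)].
  have cv : `|r2 x.1 x.2 - r1 x.1 x.2| @[x --> (p : subspace (`[0, t]%classic `*` `[0, 1]%classic))] -->
      `|r2 p.1 p.2 - r1 p.1 p.2|.
    by apply: cvg_norm; apply: cvgB; [exact: (cF _ cr2)|exact: (cF _ cr1)].
  apply: cvgM; last exact: cvg_cst.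
  by apply: cvgD; [exact: cvgD|apply: cvg_norm; exact: cvgB].
rewrite inE => -[/=]; rewrite !in_itv/= => tt0 xx0 Hmax.
have {}Hmax s y : 0 <= s <= t -> 0 <= y <= 1 -> m (s, y) <= m (t0, x0).
  by move=> st y1; apply: Hmax; rewrite inE; split; rewrite /= in_itv.
have outK F G s y : inK n (F s) -> inK n (G s) -> ~~ (0 < y < 1) -> F s y = G s y :> R.
  by move=> KF KG h; rewrite (inK_out KF h) (inK_out KG h).
suff m0 : m (t0, x0) <= 0.
  have [x01|xn] := boolP (0 < x < 1); last first.
    by split; apply: outK; auto.
  have /andP[x_0 x_1] := x01.
  have := le_trans (Hmax t x ltac:(by rewrite t_ge0 lexx) ltac:(by rewrite !ltW)) m0.
  rewrite /m/= pmulr_lle0 ?expR_gt0// ge_max !normr_le0 !subr_eq0.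
  by move=> /andP[/eqP ? /eqP ?].
rewrite leNgt; apply/negP => mp.
pose D := Num.max `|w2 t0 x0 - w1 t0 x0| `|r2 t0 x0 - r1 t0 x0|.
have D0 : 0 < D by move: mp; rewrite /m/= pmulr_lgt0// expR_gt0.
have /andP[t0_ge0 t0t] := tt0; have t0T := sT _ tt0.
have x001 : 0 < x0 < 1.
  apply/negPn/negP => h; move: D0; rewrite /D (outK w2 w1) ?(outK r2 r1) ?subrr ?normr0 ?maxxx ?ltxx//; auto.
have t0_gt0 : 0 < t0.
  rewrite lt_neqAle t0_ge0 andbT; apply/eqP => t00; move: D0.
  by rewrite /D -t00 iw1 iw2 ir1 ir2 !subrr normr0 maxxx ltxx.
have t0i : 0 < t0 < T by case/andP: t0T => _ ->; rewrite t0_gt0.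
have bD y : `|w2 t0 y - w1 t0 y| <= D /\ `|r2 t0 y - r1 t0 y| <= D.
  have [/andP[y0 y1]|yn] := boolP (0 < y < 1); last first.
    rewrite (outK w2 w1) ?(outK r2 r1) ?subrr ?normr0 ?(ltW D0)//; auto.
  have := Hmax t0 y tt0 ltac:(by rewrite !ltW).
  by rewrite /m/= ler_pM2r ?expR_gt0// ge_max => /andP[].
have [d1 d2 e1 e2] := P1 x0 t0 x001 t0i; have [d3 d4 e3 e4] := P2 x0 t0 x001 t0i.
have dw1 := inK_der x0 n1 (Kw1 _ t0T); have dw2 := inK_der x0 n1 (Kw2 _ t0T).
have dr1 := inK_der x0 n1 (Kr1 _ t0T); have dr2 := inK_der x0 n1 (Kr2 _ t0T).
have bw := le_trans ((HM1 t0 tt0).1 x0 x001) MM1.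
have br := le_trans ((HM3 t0 tt0).1 x0 x001) MM3.
pose u1 := velocity b1 b2 (w1 t0) x0; pose u2 := velocity b1 b2 (w2 t0) x0.
have Mi0 : 0 < M^-1 by rewrite invr_gt0.
have uu : `|u2 - u1| <= 2 * (D * M).
  have cw (F : R -> R -> R) : (forall s, 0 <= s < T -> inK n (F s)) -> continuous (F t0).
    by move=> Kw; exact: (continuous_der (fun y => inK_der y n1 (Kw _ t0T))).
  apply: (velocity_diff (cw w2 Kw2) (cw w1 Kw1) Mi0) => //.
  - by move=> y; exact: vw2.
  - by move=> y; exact: vw1.
  - move=> y; have [|yM] := ltP y M^-1; first by right.
    left; apply: le_trans (bD y).1 _.
    rewrite -mulrA ler_peMr ?(ltW D0)//.
    by move: yM; rewrite -[M^-1]mul1r ler_pdivrMr// mulrC.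
  - by rewrite mulr_ge0// ltW.
have rx : `|(r2 t0 x0 - r1 t0 x0) / x0| <= D * M.
  have /andP[x00 _] := x001.
  have [xM|xM] := ltP x0 M^-1.
    by rewrite vr1// vr2// subrr mul0r normr0 mulr_ge0// ltW.
  rewrite normrM ler_pM// ?(bD x0).2// normfV (gtr0_norm x00).
  by rewrite -[leRHS]invrK lef_pV2 ?posrE.
(* Common argument for omega and rho, [sg] being the sign that turns the difference into [D]. At the
   maximum the two slopes coincide, so the transport terms differ by [(u2 - u1)] times a single
   slope. *)
have core (sg : R) (Fa Fb : R -> R -> R) fa fb :
    `|sg| = 1 -> sg * (Fa t0 x0 - Fb t0 x0) = D ->
    (forall s y, `|Fa s y - Fb s y| <= Num.max `|w2 s y - w1 s y| `|r2 s y - r1 s y|) ->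
    der (Fa t0) x0 (derive1 (Fa t0) x0) -> der (Fb t0) x0 (derive1 (Fb t0) x0) ->
    der (Fa^~ x0) t0 (- u2 * derive1 (Fa t0) x0 + fa) ->
    der (Fb^~ x0) t0 (- u1 * derive1 (Fb t0) x0 + fb) ->
    `|derive1 (Fb t0) x0| <= M -> `|fa - fb| <= D * M -> False.
  move=> sg1 sD Hm dFa dFb dta dtb bFb fab.
  have dx := der_cmul sg (der_sub dFa dFb); have dt := der_cmul sg (der_sub dta dtb).
  have := @touch (fun s y => sg * (Fa s y - Fb s y)) K t0 x0 t _ _ ltac:(by rewrite t0_gt0) x001 _ dx dt.
  have H s y : 0 <= s <= t -> 0 <= y <= 1 ->
      sg * (Fa s y - Fb s y) * expR (- K * s) <= sg * (Fa t0 x0 - Fb t0 x0) * expR (- K * t0).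
    move=> st y1; rewrite sD; apply: le_trans (Hmax s y st y1).
    rewrite ler_pM2r ?expR_gt0//; apply: le_trans (ler_norm _) _.
    by rewrite normrM sg1 mul1r.
  move=> /(_ H) [xz]; rewrite sD.
  have {dx dt}xz : sg * derive1 (Fa t0) x0 = sg * derive1 (Fb t0) x0 by apply/eqP; rewrite -subr_eq0 -mulrBr xz.
  clearbody u1 u2.
  have -> : sg * (- u2 * derive1 (Fa t0) x0 + fa - (- u1 * derive1 (Fb t0) x0 + fb)) =
    sg * (fa - fb) - sg * ((u2 - u1) * derive1 (Fb t0) x0).
    rewrite mulrBr mulrDr mulrCA xz.
    by move: (derive1 (Fb t0) x0) => B; ring.
  have h1 : sg * (fa - fb) <= D * M.
    by apply: le_trans (ler_norm _) _; rewrite normrM sg1 mul1r.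
  have h2 : - (sg * ((u2 - u1) * derive1 (Fb t0) x0)) <= 2 * (D * M) * M.
    apply: le_trans (ler_norm _) _; rewrite normrN !normrM sg1 mul1r.
    by apply: ler_pM.
  by rewrite /K; move: h1 h2 D0; move: (sg * _) (sg * _) => v1 v2; clearbody D; lra.
have dtw1 : der (w1^~ x0) t0 (- u1 * derive1 (w1 t0) x0 + r1 t0 x0 / x0).
  by apply: der_eq (derivable_der d1); rewrite -e1 -/u1; ring.
have dtw2 : der (w2^~ x0) t0 (- u2 * derive1 (w2 t0) x0 + r2 t0 x0 / x0).
  by apply: der_eq (derivable_der d3); rewrite -e3 -/u2; ring.
have dtr1 : der (r1^~ x0) t0 (- u1 * derive1 (r1 t0) x0 + 0).
  by apply: der_eq (derivable_der d2); rewrite -e2 -/u1; ring.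
have dtr2 : der (r2^~ x0) t0 (- u2 * derive1 (r2 t0) x0 + 0).
  by apply: der_eq (derivable_der d4); rewrite -e4 -/u2; ring.
have sgx v : exists2 sg : R, `|sg| = 1 & sg * v = `|v|.
  have [v0|v0] := leP 0 v; first by exists 1; rewrite ?normr1// mul1r ger0_norm.
  by exists (- 1); rewrite ?normrN ?normr1// mulN1r ltr0_norm.
have [wr|rw] := leP `|r2 t0 x0 - r1 t0 x0| `|w2 t0 x0 - w1 t0 x0|.
  have [sg s1 sE] := sgx (w2 t0 x0 - w1 t0 x0).
  apply: (core sg w2 w1 _ _ s1 _ _ dw2 dw1 dtw2 dtw1 bw).
  - by rewrite sE /D (max_idPl wr).
  - by move=> s y; rewrite le_max lexx.
  - by rewrite -mulrBl.
have [sg s1 sE] := sgx (r2 t0 x0 - r1 t0 x0).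
apply: (core sg r2 r1 _ _ s1 _ _ dr2 dr1 dtr2 dtr1 br).
- by rewrite sE /D (max_idPr (ltW rw)).
- by move=> s y; rewrite le_max lexx orbT.
- by rewrite subrr normr0 mulr_ge0// ltW.
Qed.

End Two.
End Uniqueness.

(** * Back to the original variables *)

Section LogCoordinates.
Context {R : realType}.
Implicit Types (f g : R -> R -> R) (x y z t s d : R) (n k : nat).

(* The profile z |-> f s z in the logarithmic variable z = - ln x, read in the variable x. *)
Definition lg f s x : R := if 0 < x then f s (- ln x) else 0.

Lemma lgE f s x : 0 < x -> lg f s x = f s (- ln x). Proof. by rewrite /lg => ->. Qed.

Variables (lo hi : R -> R).
Hypothesis clo : continuous lo.
Hypothesis chi : continuous hi.

(** The interval is closed so that the region where [f s] is required to vanish is open: the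
    z-derivative then vanishes there too. *)
Definition supported f := forall s z, ~~ (lo s <= z <= hi s) -> f s z = 0.
Definition tame f := (forall k, Reg k f) /\ supported f.

Lemma lg_zero f s x : supported f -> x < expR (- hi s) -> lg f s x = 0.
Proof.
move=> sf xs; rewrite /lg; case: ifPn => // x0; apply: sf.
rewrite negb_and -!ltNge; apply/orP; right.
by rewrite ltrNr -ltr_expR lnK ?posrE.
Qed.

Lemma lg_zero1 f s x : supported f -> expR (- lo s) < x -> lg f s x = 0.
Proof.
move=> sf xs; have x0 : 0 < x by apply: lt_trans xs; exact: expR_gt0.
rewrite lgE//; apply: sf; rewrite negb_and -!ltNge; apply/orP; left.
by rewrite ltrNl -ltr_expR lnK ?posrE.
Qed.

Lemma der_lnN x : 0 < x -> der (fun y => - ln y) x (- x^-1).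
Proof. by move=> x0; apply: der_opp; exact: is_derive1_ln. Qed.

(** Since [dz/dx = - 1/x = - e^z], the x-derivative of a profile is again a profile, that of
    [- e^z f_z]; so the class is closed under differentiation. Near x <= 0 the profile is
    identically zero. *)
Lemma tame_der f : tame f -> exists2 g, tame g & forall s x, der (lg f s) x (lg g s x).
Proof.
move=> [rf sf]; have [_ [fz dfz _]] := rf 1%N.
have rfz k : Reg k fz.
  have [_ [fz' dfz' r]] := rf k.+1.
  by apply: Reg_ext r => t z; exact: der_unique (dfz' t z) (dfz t z).
have sfz : supported fz.
  move=> s z out; apply: der_unique (dfz s z) _.
  apply: (der_near (f := fun=> 0)); last exact: der_cst.
  move: out; rewrite negb_and -!ltNge => /orP[zl|zh]; near=> y.
    rewrite sf// negb_and -!ltNge; apply/orP; left; near: y; exact: lt_nbhsl.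
  rewrite sf// negb_and -!ltNge; apply/orP; right; near: y; exact: lt_nbhsr.
exists (fun s z => - expR z * fz s z).
  split=> [k|s z /sfz ->]; last by rewrite mulr0.
  by apply: Reg_mul => //; apply: Reg_opp; apply: Reg_exp; exact: Reg_id.
move=> s x; have [x0|x0] := ltP 0 x.
  apply: (der_near (f := fun y => f s (- ln y))).
    near=> y; rewrite lgE//; near: y; exact: lt_nbhsr.
  apply: der_eq (@der_comp _ (f s) (fun y => - ln y) x _ _ (dfz s (- ln x)) (der_lnN x0)).
  by rewrite lgE// expRN lnK ?posrE.
rewrite {2}/lg ltNge x0/=; apply: (der_near (f := fun=> 0)); last exact: der_cst.
near=> y; rewrite lg_zero//; near: y; apply: lt_nbhsl.
by apply: le_lt_trans x0 _; exact: expR_gt0.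
Unshelve. all: by end_near. Qed.

Lemma tame_chain f : tame f -> exists fs : nat -> R -> R -> R,
  [/\ fs 0%N = f, forall k, tame (fs k) &
      forall k s x, der (lg (fs k) s) x (lg (fs k.+1) s x)].
Proof.
move=> tf; have [D HD] : {D : (R -> R -> R) -> (R -> R -> R) & forall f, tame f ->
    tame (D f) /\ forall s x, der (lg f s) x (lg (D f) s x)}.
  apply: (@choice _ _ (fun f g => tame f -> tame g /\ forall s x, der (lg f s) x (lg g s x))) => g.
  by have [/tame_der[g' tg dg]|ng] := pselect (tame g); [exists g'|exists g].
exists (fun k => iter k D f).
have H k : tame (iter k D f) by elim: k => [|k IH] //=; exact: (HD _ IH).1.
by split => // k s x; exact: (HD _ (H k)).2.
Qed.

Lemma derive1n_chain (F : nat -> R -> R) : (forall k x, der (F k) x (F k.+1 x)) ->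
  forall k, derive1n k (F 0%N) = F k.
Proof.
move=> H; elim=> [|k IH] //; rewrite derive1nS IH.
by apply/funext => x; exact: der_derive1.
Qed.

Lemma supp_lg f s : supported f ->
  supp (lg f s) `<=` `[expR (- hi s), expR (- lo s)]%classic.
Proof.
move=> sf; have cl : closed `[expR (- hi s), expR (- lo s)]%classic by exact: interval_closed.
rewrite ((closure_id _).1 cl); apply: closureS => x /= fx; rewrite in_itv/=.
by apply/andP; split; rewrite leNgt; apply/negP => h; move: fx;
  rewrite ?(lg_zero sf h) ?(lg_zero1 sf h) eqxx.
Qed.

Lemma tame_inK f s n : tame f -> 0 < lo s -> inK n (lg f s).
Proof.
move=> tf lo0; have [fs [f0 _ df]] := tame_chain tf.
have E k : derive1n k (lg f s) = lg (fs k) s.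
  rewrite -f0; exact: (derive1n_chain (F := fun k => lg (fs k) s)) (fun k x => df k s x) k.
split.
- split=> [k kn x|]; rewrite E; first by have [] := df k s x.
  exact: (continuous_der (fun x => df n s x)).
- apply: (subclosed_compact _ (@segment_compact _ (expR (- hi s)) (expR (- lo s)))).
    exact: closed_closure.
  exact: supp_lg tf.2.
- move=> x /(supp_lg tf.2) /=; rewrite !in_itv/= => /andP[x1 x2].
  rewrite (lt_le_trans (expR_gt0 _) x1)/= (le_lt_trans x2)//.
  by rewrite -expR0 ltr_expR oppr_lt0.
Qed.

Lemma Cnorm_le n (F : R -> R) C :
  (forall k x, (k <= n)%N -> 0 < x < 1 -> `|derive1n k F x| <= C) ->
  (Cnorm n F <= (C *+ n.+1)%:E)%E.
Proof.
move=> H; rewrite /Cnorm.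
have -> : (C *+ n.+1)%:E = (\sum_(k < n.+1) C%:E)%E.
  by rewrite sumEFin sumr_const card_ord.
apply: lee_sum => k _; apply: ge_ereal_sup => _ [x /= + <-].
by rewrite in_itv/= lee_fin; apply: H; rewrite -ltnS.
Qed.

Lemma cont_bound (h : R -> R) S : continuous h -> exists C : R, forall s, `|s| <= S -> `|h s| <= C.
Proof.
move=> ch; have [C C0 H] := jc_bound S (jc_t ch).
have [S0|S0] := leP 0 S; last by exists 0 => s sS; have := normr_ge0 s; lra.
by exists C => s sS; apply: (H s 0) => //; rewrite normr0.
Qed.

Lemma between_norm (z l h Cl Ch : R) : `|l| <= Cl -> `|h| <= Ch -> l <= z <= h ->
  Cl < `|z| -> Ch < `|z| -> False.
Proof.
rewrite !ler_norml => /andP[? ?] /andP[? ?] /andP[? ?].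
by case: (ger0P z) => *; lra.
Qed.

Lemma lg_time_cont f n s0 (e : R) : tame f -> 0 < e -> exists2 d : R, 0 < d &
  forall s, `|s - s0| < d -> (Cnorm n (lg f s \- lg f s0)%R < e%:E)%E.
Proof.
move=> tf e0; have [fs [f0 tfs df]] := tame_chain tf.
have [Ch Hh] := cont_bound (`|s0| + 1) chi; have [Cl Hl] := cont_bound (`|s0| + 1) clo.
(* For [s] within 1 of [s0] all supports lie in [[-N, N]]: inside, uniform continuity applies;
   outside, both profiles vanish. Dividing by [n.+1] in [e'] accounts for the [n.+1] suprema in
   [Cnorm]. *)
pose N := Num.max (`|s0| + 1) (Num.max Ch Cl).
pose e' := e / 2 / n.+1%:R; have e'0 : 0 < e' by rewrite !divr_gt0.
have key k : exists2 d : R, 0 < d & forall s, `|s - s0| < d -> forall x, `|lg (fs k) s x - lg (fs k) s0 x| <= e'.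
  have [d d0 Hd] := jc_unif N (Reg_jc ((tfs k).1 0%N)) e'0.
  exists (Num.min 1 d) => [|s]; first by rewrite lt_min ltr01.
  rewrite lt_min => /andP[s1 sd] x; rewrite /lg; case: ifPn => [x0|_]; last first.
    by rewrite subrr normr0 ltW.
  have [zN|zN] := leP `|- ln x| N.
    apply/ltW/Hd => //; first by rewrite le_max lerDl ler01.
    by rewrite subrr normr0.
  have out u : `|u| <= `|s0| + 1 -> fs k u (- ln x) = 0.
    move=> u1; apply: (tfs k).2; apply/negP => zlh.
    move: zN; rewrite !gt_max => /andP[_ /andP[z1 z2]].
    exact: between_norm (Hl u u1) (Hh u u1) zlh z2 z1.
  rewrite !out ?subrr ?normr0 ?(ltW e'0)// ?lerDl//.
  by have := ler_normD (s - s0) s0; rewrite subrK; lra.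
have [d d0 Hd] : exists2 d : R, 0 < d & forall k, (k <= n)%N -> forall s, `|s - s0| < d ->
    forall x, `|lg (fs k) s x - lg (fs k) s0 x| <= e'.
  clearbody e'; elim: n => [|m [d d0 Hd]].
    by have [d d0 Hd] := key 0%N; exists d => // k; rewrite leqn0 => /eqP ->.
  have [d' d'0 Hd'] := key m.+1; exists (Num.min d d') => [|k + s]; first by rewrite lt_min d0.
  rewrite leq_eqVlt lt_min => /predU1P[->|km] /andP[h1 h2]; first exact: Hd'.
  exact: Hd.
exists d => // s sd.
have E k : derive1n k (lg f s \- lg f s0) = lg (fs k) s \- lg (fs k) s0.
  rewrite -f0; apply: (derive1n_chain (F := fun k => lg (fs k) s \- lg (fs k) s0)) => j x.
  exact: der_sub (df j s x) (df j s0 x).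
apply: (@le_lt_trans _ _ (e' *+ n.+1)%:E).
  by apply: Cnorm_le => k x kn _; rewrite E; exact: Hd.
by rewrite lte_fin -mulr_natr /e' divfK ?pnatr_eq0//; lra.
Qed.

Lemma lg_Ksize f n S : tame f -> (forall s, 0 <= s <= S -> 0 < lo s) ->
  exists M : R, forall s, 0 <= s <= S -> (Ksize n (lg f s) <= M%:E)%E.
Proof.
move=> tf lo0; have [fs [f0 tfs df]] := tame_chain tf.
have [Ch Hh] := cont_bound `|S| chi; have [Cl Hl] := cont_bound `|S| clo.
pose N := Num.max `|S| (Num.max Ch Cl).
have key k : exists C : R, forall s, 0 <= s <= S -> forall x, `|lg (fs k) s x| <= C.
  have [C C0 HC] := jc_bound N (Reg_jc ((tfs k).1 0%N)).
  exists C => s /andP[s0 sS] x; rewrite /lg; case: ifPn => [x0|_]; last by rewrite normr0.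
  have sS' : `|s| <= `|S| by rewrite !ger0_norm// (le_trans s0).
  have [zN|zN] := leP `|- ln x| N.
    by apply: HC => //; rewrite le_max sS'.
  rewrite (tfs k).2 ?normr0//; apply/negP => zlh.
  move: zN; rewrite !gt_max => /andP[_ /andP[z1 z2]].
  exact: between_norm (Hl s sS') (Hh s sS') zlh z2 z1.
have [C HC] : {C : nat -> R & forall k s, 0 <= s <= S -> forall x, `|lg (fs k) s x| <= C k}.
  exact: (@choice _ _ (fun k C => forall s, 0 <= s <= S -> forall x, `|lg (fs k) s x| <= C)) key.
pose C' : R := \sum_(k < n.+1) `|C k|.
exists (C' *+ n.+1 + expR Ch) => s sS.
have E k : derive1n k (lg f s) = lg (fs k) s.
  rewrite -f0; exact: (derive1n_chain (F := fun k => lg (fs k) s)) (fun k x => df k s x) k.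
have sS' : `|s| <= `|S| by case/andP: sS => s0 sS; rewrite !ger0_norm// (le_trans s0).
rewrite EFinD; apply: leeD.
  apply: Cnorm_le => k x kn _; rewrite E; apply: le_trans (HC k s sS x) _.
  have kn' : (k < n.+1)%N by [].
  rewrite /C' (bigD1 (Ordinal kn'))//=; apply: le_trans (ler_norm _) _.
  by rewrite lerDl sumr_ge0.
rewrite lee_fin; have [fx|ne] := pselect (exists x, lg f s x != 0).
  have [i0 _] := supp_min (tame_inK n tf (lo0 s sS)) fx.
  rewrite -[leRHS]invrK -expRN lef_pV2 ?posrE ?expR_gt0//.
  apply: lb_le_inf; first by case: fx => x fx; exists x; exact: subset_closure.
  move=> y /(supp_lg tf.2) /=; rewrite in_itv/= => /andP[h _]; apply: le_trans h.
  rewrite ler_expR lerN2; have := Hh s sS'; rewrite ler_norml => /andP[]//.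
suff -> : supp (lg f s) = set0 by rewrite inf0 invr0 expR_ge0.
rewrite /supp (_ : [set x | lg f s x != 0] = set0) ?closure0//.
by apply/seteqP; split => // x /= fx; apply: ne; exists x.
Qed.

End LogCoordinates.

(** * Lower bounds for essential suprema and for time integrals *)

Section Integrals.
Context {R : realType}.
Local Notation mu := (@lebesgue_measure R).
Implicit Types (x y t s d : R).

Lemma Linfty_ge0 (f : R -> R) : (0 <= Linfty f)%E.
Proof. exact: Lnorm_ge0. Qed.

(** Were [|f x|] above the essential supremum, by continuity so would be [|f|] on an interval around
    [x], which has positive measure. *)
Lemma Linfty_ge (f : R -> R) x : 0 < x < 1 -> {for x, continuous f} ->
  (`|f x|%:E <= Linfty f)%E.
Proof.
move=> /andP[x0 x1] cf; rewrite leNgt; apply/negP => H.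
have L0 := Linfty_ge0 f.
have /fineK E : Linfty f \is a fin_num.
  by rewrite ge0_fin_numE//; apply: lt_trans H _; rewrite ltry.
pose s := fine (Linfty f); rewrite -E lte_fin -/s in H.
have H' : 0 < `|f x| - s by rewrite subr_gt0.
have cn : `|f y| @[y --> x] --> `|f x| by exact: cvg_norm cf.
have /cvgrPdist_lt /(_ _ H') /nbhs_ballP[d /= d0 Hd] := cn.
pose e := Num.min d (Num.min x (1 - x)).
have e0 : 0 < e by rewrite !lt_min d0 x0 subr_gt0.
have ed : e <= d by rewrite ge_min lexx.
have ex : e <= x by rewrite !ge_min lexx orbT.
have e1 : e <= 1 - x by rewrite !ge_min lexx !orbT.
have := ess_sup_ge (mrestr mu (measurable_itv (`]0%R, 1%R[ : interval R))) (abse \o (EFin \o f)).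
have -> : ess_sup (mrestr mu (measurable_itv (`]0%R, 1%R[ : interval R))) (abse \o (EFin \o f)) = s%:E.
  have h : (0 < mu (setT `&` `]0%R, 1%R[%classic))%E.
    by rewrite setTI lebesgue_measure_itv/= lte_fin ltr01 oppr0 adde0 lte_fin ltr01.
  by rewrite /s E /Linfty Lnorm.unlock; case: ifPn => // /negP[]; exact: h.
move=> [N [mN N0 sub]].
have sb : `]x - e, x + e[%classic `<=` N `&` `]0, 1[%classic.
  move=> y /=; rewrite in_itv/= => /andP[y1 y2]; split; last first.
    by rewrite in_itv/=; apply/andP; split; lra.
  apply: sub => /=; apply/negP; rewrite -ltNge lte_fin.
  have := Hd y; rewrite /ball/= ltr_norml => /(_ _) /=.
  rewrite !ltr_norml => /(_ ltac:(apply/andP; split; lra)) /andP[]; lra.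
pose B : set R := `]x - e, x + e[%classic; pose I : set R := `]0, 1[%classic.
have : (mu B <= mu (N `&` I))%E.
  apply: le_measure; rewrite ?inE; [exact: measurable_itv| |exact: sb].
  by apply: measurableI => //; exact: measurable_itv.
rewrite /B lebesgue_measure_itv/= lte_fin ltrD2l.
rewrite (_ : - e < e); last by lra.
rewrite (_ : mu (N `&` I) = 0%E)//.
by rewrite -EFinD lee_fin; lra.
Qed.

(** The integral of a nonnegative function is the supremum over the simple functions below it, hence
    monotone for arbitrary nonnegative functions. It is applied to norms depending on t, whose
    measurability is not established. *)
Lemma ge0_le_integral_nomeas (D : set R) (f1 f2 : R -> \bar R) :
  (forall x, D x -> (0 <= f1 x)%E) -> (forall x, D x -> (f1 x <= f2 x)%E) ->
  (\int[mu]_(x in D) f1 x <= \int[mu]_(x in D) f2 x)%E.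
Proof.
move=> f10 f12; have f20 x : D x -> (0 <= f2 x)%E.
  by move=> Dx; apply: le_trans (f12 x Dx); exact: f10.
rewrite !ge0_integralE//; apply: le_ereal_sup => _ [h /= hf <-].
exists h => // x; apply: le_trans (hf x) _; rewrite /patch; case: ifPn => //.
by rewrite inE; exact: f12.
Qed.

Lemma int_ge (f h : R -> R) (G : R -> \bar R) T t1 :
  continuous h -> 0 <= t1 < T ->
  (forall t, 0 <= t <= t1 -> der f t (h t)) ->
  (forall t, 0 < t < T -> (0 <= G t)%E) ->
  (forall t, 0 < t < t1 -> ((h t)%:E <= G t)%E) ->
  ((f t1 - f 0)%:E <= \int[mu]_(t in `]0%R, T[) G t)%E.
Proof.
move=> ch /andP[t10 t1T] dh G0 hG.
have <- : prim h 0 t1 = f t1 - f 0.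
  by apply: prim_on => // z; rewrite (min_idPl t10) (max_idPr t10); exact: dh.
have io (k : R -> R) (b1 b2 : bool) : continuous k ->
    mu.-integrable [set` Interval (BSide b1 0) (BSide b2 t1)] (EFin \o k).
  move=> ck; apply: integrableS (cont_integrable 0 t1 ck) => //.
  by apply: subset_itvScc; rewrite bnd_simp.
rewrite /prim t10 -Rintegral_itv_bndo_bndc; last exact: io.
rewrite -Rintegral_itv_obnd_cbnd; last exact: io.
rewrite /Rintegral fineK; last by apply: integrable_fin_num => //; exact: io.
(* [h] may be negative; its positive part, extended by zero from []0, t1[] to []0, T[], still lies
   below the nonnegative [G]. *)
apply: (@le_trans _ _ (\int[mu]_(t in `]0%R, t1[) (Num.max 0 (h t))%:E)%E).
  apply: le_integral => //.
  - exact: io.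
  - have cm : continuous (fun t => Num.max 0 (h t)).
      by move=> x; apply: continuous_max; [exact: cst_continuous|exact: ch].
    exact: io.
  - by move=> t _; rewrite lee_fin le_max lexx orbT.
have -> : `]0, t1[%classic = `]0, T[%classic `&` `]0, t1[%classic :> set R.
  apply/seteqP; split=> [t|t []] //=; rewrite !in_itv/= => /andP[a b]; split; apply/andP; split => //.
  exact: lt_trans t1T.
rewrite integral_mkcondr; apply: ge0_le_integral_nomeas.
- by move=> t _; rewrite /restrict; case: ifPn => // _; rewrite lee_fin le_max lexx.
- move=> t /=; rewrite in_itv/= => tT; rewrite /restrict; case: ifPn => [|_]; last exact: G0.
  rewrite inE/= in_itv/= => tt; have [h0|h0] := leP 0 (h t); first exact: hG.
  exact: G0.
Qed.

End Integrals.

(** * Return to the original time, and divergence of the three integrals *)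

Section Assembly.
Context {R : realType}.
Implicit Types (x y z t s d : R) (n k : nat).
Variables (b1 b2 : R) (om omx rh rhx W : R -> R -> R) (lo hi q th : R -> R).
Hypothesis b2_gt0 : 0 < b2.
Hypothesis b21 : b2 <= b1.
Hypothesis clo : continuous lo.
Hypothesis chi : continuous hi.
Hypothesis tom : tame lo hi om.
Hypothesis trh : tame lo hi rh.
Let V s z := 2 * W s (z - ln b1) - W s (z - ln b2).
Hypothesis dom : forall s z, der (om s) z (omx s z).
Hypothesis domt : forall s z, der (om^~ z) s (q s * (rh s z * expR z - V s z * omx s z)).
Hypothesis drh : forall s z, der (rh s) z (rhx s z).
Hypothesis drht : forall s z, der (rh^~ z) s (q s * (- V s z * rhx s z)).
Hypothesis dW : forall s z, der (W s) z (om s z).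
Hypothesis Wl : forall s z, z <= lo s -> W s z = 0.
Hypothesis lo0 : forall s, 0 <= s -> 0 < lo s.
Hypothesis q0 : forall s, 0 < q s.
Hypothesis dth : forall s, der th s (q s).
Hypothesis th0 : th 0 = 0.
Hypothesis th1 : forall s, 0 <= s -> th s <= 1.

(** The substitution z = - ln y turns the integrals of [omega / y] into increments of [W]. The
    truncation at y = 1 becomes one at z = 0, where it changes nothing because [W] vanishes up to
    [lo s > 0]. *)
Lemma velocityE s x : 0 <= s -> 0 < x ->
  velocity b1 b2 (lg om s) x = - (x * V s (- ln x)).
Proof.
move=> s0 x0; have b1_gt0 : 0 < b1 by exact: lt_le_trans b21.
have cg : continuous (fun y => lg om s y / y).
  apply: (@div_cont _ _ (expR (- hi s))); last 2 first.
  - exact: expR_gt0.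
  - by move=> y; exact: lg_zero tom.2.
  by have [g _ dg] := tame_der tom; exact: continuous_der (dg s).
have pE y y' : 0 < y -> 0 < y' ->
    prim (fun y => lg om s y / y) y y' = W s (- ln y) - W s (- ln y').
  move=> y0 y'0; rewrite (@prim_on _ _ (fun z => - W s (- ln z))) ?opprK 1?addrC// => z /andP[z1 _].
  have z0 : 0 < z by apply: lt_le_trans z1; rewrite lt_min y0.
  apply: der_eq (der_opp (@der_comp _ (W s) (fun y => - ln y) z _ _ (dW s (- ln z)) (der_lnN z0))).
  by rewrite mulNr opprK lgE// mulrC.
have WE c : 0 < c -> W s (- ln (Num.min (c * x) 1)) = W s (- ln x - ln c).
  move=> c0; have cx : 0 < c * x by rewrite mulr_gt0.
  have -> : - ln x - ln c = - ln (c * x) by rewrite lnM ?posrE// opprD addrC.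
  have [h|h] := leP (c * x) 1 => //.
  have l0 := ltW (lo0 s0); rewrite ln1 oppr0 (Wl l0) Wl//.
  by apply: le_trans l0; rewrite oppr_le0 ln_ge0// ltW.
have mp c : 0 < c -> 0 < Num.min (c * x) 1 by move=> c0; rewrite lt_min ltr01 mulr_gt0.
rewrite velocity_prim// ?(ltW x0)// !pE ?mp// !WE// ln1 oppr0.
rewrite (Wl (z := 0)); last exact: ltW (lo0 s0).
rewrite /V; move: (W _ _) (W _ _) => u v; ring.
Qed.

(* th is the original time as a function of s, and s ranges over all of [0, +oo). *)
Definition Tmax := sup [set th s | s in [set s | 0 <= s]].
Definition tau t := xget 0 [set s | th s = t].

Let th_lt s s' : s < s' -> th s < th s'.
Proof.
move=> ss; have [c _ E] := mvt (ltW ss) (fun x _ => dth x).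
by rewrite -subr_gt0 E mulr_gt0// subr_gt0.
Qed.

Lemma th_inj : injective th.
Proof.
move=> s s' E; apply/eqP; rewrite eq_le !leNgt; apply/andP; split; apply/negP => /th_lt;
  by rewrite E ltxx.
Qed.

Lemma tauK s : tau (th s) = s.
Proof.
by apply: th_inj; apply: (@xgetPex _ 0 [set s' | th s' = th s]); exists s.
Qed.

Lemma has_sup_th : has_sup [set th s | s in [set s | 0 <= s]].
Proof.
split; first by exists (th 0); exists 0 => /=.
by exists 1 => _ [s /= s0 <-]; exact: th1.
Qed.

Lemma th_Tmax s : 0 <= s -> th s < Tmax.
Proof.
move=> s0; apply: (@lt_le_trans _ _ (th (s + 1))); first by apply: th_lt; rewrite ltrDl.
apply: ub_le_sup; first exact: has_sup_th.2.
by exists (s + 1) => //=; rewrite addr_ge0.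
Qed.

Lemma Tmax_gt0 : 0 < Tmax.
Proof. by rewrite -th0; exact: th_Tmax. Qed.

Lemma th_cont : continuous th.
Proof. by move=> x; exact: der_cont (dth x). Qed.

Lemma tau_ex t : 0 <= t < Tmax -> 0 <= tau t /\ th (tau t) = t.
Proof.
move=> /andP[t0 tT].
have [_ [s1 /= s10 <-] ts] := sup_gt has_sup_th.1 tT.
have [||s] := @IVT R th 0 s1 t s10.
- exact: continuous_subspaceT th_cont.
- have h : 0 <= th s1 by exact: le_trans t0 (ltW ts).
  by rewrite th0 (min_idPl h) (max_idPr h) t0 ltW.
by rewrite in_itv/= => /andP[s0 _] <-; rewrite tauK.
Qed.

Lemma der_tau s : der tau (th s) (q s)^-1.
Proof.
apply: is_derive_inverse.
- by near=> x; exact: tauK.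
- by near=> x; exact: th_cont.
- exact: dth.
- by rewrite gt_eqF.
Unshelve. all: by end_near. Qed.

Lemma tau_mono t t' : 0 <= t <= t' -> t' < Tmax -> tau t <= tau t'.
Proof.
move=> /andP[t0 tt] tT; rewrite leNgt; apply/negP => /th_lt.
have [_ ->] := tau_ex (t := t) ltac:(by rewrite t0 (le_lt_trans tt)).
have [_ ->] := tau_ex (t := t') ltac:(by rewrite (le_trans t0)).
by rewrite ltNge tt.
Qed.

Lemma tau0 : tau 0 = 0. Proof. by rewrite -[in LHS]th0 tauK. Qed.

Lemma ecvg0 (F : set_system R) (f : R -> \bar R) : Filter F -> (forall t, 0 <= f t)%E ->
  (forall e : R, 0 < e -> \forall t \near F, (f t < e%:E)%E) -> f @ F --> 0%E.
Proof.
move=> FF f0 H; apply/fine_cvgP; split.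
  near=> t; rewrite ge0_fin_numE//; apply: (@lt_trans _ _ 1%:E); last by rewrite ltry.
  by near: t; exact: H.
apply/cvgrPdist_lt => e e0; near=> t.
rewrite sub0r normrN ger0_norm ?fine_ge0// -lte_fin fineK.
  by near: t; exact: H.
rewrite ge0_fin_numE//; apply: (@lt_trans _ _ 1%:E); last by rewrite ltry.
by near: t; exact: H.
Unshelve. all: by end_near. Qed.

Lemma lg_in_K n f : tame lo hi f -> continuous_in_K n Tmax (fun t => lg f (tau t)).
Proof.
move=> tf; split.
- by move=> t /tau_ex[t0 _]; apply: (tame_inK n tf); exact: lo0.
- move=> t0 /[dup] t0T /tau_ex[s0 sE]; apply: ecvg0 => [t|e e0]; first exact: Cnorm_ge0.
  have [d d0 Hd] := lg_time_cont clo chi n (tau t0) tf e0.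
  have := der_cont (der_tau (tau t0)); rewrite sE => /cvgrPdist_lt /(_ d d0) H.
  apply: cvg_within; near=> t; apply: Hd; rewrite distrC; near: t; exact: H.
- move=> T' /andP[T'0 T'T].
  have [M HM] := lg_Ksize clo chi n (S := tau T') tf (fun s h => lo0 (proj1 (andP h))).
  exists M => t /andP[t0 tT']; apply: HM; rewrite tau_mono ?t0// andbT.
  by have [] := tau_ex (t := t) ltac:(by rewrite t0 (le_lt_trans tT')).
Unshelve. all: by end_near. Qed.

Lemma der_lg f fx s x : 0 < x -> (forall z, der (f s) z (fx z)) ->
  derive1 (lg f s) x = - x^-1 * fx (- ln x).
Proof.
move=> x0 df; apply: der_derive1; apply: (der_near (f := fun y => f s (- ln y))).
  near=> y; rewrite lgE//; near: y; exact: lt_nbhsr.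
by apply: (@der_comp _ (f s) (fun y => - ln y)) => //; exact: der_lnN.
Unshelve. all: by end_near. Qed.

Lemma der_lg_tau f ft t x : 0 < x -> 0 <= t < Tmax ->
  (forall z s, der (f^~ z) s (q s * ft s z)) ->
  der ((fun t => lg f (tau t))^~ x) t (ft (tau t) (- ln x)).
Proof.
move=> x0 /tau_ex[s0 sE] df; rewrite -[in X in der _ X]sE.
have E : (fun t => lg f (tau t) x) = (fun t => f (tau t) (- ln x)).
  by apply/funext => u; rewrite lgE.
rewrite E.
have dz := df (- ln x) (tau t).
apply: der_eq (@der_comp _ (f^~ (- ln x)) tau (th (tau t)) _ _ _ (der_tau _)).
  2: by rewrite tauK; exact: dz.
by rewrite mulKf// gt_eqF.
Qed.

Lemma solution n : regular_solution b1 b2 n Tmax (lg om 0) (lg rh 0)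
  (fun t => lg om (tau t)) (fun t => lg rh (tau t)).
Proof.
split.
- by split; exact: lg_in_K.
- move=> x t /andP[x0 x1] /andP[t0 tT].
  have tT' : 0 <= t < Tmax by rewrite ltW.
  have d1 := der_lg_tau x0 tT' (fun z s => domt s z).
  have d2 := der_lg_tau x0 tT' (fun z s => drht s z).
  have [s0 sE] := tau_ex tT'.
  split.
  + by case: d1.
  + by case: d2.
  + rewrite (der_derive1 d1) velocityE// (der_lg x0 (dom (tau t))) lgE// expRN lnK ?posrE//.
    by move: (V _ _) (omx _ _) (rh _ _) => v o r; field; rewrite gt_eqF.
  + rewrite (der_derive1 d2) velocityE// (der_lg x0 (drh (tau t))).
    by move: (V _ _) (rhx _ _) => v o; field; rewrite gt_eqF.
- by rewrite tau0.
- by rewrite tau0.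
Qed.


Variables (P L A : R -> R -> R) (al be m0 : R).
Hypothesis ab : al <= be.
Hypothesis lnb1 : 0 <= ln b1.
Hypothesis loE : forall s, lo s = P s al.
Hypothesis hiE : forall s, hi s = P s be.
Hypothesis qE : forall s, q s = expR (- Num.max 0 (P s be)).
Hypothesis jP : jc P.
Hypothesis jW : jc W.
Hypothesis dPz : forall s z, der (P s) z (expR (L s z)).
Hypothesis dPt : forall s z, der (P^~ z) s (q s * V s (P s z)).
Hypothesis dL : forall s z,
  der (L^~ z) s (q s * (2 * om s (P s z - ln b1) - om s (P s z - ln b2))).
Hypothesis L0 : forall z, L 0 z = 0.
Hypothesis P0 : forall z, P 0 z = z.
Hypothesis dA : forall s z, der (A^~ z) s (q s * (rh s (P s z) * expR (P s z))).
Hypothesis A0 : forall z, A 0 z <= m0.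
Hypothesis omP : forall s z, om s (P s z) = A s z.
Hypothesis surj : forall s x, exists z, P s z = x.
Hypothesis om0 : forall s z, 0 <= s -> 0 <= om s z.
Hypothesis omhi : forall s, om s (hi s) = 0.
Hypothesis Pal : forall s, 0 <= s -> P s al <= al.

Lemma jc_om : jc om. Proof. exact: tom.1 0%N. Qed.

(* A bounded front would keep the clock speed q away from 0, so that th could not stay bounded. *)
Lemma front_unbounded B : (forall s, 0 <= s -> P s be <= B) -> False.
Proof.
move=> HB; pose c := expR (- Num.max 0 B); have c0 : 0 < c by exact: expR_gt0.
have s0 : 0 <= 2 / c by rewrite divr_ge0// ltW.
have : c * (2 / c - 0) <= th (2 / c) - th 0.
  apply: (mvt_ge s0 (fun x _ => dth x)) => x /andP[x0 _].
  rewrite qE ler_expR lerN2 ge_max le_max lexx/= le_max.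
  by rewrite HB// orbT.
rewrite subr0 mulrC divfK ?gt_eqF// th0 subr0.
by have := th1 s0; lra.
Qed.

(** Change of variables: since [tau] has derivative [1 / q], an increment of [F] in the time s is
    the integral of [k] at [tau t] over the original time. Lower bounds by such increments are used
    on all three blow-up integrals. *)
Lemma tau_int (F k : R -> R) (G : R -> \bar R) s1 : 0 <= s1 -> continuous k ->
  (forall s, 0 <= s -> der F s (q s * k s)) ->
  (forall t, 0 < t < Tmax -> (0 <= G t)%E) ->
  (forall t, 0 < t < Tmax -> ((k (tau t))%:E <= G t)%E) ->
  ((F s1 - F 0)%:E <= \int[@lebesgue_measure R]_(t in `]0%R, Tmax[) G t)%E.
Proof.
move=> s10 ck dF G0 kG; pose t1 := th s1.
have t10 : 0 <= t1.
  move: (s10); rewrite le_eqVlt => /predU1P[E|/th_lt h]; first by rewrite /t1 -E th0.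
  by rewrite /t1 -th0 ltW.
have t1T : t1 < Tmax by exact: th_Tmax.
(* Projection onto [0, t1]: [int_ge] wants an integrand continuous on the whole line, while [tau] is
   controlled only on [0, Tmax). *)
pose cl t := Num.max 0 (t1 + Num.min 0 (t - t1)).
have clE t : 0 <= t <= t1 -> cl t = t.
  move=> /andP[t0 tt]; rewrite /cl (min_idPr _) ?subr_le0//.
  by rewrite addrC subrK (max_idPr _).
have cl01 t : 0 <= cl t <= t1.
  rewrite /cl le_max lexx/= ge_max t10/= gerDl ge_min lexx//.
have ccl : continuous cl.
  apply: (@jc_cont1 _ (fun t _ => cl t) 0); apply: jc_max0.
  apply: jc_add; first exact: jc_cst.
  by apply: jc_min0; apply: jc_sub; [exact: jc_fst|exact: jc_cst].
have tT t : 0 <= t <= t1 -> 0 <= t < Tmax.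
  by move=> /andP[-> h]; exact: le_lt_trans t1T.
have := @int_ge R (F \o tau) (fun t => k (tau (cl t))) G Tmax t1.
have <- : F s1 - F 0 = (F \o tau) t1 - (F \o tau) 0 by rewrite /= tauK tau0.
apply => //.
- move=> t; apply: continuous_comp; last exact: ck.
  apply: continuous_comp; first exact: ccl.
  have [_ <-] := tau_ex (tT _ (cl01 t)); exact: der_cont (der_tau _).
- by rewrite t10.
- move=> t tt; rewrite clE//; have [s0 sE] := tau_ex (tT _ tt).
  rewrite -[in der _ t]sE.
  apply: der_eq (@der_comp _ F tau (th (tau t)) _ _ _ (der_tau _)).
    2: by rewrite tauK; exact: dF.
  by rewrite mulKf// gt_eqF.
- move=> t /andP[t0 tt]; rewrite clE; last by rewrite (ltW t0) ltW.
  apply: kG.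
  by rewrite t0 (lt_trans tt).
Qed.

Lemma lg_cont f s : tame lo hi f -> continuous (lg f s).
Proof. by move=> /tame_der[g _ dg]; exact: continuous_der (dg s). Qed.

Lemma expNI z : 0 < z -> 0 < expR (- z) < 1.
Proof. by move=> z0; rewrite expR_gt0/= -expR0 ltr_expR oppr_lt0. Qed.

Lemma tame_left f s z : tame lo hi f -> 0 <= s -> z <= 0 -> f s z = 0.
Proof.
move=> tf s0 z0; apply: tf.2; rewrite negb_and -!ltNge; apply/orP; left.
exact: le_lt_trans z0 (lo0 s0).
Qed.

Lemma om_Linfty s z : 0 <= s -> ((om s z)%:E <= Linfty (lg om s))%E.
Proof.
move=> s0; have [z0|z0] := leP z 0.
  by rewrite (tame_left tom s0 z0); exact: Linfty_ge0.
apply: (@le_trans _ _ `|lg om s (expR (- z))|%:E); last first.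
  by apply: Linfty_ge; [exact: expNI|exact: lg_cont].
by rewrite lgE ?expR_gt0// expRK opprK lee_fin ler_norm.
Qed.

(** The profile of rho vanishes at x = 0, so the mean value theorem on [[0, e^(-z)]] yields a point
    where its slope equals [rho / x]. *)
Lemma rh_Linfty s z : 0 <= s ->
  ((rh s z * expR z)%:E <= Linfty (derive1 (lg rh s)))%E.
Proof.
move=> s0; have [z0|z0] := leP z 0.
  by rewrite (tame_left trh s0 z0) mul0r; exact: Linfty_ge0.
have [g tg dg] := tame_der trh.
have -> : derive1 (lg rh s) = lg g s by apply/funext => x; exact: der_derive1 (dg s x).
have /andP[x0 x1] := expNI z0.
have [c /andP[c0 cx] E] := mvt (ltW x0) (fun y _ => dg s y).
have E' : rh s z * expR z = lg g s c.
  move: E; rewrite {1 2}/lg x0 ltxx !subr0 expRK opprK => ->.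
  by rewrite -mulrA -expRD addNr expR0 mulr1.
rewrite E'; have [c0'|c0'] := ltP 0 c; last first.
  by rewrite {1}/lg ltNge c0'/=; exact: Linfty_ge0.
have c01 : 0 < c < 1 by rewrite c0' (le_lt_trans cx).
apply: (@le_trans _ _ `|lg g s c|%:E); first by rewrite lee_fin ler_norm.
by apply: Linfty_ge => //; exact: lg_cont.
Qed.

Lemma W_right s z : hi s <= z -> W s z = W s (hi s).
Proof.
move=> hz; have := mvt_bound (C := 0) hz (fun x _ => dW s x).
rewrite mul0r normr_le0 subr_eq0 => H; apply/eqP; apply: H => x /andP[x1 _].
have [->|xh] := eqVneq x (hi s); last first.
  rewrite tom.2 ?normr0// negb_and -!ltNge; apply/orP; right.
  by rewrite lt_neqAle x1 eq_sym xh.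
by rewrite omhi normr0.
Qed.

Lemma jcV : jc V.
Proof.
have h (c : R) : jc (fun s z => W s (z - c)).
  by apply: (jc_comp jW jc_fst); apply: jc_sub; [exact: jc_snd|exact: jc_cst].
by apply: jc_sub; [apply: jc_mul; [exact: jc_cst|exact: h]|exact: h].
Qed.

Lemma derV s z : der (V s) z (2 * om s (z - ln b1) - om s (z - ln b2)).
Proof.
have h (c : R) : der (fun z => W s (z - c)) z (om s (z - c)).
  by apply: (@der_shift _ (W s) (- c)); exact: dW.
by apply: der_sub; [apply: der_cmul; exact: h|exact: h].
Qed.

Lemma derive1_velocity s x : 0 <= s -> 0 < x ->
  derive1 (velocity b1 b2 (lg om s)) x =
  - V s (- ln x) + (2 * om s (- ln x - ln b1) - om s (- ln x - ln b2)).
Proof.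
move=> s0 x0; apply: der_derive1.
apply: (der_near (f := fun y => - (y * V s (- ln y)))).
  near=> y; rewrite velocityE//; near: y; exact: lt_nbhsr.
have dV := @der_comp _ (V s) (fun y => - ln y) x _ _ (derV s (- ln x)) (der_lnN x0).
apply: der_eq (der_opp (der_mul (der_id x) dV)).
by move: (V s _) (_ - _ : R) => v o; field; rewrite gt_eqF.
Unshelve. all: by end_near. Qed.

(** Between x = 0 and the support the velocity is linear in x: both shifted values of [W] equal the
    total [W s (hi s)], and its slope is [- (2 - 1)] times that total. The point [z] is taken beyond
    [hi s] even after the shift by [ln b1]. *)
Lemma W_Linfty s : 0 <= s ->
  ((W s (hi s))%:E <= Linfty (derive1 (velocity b1 b2 (lg om s))))%E.
Proof.
move=> s0; pose z := hi s + ln b1 + 1.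
have b12 : ln b2 <= ln b1 by rewrite ler_ln ?posrE//; exact: lt_le_trans b21.
have loz : lo s <= hi s.
  rewrite loE hiE; have := mvt_ge (C := 0) ab (fun x _ => dPz s x) (fun x _ => expR_ge0 _).
  by rewrite mul0r; lra.
have l0 := lo0 s0; have z0 : 0 < z by rewrite /z; move: lnb1; lra.
have h1 : hi s < z - ln b1 by rewrite /z; lra.
have h2 : hi s < z - ln b2 by rewrite /z; lra.
have out y : hi s < y -> om s y = 0.
  by move=> hy; apply: tom.2; rewrite negb_and -!ltNge hy orbT.
have E : derive1 (velocity b1 b2 (lg om s)) (expR (- z)) = - W s (hi s).
  rewrite derive1_velocity ?expR_gt0// expRK opprK !out// /V !W_right ?ltW//.
  by move: (W _ _) => u; lra.
apply: (@le_trans _ _ `|derive1 (velocity b1 b2 (lg om s)) (expR (- z))|%:E).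
  by rewrite E normrN lee_fin ler_norm.
apply: Linfty_ge; first exact: expNI.
pose f y := - V s (- ln y) + (2 * om s (- ln y - ln b1) - om s (- ln y - ln b2)).
have cf : {for expR (- z), continuous f}.
  have -> : f = (fun u => - V s u + (2 * om s (u - ln b1) - om s (u - ln b2))) \o (fun y => - ln y) by [].
  apply: continuous_comp; first exact: der_cont (der_lnN (expR_gt0 _)).
  apply: (@jc_cont2 _ (fun s u => - V s u + (2 * om s (u - ln b1) - om s (u - ln b2)))).
  have h (c : R) : jc (fun s z => om s (z - c)).
    by apply: (jc_comp jc_om jc_fst); apply: jc_sub; [exact: jc_snd|exact: jc_cst].
  apply: jc_add; first by apply: jc_opp; exact: jcV.
  by apply: jc_sub; [apply: jc_mul; [exact: jc_cst|exact: h]|exact: h].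
have fE y : 0 < y -> derive1 (velocity b1 b2 (lg om s)) y = f y by exact: derive1_velocity.
apply/cvgrPdist_lt => e e0; move/cvgrPdist_lt : cf => /(_ e e0) H.
near=> y; rewrite !fE ?expR_gt0//; first by near: y; exact: H.
near: y; apply: lt_nbhsr; exact: expR_gt0.
Unshelve. all: by end_near. Qed.

(** The rear label [al] never advances, so a bound on the stretching would bound the front, against
    [front_unbounded]. *)
Lemma L_unbounded C : (forall s z, 0 <= s -> L s z <= C) -> False.
Proof.
move=> HL; apply: (@front_unbounded (al + expR C * (be - al))) => s s0.
have h1 := Pal s0.
have : P s be - P s al <= expR C * (be - al).
  by apply: (mvt_le ab (fun x _ => dPz s x)) => x _; rewrite ler_expR; exact: HL.
by lra.
Qed.

Lemma jcPs (c z : R) : continuous (fun s => om s (P s z - c)).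
Proof.
apply: (@jc_cont1 _ (fun s z => om s (P s z - c))).
by apply: (jc_comp jc_om jc_fst); apply: jc_sub => //; exact: jc_cst.
Qed.

Lemma intNy (G : R -> \bar R) : (forall t, 0 < t < Tmax -> (0 <= G t)%E) ->
  (forall C, (\int[@lebesgue_measure R]_(t in `]0%R, Tmax[) G t <= C%:E)%E -> False) ->
  (\int[@lebesgue_measure R]_(t in `]0%R, Tmax[) G t = +oo)%E.
Proof.
move=> G0 H; set I := integral _ _ _.
have I0 : (0 <= I)%E.
  by apply: integral_ge0 => t /=; rewrite in_itv; exact: G0.
apply/eqP; rewrite -leye_eq leNgt; apply/negP => Iy.
have If : I \is a fin_num by rewrite ge0_fin_numE.
by apply: (H (fine I)); rewrite fineK.
Qed.

Let tau_ge0 t : 0 < t < Tmax -> 0 <= tau t.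
Proof. by move=> /andP[t0 tT]; have [] := tau_ex (t := t) ltac:(by rewrite ltW). Qed.

Lemma blow_up : blows_up_at b1 b2 Tmax (fun t => lg om (tau t)) (fun t => lg rh (tau t)).
Proof.
split; apply: intNy => [t _|C HC]; try exact: Linfty_ge0.
(* Half the rate of L is at most omega at one point, since the subtracted term is nonnegative; hence
   the factor 1/2 and the bound [2 C]. *)
- apply: (@L_unbounded (2 * C)) => s z s0.
  have ck : continuous (fun s => (2 * om s (P s z - ln b1) - om s (P s z - ln b2)) * 2^-1).
    move=> x; apply: cvgM; last exact: cvg_cst.
    apply: cvgB; last exact: jcPs.
    by apply: cvgM; [exact: cvg_cst|exact: jcPs].
  have : ((L s z * 2^-1 - L 0 z * 2^-1)%:E <= C%:E)%E.
    apply: le_trans HC.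
    apply: (@tau_int (fun s => L s z * 2^-1) _ _ s s0 ck).
    + move=> u u0; apply: der_eq (der_mul (dL u z) (der_cst 2^-1 u)).
      by rewrite mulr0 addr0 mulrA.
    + by move=> t _; exact: Linfty_ge0.
    + move=> t tT; have u0 := tau_ge0 tT.
      apply: le_trans (om_Linfty (P (tau t) z - ln b1) u0); rewrite lee_fin.
      have := om0 (P (tau t) z - ln b2) u0.
      by move: (om _ _) (om _ _) => u v; lra.
  by rewrite L0 mul0r subr0 lee_fin; lra.
(* The source [rho / x] is dominated by the norm of the slope of rho, so finiteness would bound
   omega by [m0 + C]; as [th <= 1], L would then be bounded too. *)
- have bA s z : 0 <= s -> A s z <= m0 + C.
    move=> s0; have : ((A s z - A 0 z)%:E <= C%:E)%E.
      apply: le_trans HC.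
      apply: (@tau_int (A^~ z) (fun s => rh s (P s z) * expR (P s z)) _ s s0).
      * apply: (@jc_cont1 _ (fun s z => rh s (P s z) * expR (P s z))).
        by apply: jc_mul; [exact: (jc_comp (trh.1 0%N) jc_fst jP)|exact: jc_exp].
      * by move=> u _; exact: dA.
      * by move=> t _; exact: Linfty_ge0.
      * by move=> t /tau_ge0 u0; exact: rh_Linfty.
    by rewrite lee_fin; have := A0 z; lra.
  apply: (@L_unbounded (2 * (m0 + C))) => s z s0.
  have mC : 0 <= m0 + C.
    by apply: le_trans (bA 0 0 (lexx 0)); rewrite -omP om0.
  have : L s z - L 0 z <= 2 * (m0 + C) * th s - 2 * (m0 + C) * th 0.
    apply: (@mono_diff _ (L^~ z) _ (fun s => 2 * (m0 + C) * th s) (fun s => 2 * (m0 + C) * q s) 0 s s0 (fun x _ => dL x z)).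
      by move=> x _; apply: der_cmul; exact: dth.
    move=> x /andP[x0 _]; rewrite mulrC ler_wpM2r ?(ltW (q0 _))//.
    have := om0 (P x z - ln b2) x0; have [y <-] := surj x (P x z - ln b1).
    rewrite omP; have := bA x y x0.
    by move: (om _ _) (A _ _) => u v; lra.
  rewrite L0 th0 mulr0 !subr0 => h; apply: le_trans h _.
  by rewrite ler_piMr ?mulr_ge0// th1.
(* The front moves at speed at most [2 W (hi)], and [W_Linfty] bounds [W (hi)] by the norm of the
   velocity gradient. *)
- apply: (@front_unbounded (be + 2 * C)) => s s0.
  have ck : continuous (fun s => V s (P s be) * 2^-1).
    apply: (@jc_cont1 _ (fun s z => V s (P s be) * 2^-1) 0).
    apply: jc_mul; last exact: jc_cst.
    by apply: (jc_comp jcV jc_fst); apply: (jc_comp jP jc_fst); exact: jc_cst.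
  have : ((P s be * 2^-1 - P 0 be * 2^-1)%:E <= C%:E)%E.
    apply: le_trans HC.
    apply: (@tau_int (fun s => P s be * 2^-1) _ _ s s0 ck).
    + move=> u u0; apply: der_eq (der_mul (dPt u be) (der_cst 2^-1 u)).
      by rewrite mulr0 addr0 mulrA.
    + by move=> t _; exact: Linfty_ge0.
    + move=> t tT; have u0 := tau_ge0 tT.
      apply: le_trans (W_Linfty u0); rewrite lee_fin /V.
      set x := tau t in u0 *.
      have Wmono y y' : y <= y' -> W x y <= W x y'.
        move=> yy; have := mvt_ge (C := 0) yy (fun v _ => dW x v) (fun v _ => om0 v u0).
        by rewrite mul0r subr_ge0.
      have h1 : W x (P x be - ln b1) <= W x (hi x) by apply: Wmono; rewrite hiE gerBl.
      have h2 : 0 <= W x (P x be - ln b2).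
        have [h|h] := leP (P x be - ln b2) (lo x); first by rewrite Wl.
        by rewrite -(Wl (lexx (lo x))); apply: Wmono; exact: ltW.
      by move: h1 h2; move: (W _ _) (W _ _) (W _ _) => v1 v2 v3; lra.
  by rewrite P0 lee_fin; lra.
Qed.

End Assembly.

(** * Choice of the data and conclusion *)

Section Construction.
Context {R : realType}.
Implicit Types (x y z t s d : R) (n k : nat).

(** The slope bound [C] is chosen before [l] and [r]: [eta] depends on [C], and the right end [r] is
    fixed only after [eta]. *)
Lemma plateau : exists2 C : R, 0 <= C & forall l r, exists h h' : R -> R,
  [/\ smooth h, forall z, der h z (h' z), forall z, 0 <= h z <= 1,
      forall z, `|h' z| <= C &
      [/\ forall z, l + 1 <= z <= r -> h z = 1, forall z, ~~ (l < z < r + 1) -> h z = 0 &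
       forall z, ~~ (l < z < l + 1) -> h' z <= 0]].
Proof.
have [sg [sg' [C [ssg dsg sl sr sb]]]] := @smooth_step R.
have C0 : 0 <= C by have [_ _ ? ?] := sb 0; lra.
exists (2 * C) => [|l r]; first by rewrite mulr_ge0.
exists (fun z => sg (z - l) * sg (r + 1 - z)),
  (fun z => sg' (z - l) * sg (r + 1 - z) - sg (z - l) * sg' (r + 1 - z)); split.
- move=> k; apply: Reg_mul; apply: (@Reg_comp _ k (fun _ => sg)) => //.
    by apply: Reg_sub; [exact: Reg_id|exact: Reg_cst].
  by apply: Reg_sub; [exact: Reg_cst|exact: Reg_id].
- move=> z.
  have d1 : der (fun z => sg (z - l)) z (sg' (z - l)) by exact: der_shift.
  have d2 : der (fun z => r + 1 - z) z (0 - 1) by apply: der_sub; [exact: der_cst|exact: der_id].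
  apply: der_eq (der_mul d1 (der_comp (dsg _) d2)).
  by move: (sg _) (sg _) (sg' _) (sg' _) => u1 u2 u3 u4; ring.
- move=> z; have [? ? _ _] := sb (z - l); have [? ? _ _] := sb (r + 1 - z).
  by rewrite mulr_ge0//= mulr_ile1.
- move=> z; have [u0 u1 v0 v1] := sb (z - l); have [u0' u1' v0' v1'] := sb (r + 1 - z).
  have h1 : 0 <= sg' (z - l) * sg (r + 1 - z) <= C.
    by rewrite mulr_ge0//= -[C]mulr1 ler_pM.
  have h2 : 0 <= sg (z - l) * sg' (r + 1 - z) <= C.
    by rewrite mulr_ge0//= -[C]mul1r ler_pM.
  rewrite ler_norml; move: h1 h2 => /andP[? ?] /andP[? ?]; apply/andP; split; lra.
- split=> z.
  + move=> /andP[z1 z2]; have [-> _] := sr (z - l) ltac:(lra).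
    by have [-> _] := sr (r + 1 - z) ltac:(lra); rewrite mulr1.
  + rewrite negb_and -!leNgt => /orP[zl|zr].
      by have [-> _] := sl (z - l) ltac:(lra); rewrite mul0r.
    by have [-> _] := sl (r + 1 - z) ltac:(lra); rewrite mulr0.
  + have [u0 _ _ _] := sb (z - l); have [_ _ v0' _] := sb (r + 1 - z).
    rewrite negb_and -!leNgt => /orP[zl|zr].
      have [-> ->] := sl (z - l) ltac:(lra); rewrite !mul0r; lra.
    have [_ ->] := sr (z - l) ltac:(lra); rewrite mul0r sub0r oppr_le0.
    exact: mulr_ge0.
Qed.

Lemma ep_exists c : 0 <= c -> expR c < 2 -> c <= 1 /\ exists2 ep : R, 0 < ep <= 1 &
  expR ((expR ep + ep) * c) < 2.
Proof.
move=> c0 c2; have c1 : c <= 1 by have := expR_ge1Dx c; move: c2; lra.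
split=> //; have l2 : c < ln 2 by rewrite -ltr_expR lnK ?posrE.
have l1 : ln 2 <= 1 :> R.
  have := ln_sublinear (x := 2 : R) ltac:(lra) => h.
  by rewrite -ler_expR lnK ?posrE//; have := expR_ge1Dx (1 : R); lra.
(* With [e^ep <= 1 + 2 ep] and [c <= 1] the exponent is at most [c + 3 ep], the midpoint of [c] and
   [ln 2]. *)
exists ((ln 2 - c) / 6); first by apply/andP; split; lra.
set ep := _ / 6.
have e2 : expR ep <= 1 + 2 * ep.
  have := expR_ge1Dx (- ep); have e0 := expR_gt0 ep; rewrite expRN => h.
  have : (1 - ep) * expR ep <= 1 by rewrite -ler_pdivlMr// div1r.
  rewrite /ep; move: (expR _) e0 l1 l2 => e *; nra.
have : (expR ep + ep) * c <= (1 + 3 * ep) * c by rewrite ler_wpM2r//; lra.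
have : (1 + 3 * ep) * c <= c + 3 * ep.
  by rewrite mulrDl mul1r lerD2l; rewrite ler_piMr// /ep; lra.
move=> h1 h2; rewrite -[X in _ < X]lnK ?posrE// ltr_expR.
by move: h1 h2; rewrite /ep; lra.
Qed.


Lemma lip_der (h h' : R -> R) C : (forall z, der h z (h' z)) -> (forall z, `|h' z| <= C) ->
  forall z z', `|h z - h z'| <= C * `|z - z'|.
Proof. by move=> dh hC z z'; apply: mvt_dist => // x _; exact: dh. Qed.

Lemma explicit_blow_up (b1 b2 : R) : 0 < b2 -> b2 <= 1 -> 1 <= b1 -> b1 < 2 * b2 ->
  exists w r : R -> R -> R, exists2 T : R, 0 < T &
   [/\ inKoo (w 0), inKoo (r 0), forall n, regular_solution b1 b2 n T (w 0) (r 0) w r &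
       blows_up_at b1 b2 T w r].
Proof.
have le161 : 1 / 16 <= 1 :> R by lra.
move=> b20 b2_le1 b1_ge1 b1_lt.
have b10 : 0 < b1 by lra.
have b21 : b2 <= b1 by lra.
pose a := ln b1; pose b := - ln b2.
have a0 : 0 <= a by exact: ln_ge0.
have b0 : 0 <= b by rewrite oppr_ge0 ln_le0.
have ab2 : expR (a + b) < 2.
  by rewrite expRD expRN !lnK ?posrE// ltr_pdivrMr.
have [ab1 [ep /andP[ep0 ep1] gab]] := ep_exists (addr_ge0 a0 b0) ab2.
pose g := expR ep + ep.
have kap0 : 0 < 2 * expR (- (g * a)) - expR (g * b) by exact: (@kap_gt0 _ a b g).
have [C C0 plat] := plateau.
have e12 : 0 < expR 12 :> R by exact: expR_gt0.
(* The height makes [eta * C * expR 12 <= ep / 2], the slope condition on [6, 7]; the [+ 1] also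
   gives [eta * expR 12 <= 1]. *)
pose eta := ep / 2 / (C + 1) / expR 12.
have eta0 : 0 < eta by rewrite /eta !divr_gt0//; lra.
have etaC : eta * (C + 1) * expR 12 = ep / 2 by rewrite /eta; field; rewrite gt_eqF//=; lra.
pose c0 : R := 32^-1 * 32^-1 * 2^-1.
have c00 : 0 < c0 by rewrite /c0 !mulr_gt0 ?invr_gt0.
pose D := (2 * expR (- (g * a)) - expR (g * b)) * eta * c0.
have D0 : 0 < D by exact: mulr_gt0 (mulr_gt0 kap0 eta0) c00.
(* Chosen so that [e^(r - 2) >= 1 + (r - 2) >= 6 / D], the size needed to start the cascade. *)
pose r := 8 + 6 / D.
have r8 : 8 <= r by rewrite /r lerDl divr_ge0// ltW.
have al_be : 2 <= r + 1 by apply: (@le_trans _ _ 8); [rewrite ler_nat|rewrite (le_trans r8)// lerDl].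
have r_big : 6 <= (2 * expR (- (g * a)) - expR (g * b)) * eta * expR (r - 2) * c0.
  have h : 6 / D <= expR (r - 2) by have := expR_ge1Dx (r - 2); rewrite /r; lra.
  by move: h; rewrite ler_pdivrMr// /D; move: (expR (r - 2)) => u; lra.
clearbody r.
have [w0 [w0' [sw0 dw0 w0_01 w0'C [w0_1 w0o w0'_le0]]]] := plat 2 r.
have w0_1' z : 3 <= z <= r -> w0 z = 1.
  by move=> /andP[? ?]; apply: w0_1; apply/andP; split; lra.
have w0'l z : 3 <= z -> w0' z <= 0.
  move=> z3; apply: w0'_le0; apply/negP => /andP[_]; lra.
(* rho starts only at label 6, well inside the plateau of omega, and ends with it at [r + 1]. *)
have [h [h' [sh dh h_01 h'C [h_1 ho h'_le0]]]] := plat 6 r.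
pose r0 z := eta * h z; pose r0' z := eta * h' z.
have sr0 : smooth r0 by move=> k; apply: Reg_mul => //; exact: Reg_cst.
have dr0 z : der r0 z (r0' z) by exact: der_cmul.
have r0_ge0 z : 0 <= r0 z by have /andP[? ?] := h_01 z; rewrite mulr_ge0// ltW.
have r0_le z : r0 z <= eta by have /andP[? ?] := h_01 z; rewrite ler_piMr// ltW.
have r0'C z : `|r0' z| <= eta * C by rewrite normrM gtr0_norm// ler_wpM2l// ltW.
have r0o z : ~~ (2 < z < r + 1) -> r0 z = 0.
  move=> zo; rewrite /r0 ho ?mulr0//; apply: contra zo => /andP[z6 ->].
  by rewrite andbT; lra.
have etaE : eta * expR 12 <= 1.
  have : eta * expR 12 <= eta * (C + 1) * expR 12 by rewrite ler_wpM2r ?(ltW e12)// ler_peMr// ?(ltW eta0)//; lra.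
  by rewrite etaC; lra.
have r0_small z : r0 z * expR 12 <= 1.
  by apply: le_trans etaE; rewrite ler_wpM2r// ltW.
have r0'_small z : r0' z * expR 12 <= ep / 2.
  rewrite -etaC ler_wpM2r ?(ltW e12)//; apply: le_trans (ler_norm _) _.
  by apply: le_trans (r0'C z) _; rewrite ler_wpM2l ?(ltW eta0)//; lra.
have r0_left z : z <= 6 -> r0 z = 0.
  by move=> z6; rewrite /r0 ho ?mulr0// ltNge z6.
have r0_eta z : 7 <= z <= r -> r0 z = eta.
  by move=> /andP[z7 zr]; rewrite /r0 h_1 ?mulr1// zr andbT; lra.
have r0'_le0 z : ~~ (6 <= z <= 7) -> 3 <= z -> r0' z <= 0.
  move=> zo _; rewrite /r0' mulr_ge0_le0 ?(ltW eta0)// h'_le0//.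
  by apply: contra zo => /andP[z6 z7]; apply/andP; split; lra.
clear etaC etaE; clearbody eta r0 r0'.
have w0b z : `|w0 z| <= 1 by have /andP[? ?] := w0_01 z; rewrite ger0_norm.
have r0b z : `|r0 z| <= eta by rewrite ger0_norm.
have w0l := lip_der dw0 w0'C.
have r0l := lip_der dr0 r0'C.
pose P := Phi a b 2 (r + 1) w0 r0.
have [jP bP] : adm 1 eta P := Phi_adm a b0 w0b r0b w0l r0l w0o r0o.
have fP t z : Tf a b 2 (r + 1) w0 r0 P t z = P t z := Phi_fix a b0 w0b r0b w0l r0l w0o r0o t z.
have Lm := Lam_mono w0b r0b.
have GB t z := Gf_bound a b (r + 1) w0b r0b (conj jP bP) t z.
have KM s t := @Kb_mono R 1 eta r0 r0b s t.
clearbody P.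
pose q := qf (r + 1) P; pose th t := prim q 0 t; pose om := omf (r + 1) w0 r0 P.
pose A := Af (r + 1) w0 r0 P; pose L := Lf a b (r + 1) w0 r0 P.
pose W := Wf 2 (r + 1) w0 r0 P; pose rh := rhf r0 P.
pose E t z := prim (fun s => q s * expR (P s z)) 0 t.
pose Ez t z := prim (fun s => q s * expR (P s z) * expR (L s z)) 0 t.
have q0 s : 0 < q s by exact: qf_gt0.
have cq : continuous q by exact: q_cont jP.
have jq : jc (fun s _ => q s) by exact: jc_qf.
have dth t : der th t (q t) by exact: der_prim.
have th0 : th 0 = 0 by exact: prim_refl.
have Pz z : P 0 z = z := P0 Lm jP bP fP sw0 sr0 r0o z.
have dPz t z : der (P t) z (expR (L t z)) := der_P Lm jP bP fP sw0 sr0 r0o t z.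
have Lz z : L 0 z = 0 by exact: L0.
have dL t z : der (L^~ z) t (q t * (2 * om t (P t z - a) - om t (P t z + b))) :=
  der_L Lm jP bP fP sw0 sr0 r0o t z.
have dPt t z : der (P^~ z) t (q t * (2 * W t (P t z - a) - W t (P t z + b))) :=
  der_Pt a0 Lm jP bP fP sw0 sr0 w0o r0o t z.
have dW t x : der (W t) x (om t x) := der_W Lm jP bP fP sw0 sr0 r0o t x.
have Wl t x : x <= P t 2 -> W t x = 0 by exact: (W_left Lm jP bP fP sw0 sr0 w0o r0o).
have omP t z : om t (P t z) = A t z := om_P (r + 1) w0 r0 jP bP t z.
have surj t x : exists z, P t z = x by exists (inv P t x); exact: invK jP bP.
have AE t z : A t z = w0 z + r0 z * E t z := AfE w0 bP r0o t z.
have Ei z : E 0 z = 0 by exact: prim_refl.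
have Ezi z : Ez 0 z = 0 by exact: prim_refl.
have jE : jc (fun s z => q s * expR (P s z)) by apply: jc_mul => //; exact: jc_exp.
have jL : jc L := Reg_jc (reg_L Lm jP bP fP sw0 sr0 r0o 0).
have jEz : jc (fun s z => q s * expR (P s z) * expR (L s z)).
  by apply: jc_mul => //; exact: jc_exp.
have dE t z : der (E^~ z) t (q t * expR (P t z)).
  by apply: (@der_prim _ (fun s => q s * expR (P s z))); exact: jc_cont1 jE.
have dEzt t z : der (Ez^~ z) t (q t * expR (P t z) * expR (L t z)).
  by apply: (@der_prim _ (fun s => q s * expR (P s z) * expR (L s z))); exact: jc_cont1 jEz.
have dEz t z : der (E t) z (Ez t z).
  apply: (der_prim_par 0 t z jE jEz) => s x.
  apply: (der_eq _ (der_cmul (q s) (der_exp (dPz s x)))).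
  by rewrite -mulrA [expR (L s x) * _]mulrC.
have GM (S : R) : exists M : R, forall s z, 0 <= s <= S ->
    `|q s * (2 * om s (P s z - a) - om s (P s z + b))| <= M.
  exists (3 * Kb 1 eta S) => s z /andP[s0 sS]; apply: le_trans (GB s z) _.
  by rewrite ler_wpM2l// KM// !ger0_norm// (le_trans s0).
have w0_ge0 z : 0 <= w0 z by have /andP[] := w0_01 z.
have w0_le1 z : w0 z <= 1 by have /andP[] := w0_01 z.
have th_lt t : 0 <= t -> th t < 1 / 16.
  exact: (th_small a0 b0 ab1 ep0 (erefl g) gab r8 w0_ge0 w0_le1 w0_1' dw0 w0'l r0_ge0 r0_small
    dr0 r0'_le0 r0'_small r0_left eta0 r0_eta q0 dth th0 Pz dPz Lz dL dPt dW Wl omP surj AE Ei dE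
    Ezi dEz dEzt GM r_big).
have th1 t : 0 <= t -> th t <= 1 by move=> /th_lt/ltW/le_trans; apply.
have lo0 t : 0 <= t -> 0 < P t 2.
  move=> t0; apply: (@lt_le_trans _ _ 1) => //.
  exact: (P2_ge a0 b0 ab1 ep0 (erefl g) gab r8 w0_ge0 w0_le1 w0_1' dw0 w0'l r0_ge0 r0_small
    dr0 r0'_le0 r0'_small r0_left q0 dth th0 Pz dPz Lz dL dPt dW Wl omP surj AE Ei dE
    Ezi dEz dEzt GM t0 (ltW (th_lt t t0))).
have P2 t : 0 <= t -> P t 2 <= 2.
  exact: (P2_le a0 w0_ge0 r0_ge0 q0 Pz dPt dW Wl omP surj AE Ei dE).
have omp t x : 0 <= t -> 0 <= om t x.
  exact: (om_ge0 w0_ge0 r0_ge0 q0 omP surj AE Ei dE).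
pose lo t := P t 2; pose hi t := P t (r + 1).
have clo : continuous lo by exact: jc_cont1.
have chi : continuous hi by exact: jc_cont1.
have outs s z : ~~ (lo s <= z <= hi s) -> ~~ (P s 2 < z < P s (r + 1)).
  by apply: contra => /andP[/ltW z1 /ltW z2]; rewrite z1.
have tom : tame lo hi om.
  split; first exact: (reg_om Lm jP bP fP sw0 sr0 r0o).
  by move=> s z /outs; exact: (om_out jP bP w0o r0o).
have trh : tame lo hi rh.
  split; first exact: (reg_rh Lm jP bP fP sw0 sr0 r0o).
  by move=> s z /outs; exact: (rh_out jP bP r0o).
have [omx _ dom] := om_pde a0 Lm jP bP fP sw0 sr0 w0o r0o.
have [rhx _ drh] := rh_pde a0 Lm jP bP fP sw0 sr0 w0o r0o.
have sol n := solution b20 b21 clo chi tom trh (fun s z => (dom s z).1) (fun s z => (dom s z).2)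
  (fun s z => (drh s z).1) (fun s z => (drh s z).2) dW Wl lo0 q0 dth th0 th1 n.
have tz := tau0 q0 dth th0.
exists (fun t => lg om (tau th t)), (fun t => lg rh (tau th t)), (Tmax th); first exact: Tmax_gt0.
rewrite tz; split.
- by move=> n _; apply: (tame_inK n tom); exact: lo0.
- by move=> n _; apply: (tame_inK n trh); exact: lo0.
- exact: sol.
- have jW : jc W.
    have jom : jc om := Reg_jc (tom.1 0%N).
    have cont_om s : continuous (om s) by exact: jc_cont2.
    have jp : jc (fun s z => prim (om s) 0 z) by exact: jc_prim2.
    (* The base point [P s 2] of [W] moves with time; rewriting from the fixed base 0 gives joint
       continuity. *)
    apply: (@jc_ext _ (fun s z => prim (om s) 0 z - prim (om s) 0 (P s 2))) => [s z|].
      rewrite (prim_eq (F := W s) 0 z (cont_om s) (dW s)).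
      by rewrite (prim_eq (F := W s) 0 _ (cont_om s) (dW s)) [W s (P s 2)]Wl//; ring.
    apply: jc_sub => //; apply: (jc_comp jp jc_fst).
    by apply: (jc_comp jP jc_fst); exact: jc_cst.
  have dA s z : der (A^~ z) s (q s * (rh s (P s z) * expR (P s z))).
    by rewrite /rh (rh_P _ jP bP); apply: der_eq (der_A w0 jP bP r0o s z); rewrite mulrCA.
  have A1 z : A 0 z <= 1 by rewrite /A (A0 _ bP r0o).
  have omhi s : om s (hi s) = 0 by apply: (om_out jP bP w0o r0o); rewrite ltxx andbF.
  exact: (blow_up b20 b21 tom trh dW Wl lo0 q0 dth th0 th1 al_be a0 (fun=> erefl) (fun=> erefl)
    (fun=> erefl) jP jW dPz dPt dL Lz Pz dA A1 omP surj omp omhi P2).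
Qed.

Lemma eq_blows_up (b1 b2 T : R) (w w' r r' : R -> R -> R) :
  (forall t, 0 <= t < T -> w t = w' t) -> (forall t, 0 <= t < T -> r t = r' t) ->
  blows_up_at b1 b2 T w' r' -> blows_up_at b1 b2 T w r.
Proof.
move=> ew er [h1 h2 h3]; have tT t : t \in `]0, T[ -> 0 <= t < T.
  by rewrite in_itv/= => /andP[/ltW -> ->].
split; [rewrite -h1|rewrite -h2|rewrite -h3]; apply: eq_integral => t; rewrite inE/= => /tT tT';
  by rewrite ?ew ?er.
Qed.

End Construction.

Theorem theorem2 (R : realType) (b1 b2 : R) (b2_gt0 : 0 < b2) (b2_le1 : b2 <= 1)
    (b1_ge1 : 1 <= b1) (b1_lt : b1 < 2 * b2) :
  exists w0 r0 : R -> R, inKoo w0 /\ inKoo r0 /\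
    exists T : R, 0 < T /\ forall n : nat, (1 <= n)%N ->
      (exists w r : R -> R -> R, regular_solution b1 b2 n T w0 r0 w r) /\
      (forall w r : R -> R -> R, regular_solution b1 b2 n T w0 r0 w r ->
        blows_up_at b1 b2 T w r).
Proof.
have b21 : b2 <= b1 by exact: le_trans b1_ge1.
have [w [r [T T0 [Kw Kr sol blow]]]] := explicit_blow_up b2_gt0 b2_le1 b1_ge1 b1_lt.
exists (w 0), (r 0); split; [exact: Kw|split; first exact: Kr].
exists T; split; [exact: T0|move=> n n1].
split; first by exists w, r.
move=> w' r' sol'; apply: eq_blows_up blow => t tT; apply/funext => x.
  by have [] := unique b2_gt0 b21 n1 (sol n) sol' x tT.
by have [] := unique b2_gt0 b21 n1 (sol n) sol' x tT.
Qed.
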